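(* Let $d\ge 1$, $N\in\mathbf N$ and consider $$\mathcal H_\mu=\frac{|I|^2}{2}+\frac{p^2}{2}+(\cos q-1)+\mu f(I,\varphi,p,q,t),\qquad (I,\varphi,p,q,t)\in\mathbf R^d\times\mathbf T^d\times\mathbf R\times\mathbf T\times\mathbf T,$$ where $f(I,\varphi,p,q,t)=\sum_{|(n,l)|\le N} f_{n,l}(I,p,q)e^{\mathrm i(n\cdot\varphi+lt)}$ is a real trigonometric polynomial in $(\varphi,t)$ whose coefficients $f_{n,l}$ are analytic functions (with $\overline{f_{n,l}}=f_{-n,-l}$). The associated system $(\mathcal S_\mu)$ is $$\dot\varphi=I+\mu\partial_I f,\quad \dot I=-\mu\partial_\varphi f,\quad \dot q=p+\mu\partial_p f,\quad \dot p=\sin q-\mu\partial_q f.$$ Then for all $\kappa,\overline r,\widetilde r>0$ there exist $\mu_1,\kappa_0>0$ such that for all $0<\mu\le\mu_1$ and every solution $(I(t),\varphi(t),p(t),q(t))$ of $(\mathcal S_\mu)$ with $|I(0)|\le\overline r$ and $|p(0)|\le\widetilde r$, $$|I(t)-I(0)|\le\kappa\qquad\text{for all } t \text{ with } |t|\le\frac{\kappa_0}{\mu}\ln\frac1\mu .$$ *)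

(* Defs.v *)
From Stdlib Require Import Reals ZArith.
From Coquelicot Require Import Coquelicot.
From mathcomp Require Import ssreflect ssrfun ssrbool eqtype ssrnat seq fintype finfun bigop.

Set Implicit Arguments.
Unset Strict Implicit.

Open Scope R_scope.

Definition vec (d : nat) := 'I_d -> R.

Definition enorm (d : nat) (x : vec d) : R :=
  sqrt (\big[Rplus/0]_(j < d) (x j * x j)).

Definition vsub (d : nat) (x y : vec d) : vec d := fun j => x j - y j.

Definition upd (d : nat) (x : vec d) (j : 'I_d) (s : R) : vec d :=
  fun k => if k == j then s else x k.

Definition zdot (d : nat) (n : 'I_d -> Z) (x : vec d) : R :=
  \big[Rplus/0]_(j < d) (IZR (n j) * x j).

Definition freq_norm (d : nat) (n : 'I_d -> Z) (l : Z) : nat :=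
  (\sum_(j < d) Z.abs_nat (n j) + Z.abs_nat l)%nat.

Definition zof (N : nat) (k : 'I_(N + N).+1) : Z := (Z.of_nat k - Z.of_nat N)%Z.

Definition monom (d : nat) (x y : vec d) (p0 p q0 q : R)
  (alpha : 'I_d -> nat) (beta gamma : nat) : R :=
  (\big[Rmult/1]_(j < d) ((y j - x j) ^ alpha j)) * (p - p0) ^ beta * (q - q0) ^ gamma.

Definition box_sum (d : nat) (F : ('I_d -> nat) -> nat -> nat -> R) (K : nat) : R :=
  \big[Rplus/0]_(alpha : {ffun 'I_d -> 'I_K.+1})
    \big[Rplus/0]_(beta < K.+1) \big[Rplus/0]_(gamma < K.+1)
      F (fun j => nat_of_ord (alpha j)) beta gamma.

Definition real_analytic (d : nat) (g : vec d -> R -> R -> R) : Prop :=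
  forall (x : vec d) (p0 q0 : R),
  exists (r : R) (a : ('I_d -> nat) -> nat -> nat -> R),
    0 < r /\
    forall (y : vec d) (p q : R),
      (forall j, Rabs (y j - x j) < r) -> Rabs (p - p0) < r -> Rabs (q - q0) < r ->
      (exists M : R, forall K,
          box_sum (fun al be ga => Rabs (a al be ga * monom x y p0 p q0 q al be ga)) K <= M)
      /\ is_lim_seq (box_sum (fun al be ga => a al be ga * monom x y p0 p q0 q al be ga))
                    (g y p q).

(* The perturbation
     f(I,phi,p,q,t) = sum_{|(n,l)| <= N} f_{n,l}(I,p,q) e^{i(n.phi + l t)}
   with complex coefficients f_{n,l} = fre n l + i fim n l.  Under the
   reality condition  conj f_{n,l} = f_{-n,-l}  the sum is real and equals
   its real part, which is what we compute. *)
Definition trig_f (d N : nat) (fre fim : ('I_d -> Z) -> Z -> vec d -> R -> R -> R)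
  (I phi : vec d) (p q t : R) : R :=
  \big[Rplus/0]_(k : {ffun 'I_d -> 'I_(N + N).+1})
    \big[Rplus/0]_(l0 < (N + N).+1 | (freq_norm (fun j => zof (k j)) (zof l0) <= N)%nat)
      (let n := fun j => zof (k j) in
       let l := zof l0 in
       let th := zdot n phi + IZR l * t in
       fre n l I p q * cos th - fim n l I p q * sin th).

Definition dI (d : nat) (F : vec d -> vec d -> R -> R -> R -> R)
  (I phi : vec d) (p q t : R) (j : 'I_d) : R :=
  Derive (fun s => F (upd I j s) phi p q t) (I j).
Definition dphi (d : nat) (F : vec d -> vec d -> R -> R -> R -> R)
  (I phi : vec d) (p q t : R) (j : 'I_d) : R :=
  Derive (fun s => F I (upd phi j s) p q t) (phi j).
Definition dp (d : nat) (F : vec d -> vec d -> R -> R -> R -> R)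
  (I phi : vec d) (p q t : R) : R :=
  Derive (fun s => F I phi s q t) p.
Definition dq (d : nat) (F : vec d -> vec d -> R -> R -> R -> R)
  (I phi : vec d) (p q t : R) : R :=
  Derive (fun s => F I phi p s t) q.

(* (I, phi, p, q) solves (S_mu) on the open interval ]a, b[
   (angles phi, q lifted to R). *)
Definition solves (d : nat) (F : vec d -> vec d -> R -> R -> R -> R) (mu a b : R)
  (I phi : R -> vec d) (p q : R -> R) : Prop :=
  forall t, a < t < b ->
    (forall j, is_derive (fun s => phi s j) t (I t j + mu * dI F (I t) (phi t) (p t) (q t) t j)) /\
    (forall j, is_derive (fun s => I s j) t (- (mu * dphi F (I t) (phi t) (p t) (q t) t j))) /\
    is_derive q t (p t + mu * dp F (I t) (phi t) (p t) (q t) t) /\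
    is_derive p t (sin (q t) - mu * dq F (I t) (phi t) (p t) (q t) t).

(* Main.v *)
(* Let E = p^2/2 + cos q - 1. Along an orbit I and E change only through the
   integrals of mu c_i, where c_i is a harmonic of f with phase th_i of
   frequency u_i = n_i . I + l_i up to O(mu).

   Away from the separatrix, |E| >= 1/G where G is a small inverse power of mu,
   the pendulum is periodic with a period T(E), and a corrector (the explicit
   periodic solution of the cohomological equation) shows that a harmonic
   produces no drift unless u_i T is within a power of 1/G of 2 PI Z. On the
   remaining resonances u_i = 2 PI m_i / T(E). The drift of I is then a
   combination of the resonant n_i, and conservation of the total energy
   H = |I|^2/2 + E, corrected by the l_i, gives |dI|^2 = sum da_i du_i and
   dE = - sum da_i u_i. As 1/T^2 is a strictly concave function of E, these
   relations at three energies force the drift to be small.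

   Near the separatrix the integral of |p| + |sin (q/2)| over a window of
   length c ln (1/mu) is bounded, so that a harmonic with |u_i| bounded below
   drifts by O(mu) per window, hence by a small amount during
   (kappa0/mu) ln (1/mu), and the resonances u_i = 0 are stopped by the
   convexity of |I|^2/2.

   The set of active resonances can change along the orbit; a chain of scales,
   one for each number of resonances, handles this by induction. *)
Require Import Defs.
From Stdlib Require Import Reals ZArith Lra Lia Classical ClassicalEpsilon FunctionalExtensionality.
From Coquelicot Require Import Coquelicot Compactness.
From HB Require Import structures.
From mathcomp Require Import ssreflect ssrfun ssrbool eqtype ssrnat seq fintype finfun finset bigop.

Set Implicit Arguments.
Unset Strict Implicit.

Open Scope R_scope.

(** * Finite sums *)

(** Why three energies settle the far case: on exact resonances [u_i = M_i w] with [w = 1 / T], the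
    drift of I lies in the span of the resonant [n_i], on which dI/dw is then a constant vector. So
    |dI|^2 = c dw^2 for a constant c, and the two relations become dE = - c d(w^2) / 2: along the
    drift 1/T^2 would be affine in E, against strict concavity.

    The obstacle is that the period, the small divisors and the Lipschitz constants of the
    correctors all degenerate at the separatrix. Each loss is a power of [G], and [G] is so small a
    power of 1/mu that [mu * G ^ m <= 1] for the total exponent [m]; hence exponents are counted
    generously and never optimised. In this regime the time costs only [mu * (b - a) <= G], far more
    than is needed. The time scale of the theorem comes from the neighbourhood of the separatrix:
    there each window of length c ln (1/mu) costs O(mu), and the smallness of the sum has to come
    from [kappa0]. *)

HB.instance Definition _ := Monoid.isComLaw.Build R 0 Rplus
  (fun x y z : R => Logic.eq_sym (Rplus_assoc x y z)) Rplus_comm Rplus_0_l.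

Definition rsum (T : finType) (F : T -> R) : R := \big[Rplus/0]_(i : T) F i.

Section FiniteSums.
Variable T : finType.
Implicit Types F H : T -> R.

Lemma rsum_ext F H : (forall i, F i = H i) -> rsum F = rsum H.
Proof. by move=> FH; apply: eq_bigr => i _. Qed.

Lemma rsum_add F H : rsum (fun i => F i + H i) = rsum F + rsum H.
Proof. exact: big_split. Qed.

Lemma rsum_scal c F : rsum (fun i => c * F i) = c * rsum F.
Proof.
rewrite /rsum; elim/big_rec2: _ => [|i x y _ ->]; first by rewrite Rmult_0_r.
by rewrite Rmult_plus_distr_l.
Qed.

Lemma rsum_opp F : rsum (fun i => - F i) = - rsum F.
Proof.
rewrite (@rsum_ext _ (fun i => -1 * F i)); last by move=> i; ring.
rewrite rsum_scal; ring.
Qed.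

Lemma rsum_sub F H : rsum (fun i => F i - H i) = rsum F - rsum H.
Proof. by rewrite rsum_add rsum_opp. Qed.

Lemma rsum_le F H : (forall i, F i <= H i) -> rsum F <= rsum H.
Proof.
move=> FH; rewrite /rsum; elim/big_rec2: _ => [|i x y _ h]; first lra.
by have := FH i; lra.
Qed.

Lemma rsum_ge0 F : (forall i, 0 <= F i) -> 0 <= rsum F.
Proof.
move=> F0; rewrite /rsum; elim/big_rec: _ => [|i x _ h]; first lra.
by have := F0 i; lra.
Qed.

Lemma rsum_abs F : Rabs (rsum F) <= rsum (fun i => Rabs (F i)).
Proof.
rewrite /rsum; elim/big_rec2: _ => [|i x y _ h]; first by rewrite Rabs_R0; lra.
by apply: Rle_trans (Rabs_triang _ _) _; lra.
Qed.

Lemma rsum_const c : rsum (fun _ : T => c) = INR #|T| * c.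
Proof.
rewrite /rsum big_const; elim: #|T| => [|k IH]; first by rewrite Rmult_0_l.
by rewrite iterS IH S_INR; ring.
Qed.

Lemma rsum_bound F C : (forall i, Rabs (F i) <= C) -> Rabs (rsum F) <= INR #|T| * C.
Proof.
by move=> h; apply: Rle_trans (rsum_abs F) _; rewrite -rsum_const; apply: rsum_le.
Qed.

Lemma rsum_term F j : (forall i, 0 <= F i) -> F j <= rsum F.
Proof.
move=> F0; rewrite /rsum (bigD1 j) //=.
suff: 0 <= \big[Rplus/0]_(i | i != j) F i by lra.
elim/big_rec: _ => [|i x _ h]; first lra.
by have := F0 i; lra.
Qed.

Lemma is_derive_rsum (F : T -> R -> R) (dF : T -> R) t :
  (forall i, is_derive (F i) t (dF i)) ->
  is_derive (fun s => rsum (fun i => F i s)) t (rsum dF).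
Proof.
move=> h; rewrite /rsum.
elim: (index_enum T) => [|i s IH].
  rewrite big_nil; apply: (is_derive_ext (fun=> 0)); last exact: is_derive_const.
  by move=> u; rewrite big_nil.
rewrite big_cons.
apply: (is_derive_ext (fun u => F i u + \big[Rplus/0]_(j <- s) F j u)).
  by move=> u; rewrite big_cons.
exact: (is_derive_plus _ _ _ _ _ (h i) IH).
Qed.

Lemma continuous_rsum (F : T -> R -> R) t :
  (forall i, continuous (F i) t) -> continuous (fun s => rsum (fun i => F i s)) t.
Proof.
move=> h; rewrite /rsum.
elim: (index_enum T) => [|i s IH].
  apply: (continuous_ext (fun=> 0)); last exact: continuous_const.
  by move=> u; rewrite big_nil.
apply: (continuous_ext (fun u => F i u + \big[Rplus/0]_(j <- s) F j u)).
  by move=> u; rewrite big_cons.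
exact: (continuous_plus (V := R_NormedModule) _ _ _ (h i) IH).
Qed.

End FiniteSums.

Lemma rsum_exchange (T U : finType) (F : T -> U -> R) :
  rsum (fun i => rsum (F i)) = rsum (fun j => rsum (fun i => F i j)).
Proof. exact: exchange_big. Qed.

(** * Real analysis on an interval *)

Lemma le_of_eps (x y : R) : (forall e, 0 < e -> x <= y + e) -> x <= y.
Proof.
move=> h; apply: Rnot_lt_le => yx.
by have := h ((x - y) / 2) ltac:(lra); lra.
Qed.

(** A mean value inequality for functions that are only known to be Lipschitz at each point: a
    corrector is never shown to be differentiable along an orbit. The supremum of the times up to
    which the bound with slope [C + e] holds belongs to them, and could be increased if it were less
    than [b]. *)
Lemma dini_bound (F : R -> R) (a b C : R) : a <= b ->
  (forall t, a <= t <= b -> forall e, 0 < e -> exists dl, 0 < dl /\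
     forall s, a <= s <= b -> Rabs (s - t) < dl ->
       Rabs (F s - F t) <= (C + e) * Rabs (s - t)) ->
  Rabs (F b - F a) <= C * (b - a).
Proof.
move=> ab hF; apply: le_of_eps => e0 e0_gt0.
have [e [e_gt0 ee0]] : exists e, 0 < e /\ e * (b - a) <= e0.
  exists (e0 / (b - a + 1)); split; first by apply: Rdiv_lt_0_compat; lra.
  have -> : e0 / (b - a + 1) * (b - a) = e0 * ((b - a) / (b - a + 1)) by field; lra.
  have : (b - a) / (b - a + 1) <= 1 by apply/Rle_div_l; lra.
  by move=> ?; nra.
suff : Rabs (F b - F a) <= (C + e) * (b - a) by lra.
pose E t := a <= t <= b /\ Rabs (F t - F a) <= (C + e) * (t - a).
have Ea : E a by split; [lra | rewrite !Rminus_diag Rabs_R0; lra].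
have Eb : bound E by exists b => t [[]].
have [m [m_ub m_lub]] := completeness E Eb (ex_intro _ a Ea).
have am : a <= m by exact: m_ub.
have mb : m <= b by apply: m_lub => t [[]].
have [dl [dl_gt0 hdl]] := hF m (conj am mb) e e_gt0.
have [t [Et mt]] : exists t, E t /\ m - dl < t.
  apply: NNPP => h; have : m <= m - dl; last lra.
  apply: m_lub => t Et; apply: Rnot_lt_le => ?; apply: h; by exists t.
have tm : t <= m by exact: m_ub.
have Em : E m.
  case: Et => [[at_ tb] ht]; split=> //.
  have := hdl t (conj at_ tb); rewrite Rabs_minus_sym (Rabs_minus_sym (F t)).
  rewrite (Rabs_pos_eq (m - t)); last lra.
  move=> /(_ ltac:(lra)) h1.
  have -> : F m - F a = (F m - F t) + (F t - F a) by ring.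
  by apply: Rle_trans (Rabs_triang _ _) _; lra.
case: (Rle_lt_or_eq_dec _ _ mb) => [mb'|<-]; last by case: Em.
pose s := Rmin b (m + dl / 2).
have sb : s <= b by exact: Rmin_l.
have sm : m < s by apply: Rmin_glb_lt; lra.
have sd : s <= m + dl / 2 by exact: Rmin_r.
suff /m_ub : E s by lra.
case: Em => _ hm; split; first lra.
have := hdl s; rewrite (Rabs_pos_eq (s - m)); last lra.
move=> /(_ ltac:(lra) ltac:(lra)) h1.
have -> : F s - F a = (F s - F m) + (F m - F a) by ring.
by apply: Rle_trans (Rabs_triang _ _) _; lra.
Qed.

Lemma continuous_eps (f : R -> R) (t : R) : continuous f t ->
  forall e, 0 < e -> exists dl, 0 < dl /\ forall s, Rabs (s - t) < dl -> Rabs (f s - f t) < e.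
Proof.
move=> cf e e_gt0.
have [dl hdl] := proj1 (filterlim_locally _ _) cf (mkposreal e e_gt0).
exists dl; split; first exact: cond_pos.
by move=> s hs; exact: (hdl s hs).
Qed.

(** Continuity method: the times up to which [phi <= r] holds form a closed set, and the improved
    bound [r / 2] leaves room to go further. *)
Lemma bootstrap_right (phi : R -> R) (a b r : R) : 0 < r -> phi a <= r / 2 ->
  (forall t, a <= t <= b -> continuous phi t) ->
  (forall t, a <= t <= b -> (forall s, a <= s <= t -> phi s <= r) -> phi t <= r / 2) ->
  forall t, a <= t <= b -> phi t <= r / 2.
Proof.
move=> r_gt0 phia cphi step t0 t0ab.
suff h : forall s, a <= s <= b -> phi s <= r.
  by apply: step => // s hs; apply: h; lra.
have ab : a <= b by lra.
pose E t := a <= t <= b /\ forall s, a <= s <= t -> phi s <= r.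
have Ea : E a.
  split; [lra | move=> s hs].
  have -> : s = a by lra.
  lra.
have Eb : bound E by exists b => t [[]].
have [m [m_ub m_lub]] := completeness E Eb (ex_intro _ a Ea).
have am : a <= m by exact: m_ub.
have mb : m <= b by apply: m_lub => t [[]].
have below s : a <= s < m -> phi s <= r.
  move=> [as_ sm]; apply: NNPP => hs.
  have : m <= s; last lra.
  apply: m_lub => t [[at_ tb] ht]; apply: Rnot_lt_le => st.
  by apply: hs; apply: ht; lra.
have phim : phi m <= r / 2.
  case: (Rle_lt_or_eq_dec _ _ am) => [am'|<-] //.
  apply: step => [|s [as_ sm]]; first lra.
  case: (Rle_lt_or_eq_dec _ _ sm) => [sm'|->]; first exact: below.
  apply: le_of_eps => e e_gt0.
  have [dl [dl_gt0 hdl]] := continuous_eps (cphi m ltac:(lra)) e_gt0.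
  pose u := Rmax a (m - dl / 2).
  have um : u < m by apply: Rmax_lub_lt; lra.
  have au : a <= u by exact: Rmax_l.
  have du : m - dl / 2 <= u by exact: Rmax_r.
  have := hdl u; rewrite Rabs_minus_sym Rabs_pos_eq; last lra.
  move=> /(_ ltac:(lra)) /Rabs_def2 h1.
  have := below u ltac:(lra); lra.
have [dl [dl_gt0 hdl]] := continuous_eps (cphi m ltac:(lra)) (e := r / 2) ltac:(lra).
suff -> : b = m.
  move=> s [as_ sm]; case: (Rle_lt_or_eq_dec _ _ sm) => [sm'|->]; last lra.
  exact: below.
case: (Rle_lt_or_eq_dec _ _ mb) => // mb'.
pose s := Rmin b (m + dl / 2).
have sb : s <= b by exact: Rmin_l.
have sm : m < s by apply: Rmin_glb_lt; lra.
have sd : s <= m + dl / 2 by exact: Rmin_r.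
suff /m_ub : E s by lra.
split=> [|u [au us]]; first lra.
case: (Rlt_le_dec u m) => um; first exact: below.
have := hdl u; rewrite Rabs_pos_eq; last lra.
by move=> /(_ ltac:(lra)) /Rabs_def2; lra.
Qed.

Lemma bootstrap (phi : R -> R) (a b t0 r : R) : 0 < r -> a <= t0 <= b ->
  phi t0 <= r / 2 ->
  (forall t, a <= t <= b -> continuous phi t) ->
  (forall t, a <= t <= b ->
     (forall s, Rmin t0 t <= s <= Rmax t0 t -> phi s <= r) -> phi t <= r / 2) ->
  forall t, a <= t <= b -> phi t <= r / 2.
Proof.
move=> r_gt0 t0ab phi0 cphi step t tab.
case: (Rle_lt_dec t0 t) => t0t.
  apply: (@bootstrap_right phi t0 b r) => //; last lra.
    by move=> s hs; apply: cphi; lra.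
  move=> s hs h; apply: step; first lra.
  by rewrite Rmin_left ?Rmax_right; [exact: h | lra | lra].
(* Times before [t0] are reached by reversing time. *)
have -> : phi t = phi (- - t) by rewrite Ropp_involutive.
apply: (@bootstrap_right (fun s => phi (- s)) (- t0) (- a) r) => //; last lra.
- by rewrite Ropp_involutive.
- move=> s hs; apply: (continuous_comp Ropp phi); last by apply: cphi; lra.
  exact: (continuous_opp (V := R_NormedModule) _ _ (continuous_id _)).
move=> s hs h; apply: step; first lra.
rewrite Rmin_right ?Rmax_left; [|lra|lra].
by move=> u hu; have := h (- u); rewrite Ropp_involutive; apply; lra.
Qed.

Lemma continuous_is_derive (f : R -> R) t l : is_derive f t l -> continuous f t.
Proof. by move=> h; apply: ex_derive_continuous; exists l. Qed.

Lemma ivt (f : R -> R) (a b y : R) : a <= b ->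
  (forall t, a <= t <= b -> continuous f t) ->
  Rmin (f a) (f b) <= y <= Rmax (f a) (f b) ->
  exists z, a <= z <= b /\ f z = y.
Proof.
move=> ab cf hy.
case: (Req_dec (f a) y) => [|fay]; first by exists a; split=> //; lra.
case: (Req_dec (f b) y) => [|fby]; first by exists b; split=> //; lra.
have ab' : a < b.
  case: (Rle_lt_or_eq_dec _ _ ab) => // e; subst b.
  by move: hy; rewrite Rmin_left ?Rmax_left; lra.
case: (Rlt_le_dec (f a) (f b)) => fab.
  move: hy; rewrite Rmin_left ?Rmax_right; try lra; move=> hy.
  have [|||z [zab fz]] := Ranalysis5.IVT_interv (fun t => f t - y) a b _ ab'; try lra.
    move=> t tab; apply/continuity_pt_filterlim.
    exact: (continuous_minus (V := R_NormedModule) _ _ _ (cf t tab) (continuous_const _ _)).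
  by exists z; split=> //; lra.
move: hy; rewrite Rmin_right ?Rmax_left; try lra; move=> hy.
have [|||z [zab fz]] := Ranalysis5.IVT_interv (fun t => y - f t) a b _ ab'; try lra.
  move=> t tab; apply/continuity_pt_filterlim.
  exact: (continuous_minus (V := R_NormedModule) _ _ _ (continuous_const _ _) (cf t tab)).
by exists z; split=> //; lra.
Qed.

Lemma constant_sign (f : R -> R) (a b : R) :
  (forall t, a <= t <= b -> continuous f t) ->
  (forall t, a <= t <= b -> f t <> 0) ->
  (forall t, a <= t <= b -> 0 < f t) \/ (forall t, a <= t <= b -> f t < 0).
Proof.
move=> cf fn0.
case: (Rlt_le_dec b a) => ab; first by left=> t; lra.
have key s t : a <= s <= b -> a <= t <= b -> f s < 0 -> 0 < f t -> False.
  move=> hs ht fs ft.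
  have [|||z [hz fz]] := @ivt f (Rmin s t) (Rmax s t) 0.
  - exact: Rle_trans (Rmin_l s t) (Rmax_l s t).
  - move=> u hu; apply: cf; split.
      by apply: Rle_trans (proj1 hu); apply: Rmin_glb; lra.
    by apply: Rle_trans (proj2 hu) _; apply: Rmax_lub; lra.
  - case: (Rle_lt_dec s t) => st.
      by rewrite (Rmin_left s t) // (Rmax_right s t) // Rmin_left ?Rmax_right; lra.
    by rewrite (Rmin_right s t) ?(Rmax_left s t) ?Rmin_right ?Rmax_left; lra.
  apply: (fn0 z) => //; split.
    by apply: Rle_trans (proj1 hz); apply: Rmin_glb; lra.
  by apply: Rle_trans (proj2 hz) _; apply: Rmax_lub; lra.
case: (Rlt_le_dec (f a) 0) => fa; [right | left] => t ht.
  have := fn0 t ht; case: (Rlt_le_dec (f t) 0) => // ft n0.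
  by case: (@key a t); lra.
have := fn0 t ht; have := fn0 a ltac:(lra); case: (Rlt_le_dec 0 (f t)) => // ft n0 n1.
by case: (@key t a); lra.
Qed.

Lemma derive_bound (f : R -> R) (df : R -> R) (a b C : R) : a <= b ->
  (forall t, a <= t <= b -> is_derive f t (df t)) ->
  (forall t, a <= t <= b -> Rabs (df t) <= C) ->
  Rabs (f b - f a) <= C * (b - a).
Proof.
move=> ab hf hdf.
have [c [hc ->]] : exists c, Rmin a b <= c <= Rmax a b /\ f b - f a = df c * (b - a).
  apply: MVT_gen => x; rewrite Rmin_left ?Rmax_right // => hx; first by apply: hf; lra.
  by apply/continuity_pt_filterlim; apply: continuous_is_derive (hf x _); lra.
rewrite Rmin_left // Rmax_right // in hc.
rewrite Rabs_mult (Rabs_pos_eq (b - a)); last lra.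
by apply: Rmult_le_compat_r; [lra | exact: hdf].
Qed.

(** * Confinement by a descending chain of resonances *)

Section Confinement.
Variables (T : finType) (a b Lam : R) (dist : R -> R -> R) (D : T -> R -> R).
Variables (Rad eta : nat -> R).

Hypothesis dist_refl : forall t, dist t t = 0.
Hypothesis dist_sym : forall s t, dist s t = dist t s.
Hypothesis dist_tri : forall s t u, dist s u <= dist s t + dist t u.
Hypothesis dist_cont : forall t0 t, a <= t0 <= b -> a <= t <= b -> continuous (dist t0) t.
Hypothesis D_lip : forall i s t, a <= s <= b -> a <= t <= b ->
  Rabs (D i s - D i t) <= Lam * dist t s.
Hypothesis Lam_ge0 : 0 <= Lam.
Hypothesis Rad_gt0 : forall k, 0 < Rad k.
Hypothesis Rad_step : forall k, (k < #|T|)%N -> 8 * Rad k <= Rad k.+1.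
Hypothesis eta_step : forall k, (k < #|T|)%N -> 2 * eta k <= eta k.+1.
Hypothesis Rad_eta : forall k, 2 * (Lam * Rad k) <= eta k.

(* [D i] measures the distance to the [i]-th resonance: only the resonances
   in [S] are active on [[t1, t2]], and all of them are. *)
Hypothesis confined : forall (S : {set T}) t1 t2, a <= t1 -> t1 <= t2 -> t2 <= b ->
  (forall s, t1 <= s <= t2 -> dist t1 s <= 2 * Rad #|S|) ->
  (forall s i, t1 <= s <= t2 -> i \notin S -> eta #|S| / 2 <= D i s) ->
  (forall s i, t1 <= s <= t2 -> i \in S -> D i s < eta #|S|.-1) ->
  dist t1 t2 <= Rad #|S| / 4.

(* If a resonance of [S] becomes inactive at some time, the induction
   hypothesis applies from that time on, in both directions. *)
Lemma confinement_step (S : {set T}) t0 : a <= t0 <= b ->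
  (forall i, i \notin S -> eta #|S| <= D i t0) ->
  (forall s i, a <= s <= b -> i \in S -> eta #|S|.-1 <= D i s ->
     (forall j, j \notin S -> eta #|S| / 2 <= D j s) ->
     forall t, a <= t <= b -> dist s t <= Rad #|S| / 8) ->
  forall t, a <= t <= b -> dist t0 t <= Rad #|S| / 2.
Proof.
move=> t0ab far inner.
have RS := Rad_gt0 #|S|.
apply: (@bootstrap _ _ _ t0 (Rad #|S|)) => //.
- by rewrite dist_refl; lra.
- by move=> s hs; exact: dist_cont.
move=> t tab close.
have inab s : Rmin t0 t <= s <= Rmax t0 t -> a <= s <= b.
  move=> [h1 h2]; split; first by apply: Rle_trans h1; apply: Rmin_glb; lra.
  by apply: Rle_trans h2 _; apply: Rmax_lub; lra.
have far2 s i : Rmin t0 t <= s <= Rmax t0 t -> i \notin S -> eta #|S| / 2 <= D i s.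
  move=> hs iS; have := far i iS.
  have := D_lip i (inab s hs) t0ab; move/Rabs_le_between.
  have := Rmult_le_compat_l _ _ _ Lam_ge0 (close s hs); have := Rad_eta #|S|; lra.
case: (classic (exists s i, Rmin t0 t <= s <= Rmax t0 t /\ i \in S /\ eta #|S|.-1 <= D i s)).
  move=> [s [i [hs [iS Dis]]]].
  have h := inner s i (inab s hs) iS Dis (fun j jS => far2 s j hs jS).
  have := dist_tri t0 s t; have := h t tab; have := h t0 t0ab; rewrite (dist_sym s t0); lra.
move=> no.
have near s i : Rmin t0 t <= s <= Rmax t0 t -> i \in S -> D i s < eta #|S|.-1.
  by move=> hs iS; apply: Rnot_le_lt => h; apply: no; exists s, i.
have m_le_M : Rmin t0 t <= Rmax t0 t by apply: Rle_trans (Rmin_l _ _) (Rmax_l _ _).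
have [h1 h2] := inab _ (conj (Rle_refl _) m_le_M).
have [h3 h4] := inab _ (conj m_le_M (Rle_refl _)).
have h : dist (Rmin t0 t) (Rmax t0 t) <= Rad #|S| / 4.
  apply: confined => // s hs; apply: Rle_trans (dist_tri _ t0 _) _.
  have := close s hs; have := close _ (conj (Rle_refl _) m_le_M).
  rewrite (dist_sym (Rmin t0 t)); lra.
move: h; case: (Rle_lt_dec t0 t) => ?.
  by rewrite Rmin_left // Rmax_right //; lra.
by rewrite Rmin_right ?Rmax_left; try lra; rewrite dist_sym; lra.
Qed.

(** Strong induction on the number of active resonances. When [i] leaves [S], it is at distance
    [eta #|S|.-1], and the inactive ones are still at [eta #|S| / 2], which is no less: the smaller
    set satisfies the hypothesis from that time on. The full set satisfies it vacuously. *)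
Lemma confinement (S : {set T}) t0 : a <= t0 <= b ->
  (forall i, i \notin S -> eta #|S| <= D i t0) ->
  forall t, a <= t <= b -> dist t0 t <= Rad #|S| / 2.
Proof.
have [k] := ubnP #|S|; elim: k S t0 => // k IH S t0 Sk t0ab far.
apply: confinement_step => // s i sab iS Dis far2 t tab.
have cS : #|S| = (#|S :\ i|).+1 by rewrite (cardsD1 i S) iS.
have cT : (#|S :\ i| < #|T|)%N by rewrite -cS max_card.
have : dist s t <= Rad #|S :\ i| / 2.
  apply: IH => //; first by rewrite -ltnS -cS.
  move=> j; rewrite !inE negb_and negbK => /orP[/eqP->|jS].
    by move: Dis; rewrite cS.
  by have := far2 j jS; have := eta_step cT; rewrite cS; lra.
have := Rad_step cT; rewrite -cS; have := Rad_gt0 #|S :\ i|; lra.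
Qed.

Lemma confinement_all s t : a <= s <= b -> a <= t <= b -> dist s t <= Rad #|T| / 2.
Proof.
move=> hs ht; rewrite -cardsT; apply: confinement => // i.
by rewrite inE.
Qed.

End Confinement.

(** * Integrals of continuous functions *)

Lemma cont_ex_RInt (f : R -> R) a b : (forall x, continuous f x) -> ex_RInt f a b.
Proof. by move=> cf; apply: ex_RInt_continuous => x _. Qed.

Lemma RInt_shift (f : R -> R) v a b : (forall x, continuous f x) ->
  RInt (fun x => f (x + v)) a b = RInt f (a + v) (b + v).
Proof.
move=> cf; have := @RInt_comp_lin R_CompleteNormedModule f 1 v a b (cont_ex_RInt _ _ cf).
rewrite !Rmult_1_l => <-; apply: RInt_ext => x _.
by rewrite /scal /= /mult /= !Rmult_1_l.
Qed.

Lemma is_derive_prim (f : R -> R) a x :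
  (forall x, continuous f x) -> is_derive (RInt f a) x (f x).
Proof.
move=> cf; apply: (is_derive_RInt f (RInt f a) a) => //.
by apply: filter_forall => y; apply: RInt_correct; exact: cont_ex_RInt.
Qed.

Lemma RInt_chasles (f : R -> R) a b c : (forall x, continuous f x) ->
  RInt f a c = RInt f a b + RInt f b c.
Proof.
move=> cf; symmetry.
exact: (RInt_Chasles (V := R_CompleteNormedModule) f a b c
          (cont_ex_RInt _ _ cf) (cont_ex_RInt _ _ cf)).
Qed.

Lemma RInt_eq (f g : R -> R) a b : (forall x, f x = g x :> R) -> RInt f a b = RInt g a b :> R.
Proof. by move=> fg; apply: RInt_ext => x _; exact: fg. Qed.

Lemma RInt_periodic (f : R -> R) x0 w : (forall x, continuous f x) ->
  (forall x, f (x + w) = f x) -> RInt f x0 (x0 + w) = RInt f 0 w.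
Proof.
move=> cf pf.
rewrite (RInt_chasles x0 0 (x0 + w) cf) (RInt_chasles 0 w (x0 + w) cf).
have -> : RInt f w (x0 + w) = RInt f 0 x0.
  rewrite -{1}(Rplus_0_l w) -RInt_shift //.
  by apply: RInt_ext => x _.
have := RInt_chasles x0 0 x0 cf; rewrite RInt_point /zero /=; lra.
Qed.

Lemma RInt_diff_bound (f g : R -> R) a b C : a <= b ->
  (forall x, continuous f x) -> (forall x, continuous g x) ->
  (forall x, a <= x <= b -> Rabs (f x - g x) <= C) ->
  Rabs (RInt f a b - RInt g a b) <= C * (b - a).
Proof.
move=> ab cf cg h.
have -> : RInt f a b - RInt g a b = RInt (fun x => f x - g x) a b.
  by symmetry; apply: (RInt_minus (V := R_CompleteNormedModule)); exact: cont_ex_RInt.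
rewrite Rmult_comm; apply: abs_RInt_le_const => //.
apply: cont_ex_RInt => x; exact: (continuous_minus (V := R_NormedModule) _ _ _ (cf x) (cg x)).
Qed.

Lemma RInt_abs_bound (f : R -> R) a b C : a <= b -> (forall x, continuous f x) ->
  (forall x, a <= x <= b -> Rabs (f x) <= C) -> Rabs (RInt f a b) <= C * (b - a).
Proof.
move=> ab cf h; rewrite Rmult_comm; apply: abs_RInt_le_const => //.
exact: cont_ex_RInt.
Qed.

Lemma RInt_ge (f g : R -> R) a b : a <= b ->
  (forall x, continuous f x) -> (forall x, continuous g x) ->
  (forall x, g x <= f x) -> RInt g a b <= RInt f a b.
Proof. by move=> ab cf cg h; apply: RInt_le => //; exact: cont_ex_RInt. Qed.

Lemma RInt_scale (f : R -> R) a b c : (forall x, continuous f x) ->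
  RInt (fun x => c * f x) a b = c * RInt f a b.
Proof.
by move=> cf; apply: (RInt_scal (V := R_CompleteNormedModule)); exact: cont_ex_RInt.
Qed.

Lemma RInt_add (f g : R -> R) a b :
  (forall x, continuous f x) -> (forall x, continuous g x) ->
  RInt (fun x => f x + g x) a b = RInt f a b + RInt g a b.
Proof.
by move=> cf cg; apply: (RInt_plus (V := R_CompleteNormedModule)); exact: cont_ex_RInt.
Qed.

Lemma cont_mult (f g : R -> R) x :
  continuous f x -> continuous g x -> continuous (fun y => f y * g y) x.
Proof. exact: (continuous_mult (K := R_AbsRing)). Qed.

Lemma cont_plus (f g : R -> R) x :
  continuous f x -> continuous g x -> continuous (fun y => f y + g y) x.
Proof. exact: (continuous_plus (V := R_NormedModule)). Qed.

Lemma cont_minus (f g : R -> R) x :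
  continuous f x -> continuous g x -> continuous (fun y => f y - g y) x.
Proof. exact: (continuous_minus (V := R_NormedModule)). Qed.

Lemma cont_opp (f : R -> R) x : continuous f x -> continuous (fun y => - f y) x.
Proof. exact: (continuous_opp (V := R_NormedModule)). Qed.

Lemma cont_cst (c x : R) : continuous (fun _ : R => c) x.
Proof. exact: continuous_const. Qed.

(** * The pendulum in rotating coordinates *)

(* With X = p/2, Y = cos (q/2), Z = sin (q/2), the pendulum is the system
   X' = YZ, Y' = -XZ, Z' = XY.  The pair (A, Y) rotates with speed B, where
   (A, B) = (X, Z) for librations and (A, B) = (Z, X) for rotations, and
   B^2 - A^2 = e is half the absolute value of the energy. *)
Definition rotA (A Y x : R) := A * cos x + Y * sin x.
Definition rotY (A Y x : R) := Y * cos x - A * sin x.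
Definition slow (A Y e x : R) := / sqrt (e + rotA A Y x ^ 2).
Definition phase (A Y e x : R) := RInt (slow A Y e) 0 x.
Definition period (A Y e : R) := phase A Y e (2 * PI).

Lemma rotA_add A Y x y : rotA (rotA A Y x) (rotY A Y x) y = rotA A Y (y + x).
Proof. by rewrite /rotA /rotY cos_plus sin_plus; ring. Qed.

Lemma rotY_add A Y x y : rotY (rotA A Y x) (rotY A Y x) y = rotY A Y (y + x).
Proof. by rewrite /rotA /rotY cos_plus sin_plus; ring. Qed.

Lemma rotA_2PI A Y x : rotA A Y (x + 2 * PI) = rotA A Y x.
Proof. by rewrite /rotA cos_plus sin_plus cos_2PI sin_2PI; ring. Qed.

Lemma rotY_2PI A Y x : rotY A Y (x + 2 * PI) = rotY A Y x.
Proof. by rewrite /rotY cos_plus sin_plus cos_2PI sin_2PI; ring. Qed.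

Lemma rotA_0 A Y : rotA A Y 0 = A.
Proof. by rewrite /rotA cos_0 sin_0; ring. Qed.

Lemma rotY_0 A Y : rotY A Y 0 = Y.
Proof. by rewrite /rotY cos_0 sin_0; ring. Qed.

Lemma rot_norm A Y x : rotA A Y x ^ 2 + rotY A Y x ^ 2 = A ^ 2 + Y ^ 2.
Proof.
have := sin2_cos2 x; rewrite /rotA /rotY /Rsqr => h.
transitivity ((A ^ 2 + Y ^ 2) * (sin x * sin x + cos x * cos x)); first ring.
by rewrite h; ring.
Qed.

Lemma is_derive_rotA A Y x : is_derive (rotA A Y) x (rotY A Y x).
Proof. by rewrite /rotA /rotY; auto_derive => //; ring. Qed.

Lemma is_derive_rotY A Y x : is_derive (rotY A Y) x (- rotA A Y x).
Proof. by rewrite /rotA /rotY; auto_derive => //; ring. Qed.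

Lemma continuous_rotA A Y x : continuous (rotA A Y) x.
Proof. exact: continuous_is_derive (is_derive_rotA A Y x). Qed.

Lemma continuous_rotY A Y x : continuous (rotY A Y) x.
Proof. exact: continuous_is_derive (is_derive_rotY A Y x). Qed.

Section PositiveEnergy.
Variables (A Y e : R).
Hypothesis e_gt0 : 0 < e.

Lemma speed_gt0 x : 0 < sqrt (e + rotA A Y x ^ 2).
Proof. by apply: sqrt_lt_R0; have := pow2_ge_0 (rotA A Y x); lra. Qed.

Lemma slow_gt0 x : 0 < slow A Y e x.
Proof. exact: Rinv_0_lt_compat (speed_gt0 x). Qed.

Lemma continuous_slow x : continuous (slow A Y e) x.
Proof.
have h := speed_gt0 x; have h2 := pow2_ge_0 (rotA A Y x).
apply: ex_derive_continuous; rewrite /slow /rotA; rewrite /rotA in h h2; auto_derive.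
split; first by move: h2; rewrite /= !Rmult_1_r; lra.
split=> //; move: h; rewrite /= !Rmult_1_r => h; lra.
Qed.

Lemma is_derive_phase x : is_derive (phase A Y e) x (slow A Y e x).
Proof. by apply: is_derive_prim => y; exact: continuous_slow. Qed.

Lemma phase_0 : phase A Y e 0 = 0.
Proof. by rewrite /phase RInt_point. Qed.

Lemma slow_rot x y : slow (rotA A Y x) (rotY A Y x) e y = slow A Y e (y + x).
Proof. by rewrite /slow rotA_add. Qed.

Lemma phase_rot x y :
  phase (rotA A Y x) (rotY A Y x) e y = phase A Y e (y + x) - phase A Y e x.
Proof.
rewrite /phase (RInt_ext _ (fun t => slow A Y e (t + x))); last by move=> t _; rewrite slow_rot.
rewrite RInt_shift; last by move=> t; exact: continuous_slow.
rewrite Rplus_0_l (RInt_chasles 0 x (y + x)); last by move=> t; exact: continuous_slow.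
have h : forall u v : R, v = u + v - u by move=> u v; ring.
exact: h.
Qed.

Lemma slow_2PI x : slow A Y e (x + 2 * PI) = slow A Y e x.
Proof. by rewrite /slow rotA_2PI. Qed.

Lemma period_rot x : period (rotA A Y x) (rotY A Y x) e = period A Y e.
Proof.
rewrite /period phase_rot Rplus_comm /phase (RInt_chasles 0 x (x + 2 * PI)).
  rewrite RInt_periodic; [|exact: continuous_slow|exact: slow_2PI].
  have h : forall u v : R, u + v - u = v by move=> u v; ring.
  exact: h.
exact: continuous_slow.
Qed.

End PositiveEnergy.

Lemma polar (A Y : R) : exists x, A = rotA 0 (sqrt (A ^ 2 + Y ^ 2)) x /\
  Y = rotY 0 (sqrt (A ^ 2 + Y ^ 2)) x.
Proof.
set k := sqrt _; have k2 : k ^ 2 = A ^ 2 + Y ^ 2.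
  by rewrite /k pow2_sqrt //; have := pow2_ge_0 A; have := pow2_ge_0 Y; lra.
have k_ge0 : 0 <= k by exact: sqrt_pos.
have hA := pow2_ge_0 A; have hY := pow2_ge_0 Y.
case: (Req_dec k 0) => [k0|kn0].
  by exists 0; rewrite rotA_0 rotY_0; move: k2; rewrite k0; nra.
have h1 : Rabs (Y / k) <= 1.
  rewrite Rabs_div // (Rabs_pos_eq k) //; apply/Rle_div_l; first lra.
  by rewrite Rmult_1_l -(Rabs_pos_eq k) //; apply: Rsqr_le_abs_0; rewrite /Rsqr; nra.
have h2 : -1 <= Y / k <= 1 by apply/Rabs_le_between.
have cx : cos (acos (Y / k)) = Y / k by exact: cos_acos.
have sx : sin (acos (Y / k)) = Rabs A / k.
  have -> : Rabs A / k = sqrt (Rsqr (A / k)).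
    by rewrite sqrt_Rsqr_abs Rabs_div // (Rabs_pos_eq k).
  rewrite sin_acos //; congr sqrt; rewrite /Rsqr.
  by apply: (Rmult_eq_reg_r (k ^ 2)); [field_simplify => //; lra | exact: pow_nonzero].
rewrite /rotA /rotY; case: (Rle_lt_dec 0 A) => A0.
  by exists (acos (Y / k)); rewrite cx sx (Rabs_pos_eq A) //; split; field.
exists (- acos (Y / k)); rewrite cos_neg sin_neg cx sx (Rabs_left A) //; split; field => //.
Qed.

(** The period does not change along the rotation, so the starting point can be moved to [A = 0];
    the result depends on [A] and [Y] only through the invariant [A ^ 2 + Y ^ 2]. *)
Lemma period_polar A Y e : 0 < e ->
  period A Y e = RInt (fun x => / sqrt (e + (A ^ 2 + Y ^ 2) * sin x ^ 2)) 0 (2 * PI).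
Proof.
move=> e_gt0; have [x] := polar A Y; set k := sqrt _ => -[Ax Yx].
rewrite {1}Ax {1}Yx period_rot // /period /phase; apply: RInt_ext => y _.
rewrite /slow /rotA Rmult_0_l Rplus_0_l Rpow_mult_distr /k pow2_sqrt //.
by have := pow2_ge_0 A; have := pow2_ge_0 Y; lra.
Qed.

(** * The corrector of a non-resonant harmonic *)

Lemma sin_lip x y : Rabs (sin x - sin y) <= Rabs (x - y).
Proof.
have key u v : u <= v -> Rabs (sin v - sin u) <= Rabs (v - u).
  move=> uv; rewrite (Rabs_pos_eq (v - u)); last lra.
  rewrite -(Rmult_1_l (v - u)).
  apply: (@derive_bound sin cos) => // t _; first exact: is_derive_sin.
  by apply/Rabs_le_between; exact: COS_bound.
case: (Rle_lt_dec x y) => h; last by apply: key; lra.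
by rewrite Rabs_minus_sym (Rabs_minus_sym x); apply: key.
Qed.

Lemma cos_lip x y : Rabs (cos x - cos y) <= Rabs (x - y).
Proof.
rewrite !cos_sin; have := sin_lip (PI / 2 + x) (PI / 2 + y).
by have -> : PI / 2 + x - (PI / 2 + y) = x - y by ring.
Qed.

Lemma abs_sin_le x : Rabs (sin x) <= 1.
Proof. by apply/Rabs_le_between; exact: SIN_bound. Qed.

Lemma abs_cos_le x : Rabs (cos x) <= 1.
Proof. by apply/Rabs_le_between; exact: COS_bound. Qed.

Lemma mul_diff_bound a a' b b' (Ca Cb da db : R) :
  Rabs a <= Ca -> Rabs b' <= Cb -> Rabs (a - a') <= da -> Rabs (b - b') <= db ->
  Rabs (a * b - a' * b') <= Ca * db + da * Cb.
Proof.
move=> ha hb hda hdb.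
have -> : a * b - a' * b' = a * (b - b') + (a - a') * b' by ring.
apply: Rle_trans (Rabs_triang _ _) _; rewrite !Rabs_mult.
by apply: Rplus_le_compat; apply: Rmult_le_compat => //; exact: Rabs_pos.
Qed.

Lemma mul_bound a b Ca Cb : Rabs a <= Ca -> Rabs b <= Cb -> Rabs (a * b) <= Ca * Cb.
Proof. by move=> ha hb; rewrite Rabs_mult; apply: Rmult_le_compat => //; exact: Rabs_pos. Qed.

Lemma add_bound a b Ca Cb : Rabs a <= Ca -> Rabs b <= Cb -> Rabs (a + b) <= Ca + Cb.
Proof. by move=> ha hb; apply: Rle_trans (Rabs_triang _ _) _; lra. Qed.

Lemma sub_bound a b Ca Cb : Rabs a <= Ca -> Rabs b <= Cb -> Rabs (a - b) <= Ca + Cb.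
Proof. by move=> ha hb; apply: add_bound; rewrite ?Rabs_Ropp. Qed.

Lemma add_diff_bound a a' b b' (da db : R) :
  Rabs (a - a') <= da -> Rabs (b - b') <= db -> Rabs (a + b - (a' + b')) <= da + db.
Proof.
move=> hda hdb; have -> : a + b - (a' + b') = (a - a') + (b - b') by ring.
exact: add_bound.
Qed.

Lemma abs_le_sqr x C : 0 <= C -> x ^ 2 <= C ^ 2 -> Rabs x <= C.
Proof.
move=> C0 h; rewrite -(Rabs_pos_eq C) //; apply: Rsqr_le_abs_0.
by rewrite /Rsqr; nra.
Qed.

Lemma derive_eps (f : R -> R) t l : is_derive f t l ->
  forall e, 0 < e -> exists dl, 0 < dl /\ forall s, Rabs (s - t) < dl ->
    Rabs (f s - f t - l * (s - t)) <= e * Rabs (s - t).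
Proof.
move=> [_ hf] e e_gt0.
have [dl hdl] := hf t (fun P hP => hP) (mkposreal e e_gt0).
exists dl; split; first exact: cond_pos.
move=> s hs; have := hdl s hs.
rewrite /norm /= /abs /= /minus /plus /opp /scal /= /mult /= => h.
have -> : f s - f t - l * (s - t) = f s + - f t + - ((s + - t) * l) by ring.
exact: h.
Qed.

(** Puts two curves that meet at [t] into the form that [dini_bound] asks for. *)
Lemma derive_close (f g : R -> R) t lf lg C : is_derive f t lf -> is_derive g t lg ->
  f t = g t -> Rabs (lf - lg) <= C ->
  forall e, 0 < e -> exists dl, 0 < dl /\ forall s, Rabs (s - t) < dl ->
    Rabs (f s - g s) <= (C + e) * Rabs (s - t).
Proof.
move=> hf hg fg lfg e e_gt0.
have h := is_derive_minus _ _ _ _ _ hf hg.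
have [dl [dl_gt0 hdl]] := derive_eps h e_gt0.
exists dl; split=> // s hs; have := hdl s hs.
rewrite /minus /plus /opp /= fg => h1.
have -> : f s - g s = (f s + - g s - (g t + - g t) - (lf + - lg) * (s - t)) + (lf - lg) * (s - t) by ring.
have -> : (C + e) * Rabs (s - t) = e * Rabs (s - t) + C * Rabs (s - t) by ring.
apply: add_bound => //.
by rewrite Rabs_mult; apply: Rmult_le_compat_r => //; exact: Rabs_pos.
Qed.

(** * Lipschitz dependence of the unperturbed flow on its data, in powers of [G] *)

Section Lipschitz.
Variable G : R.
Hypothesis G10 : 10 <= G.

Lemma pow_G_le m n : (m <= n)%coq_nat -> G ^ m <= G ^ n.
Proof. by move=> mn; apply: Rle_pow => //; lra. Qed.

Lemma pow_G_gt0 n : 0 < G ^ n.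
Proof. by apply: pow_lt; lra. Qed.

Lemma pow_G_ge1 n : 1 <= G ^ n.
Proof. by apply: pow_R1_Rle; lra. Qed.

Lemma pow_G_10 n : 10 * G ^ n <= G ^ n.+1.
Proof. by rewrite -tech_pow_Rmult; apply: Rmult_le_compat_r => //; apply: Rlt_le; exact: pow_G_gt0. Qed.

Lemma sqrt_ge_invG x : / G <= x -> / G <= sqrt x.
Proof.
move=> h; have g0 : 0 < / G by apply: Rinv_0_lt_compat; lra.
have g1 : / G <= 1 by rewrite -Rinv_1; apply: Rinv_le_contravar; lra.
rewrite -(sqrt_Rsqr (/ G)); last lra.
by apply: sqrt_le_1_alt; rewrite /Rsqr; nra.
Qed.

Lemma inv_le_G x : / G <= x -> / x <= G.
Proof.
move=> h; rewrite -(Rinv_inv G); apply: Rinv_le_contravar => //.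
by apply: Rinv_0_lt_compat; lra.
Qed.

Lemma inv_sqrt_diff u v : 0 < u -> 0 < v ->
  / sqrt u - / sqrt v = (v - u) * (/ sqrt u * / sqrt v * / (sqrt u + sqrt v)).
Proof.
move=> u0 v0; have su := sqrt_lt_R0 u u0; have sv := sqrt_lt_R0 v v0.
have -> : v - u = (sqrt v - sqrt u) * (sqrt u + sqrt v).
  by have := sqrt_sqrt u; have := sqrt_sqrt v; nra.
by field; lra.
Qed.

Lemma inv_sqrt_lip u v : / G <= u -> / G <= v ->
  Rabs (/ sqrt u - / sqrt v) <= G ^ 3 * Rabs (u - v).
Proof.
move=> hu hv; have g0 : 0 < / G by apply: Rinv_0_lt_compat; lra.
rewrite inv_sqrt_diff; [|lra|lra].
have su := sqrt_ge_invG hu; have sv := sqrt_ge_invG hv.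
rewrite Rabs_mult Rmult_comm Rabs_minus_sym; apply: Rmult_le_compat_r; first exact: Rabs_pos.
have -> : G ^ 3 = G * G * G by ring.
have pos x : / G <= x -> Rabs (/ x) <= G.
  move=> hx; rewrite Rabs_pos_eq; first exact: inv_le_G.
  by apply: Rlt_le; apply: Rinv_0_lt_compat; lra.
by apply: mul_bound; [apply: mul_bound|]; apply: pos => //; lra.
Qed.

Section TwoPoints.
Variables (A Y e A' Y' e' r : R).
Hypotheses (eG : / G <= e) (eG' : / G <= e').
Hypotheses (nG : A ^ 2 + Y ^ 2 <= G ^ 2) (nG' : A' ^ 2 + Y' ^ 2 <= G ^ 2).
Hypotheses (dA : Rabs (A - A') <= r) (dY : Rabs (Y - Y') <= r) (de : Rabs (e - e') <= r).

Lemma e_gt0_of : 0 < e.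
Proof. by apply: Rlt_le_trans eG; apply: Rinv_0_lt_compat; lra. Qed.

Lemma r_ge0_of : 0 <= r.
Proof. exact: Rle_trans (Rabs_pos _) dA. Qed.

Lemma abs_rotA_le x : Rabs (rotA A Y x) <= G.
Proof.
apply: abs_le_sqr; first lra.
by have := rot_norm A Y x; have := pow2_ge_0 (rotY A Y x); lra.
Qed.

Lemma rotA_lip x : Rabs (rotA A Y x - rotA A' Y' x) <= 2 * r.
Proof.
have -> : rotA A Y x - rotA A' Y' x = (A - A') * cos x + (Y - Y') * sin x by rewrite /rotA; ring.
have -> : 2 * r = r * 1 + r * 1 by ring.
by apply: add_bound; apply: mul_bound => //; [exact: abs_cos_le | exact: abs_sin_le].
Qed.

Lemma rotY_lip x : Rabs (rotY A Y x - rotY A' Y' x) <= 2 * r.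
Proof.
have -> : rotY A Y x - rotY A' Y' x = (Y - Y') * cos x - (A - A') * sin x by rewrite /rotY; ring.
have -> : 2 * r = r * 1 + r * 1 by ring.
by apply: sub_bound; apply: mul_bound => //; [exact: abs_cos_le | exact: abs_sin_le].
Qed.

Lemma slow_bound x : 0 < slow A Y e x <= G.
Proof.
split; first exact: slow_gt0 e_gt0_of x.
apply: inv_le_G; apply: sqrt_ge_invG.
by have := pow2_ge_0 (rotA A Y x); lra.
Qed.

Lemma phase_bound x : 0 <= x <= 2 * PI -> Rabs (phase A Y e x) <= G ^ 2.
Proof.
move=> hx; have P4 := PI_4; have eg := e_gt0_of.
have h : Rabs (phase A Y e x) <= G * (x - 0).
  apply: RInt_abs_bound; [lra | by move=> y; exact: continuous_slow|].
  by move=> y _; have := slow_bound y => -[h1 h2]; rewrite Rabs_pos_eq //; lra.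
by apply: Rle_trans h _; nra.
Qed.

End TwoPoints.

Section TwoPoints'.
Variables (A Y e A' Y' e' r : R).
Hypotheses (eG : / G <= e) (eG' : / G <= e').
Hypotheses (nG : A ^ 2 + Y ^ 2 <= G ^ 2) (nG' : A' ^ 2 + Y' ^ 2 <= G ^ 2).
Hypotheses (dA : Rabs (A - A') <= r) (dY : Rabs (Y - Y') <= r) (de : Rabs (e - e') <= r).

Lemma slow_lip x : Rabs (slow A Y e x - slow A' Y' e' x) <= G ^ 5 * r.
Proof.
have r0 := r_ge0_of dA.
apply: Rle_trans (inv_sqrt_lip _ _) _.
- by have := pow2_ge_0 (rotA A Y x); lra.
- by have := pow2_ge_0 (rotA A' Y' x); lra.
have -> : G ^ 5 * r = G ^ 3 * (G ^ 2 * r) by ring.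
apply: Rmult_le_compat_l; first by apply: Rlt_le; exact: pow_G_gt0.
have hx := rotA_lip dA dY x; have h1 := abs_rotA_le nG x; have h2 := abs_rotA_le nG' x.
have -> : e + rotA A Y x ^ 2 - (e' + rotA A' Y' x ^ 2) =
  (e - e') + (rotA A Y x - rotA A' Y' x) * (rotA A Y x + rotA A' Y' x) by ring.
apply: Rle_trans (add_bound de (mul_bound hx (add_bound h1 h2))) _.
have -> : r + 2 * r * (G + G) = (1 + 4 * G) * r by ring.
by apply: Rmult_le_compat_r => //; nra.
Qed.

Lemma phase_lip x : 0 <= x <= 2 * PI ->
  Rabs (phase A Y e x - phase A' Y' e' x) <= G ^ 6 * r.
Proof.
move=> hx; have P4 := PI_4; have r0 := r_ge0_of dA.
have h : Rabs (phase A Y e x - phase A' Y' e' x) <= G ^ 5 * r * (x - 0).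
  apply: RInt_diff_bound; [lra | | | by move=> y _; exact: slow_lip].
    by move=> y; exact: (continuous_slow (e_gt0_of eG)).
  by move=> y; exact: (continuous_slow (e_gt0_of eG')).
apply: Rle_trans h _.
have := Rmult_le_pos _ _ (Rlt_le _ _ (pow_G_gt0 5)) r0.
have -> : G ^ 6 * r = (G ^ 5 * r) * G by ring.
by move=> h; apply: Rmult_le_compat_l => //; lra.
Qed.

End TwoPoints'.
End Lipschitz.

(** * The cohomological equation *)

Section Corrector.
Variables (G mu eta a b : R) (Dom : R -> R -> Prop) (F1 F2 : R -> R -> R -> R -> R).
Hypothesis G10 : 10 <= G.
Hypothesis mu_ge0 : 0 <= mu.
Hypothesis eta01 : 0 < eta <= 1.
Hypothesis Dom_e : forall k e, Dom k e -> / G <= e.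
Hypothesis Dom_k : forall k e, Dom k e -> k <= G ^ 2.

(** Time enters the observables only through the slow actions, hence the weight [mu] on [t - t']. *)
Definition regular_observable (F : R -> R -> R -> R -> R) :=
  (forall t A Y e, a <= t <= b -> Dom (A ^ 2 + Y ^ 2) e -> Rabs (F t A Y e) <= G) /\
  (forall t t' A A' Y Y' e e', a <= t <= b -> a <= t' <= b ->
     Dom (A ^ 2 + Y ^ 2) e -> Dom (A' ^ 2 + Y' ^ 2) e' ->
     Rabs (F t A Y e - F t' A' Y' e') <=
       G ^ 4 * (mu * Rabs (t - t') + Rabs (A - A') + Rabs (Y - Y') + Rabs (e - e'))).

Hypothesis regF1 : regular_observable F1.
Hypothesis regF2 : regular_observable F2.

(** Phase of the harmonic when the rotation has turned by [x], shifted by half a period. Its end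
    values over a turn are [th - u T / 2] and [th + u T / 2], whose symmetric difference produces
    the factor [2 sin (u T / 2)]. *)
Definition angle A Y e th u x := th + u * phase A Y e x - u * period A Y e / 2.

Definition corr_density t A Y e th u x :=
  (- F1 t (rotA A Y x) (rotY A Y x) e * cos (angle A Y e th u x) +
   F2 t (rotA A Y x) (rotY A Y x) e * sin (angle A Y e th u x)) * slow A Y e x.

(* The solution of the cohomological equation dg/dt = F1 sin th + F2 cos th
   along the unperturbed flow th' = u, with the small divisor sin (u T / 2). *)
Definition corrector t A Y e th u :=
  RInt (corr_density t A Y e th u) 0 (2 * PI) / (2 * sin (u * period A Y e / 2)).

Lemma Dom_rot A Y e x : Dom (A ^ 2 + Y ^ 2) e -> Dom (rotA A Y x ^ 2 + rotY A Y x ^ 2) e.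
Proof. by rewrite rot_norm. Qed.

Lemma observable_rot_lip F t t' A A' Y Y' e e' r x : regular_observable F ->
  a <= t <= b -> a <= t' <= b -> Dom (A ^ 2 + Y ^ 2) e -> Dom (A' ^ 2 + Y' ^ 2) e' ->
  mu * Rabs (t - t') <= r -> Rabs (A - A') <= r -> Rabs (Y - Y') <= r -> Rabs (e - e') <= r ->
  Rabs (F t (rotA A Y x) (rotY A Y x) e - F t' (rotA A' Y' x) (rotY A' Y' x) e') <= G ^ 5 * r.
Proof.
move=> [_ lipF] ht ht' D D' dt dA dY de.
have r0 := r_ge0_of dA.
apply: Rle_trans (lipF _ _ _ _ _ _ _ _ ht ht' (Dom_rot x D) (Dom_rot x D')) _.
have -> : G ^ 5 * r = G ^ 4 * (G * r) by ring.
apply: Rmult_le_compat_l; first by apply: Rlt_le; exact: pow_G_gt0.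
have := rotA_lip dA dY x; have := rotY_lip dA dY x; nra.
Qed.

Lemma continuous_observable_rot F t A Y e x : regular_observable F ->
  a <= t <= b -> Dom (A ^ 2 + Y ^ 2) e ->
  continuous (fun y => F t (rotA A Y y) (rotY A Y y) e) x.
Proof.
move=> [_ lipF] ht D; apply/filterlim_locally => eps.
have g4 := pow_G_gt0 G10 4.
have d_gt0 : 0 < eps / (2 * G ^ 4) by apply: Rdiv_lt_0_compat; [exact: cond_pos | lra].
have [d1 [d1_gt0 h1]] := continuous_eps (@continuous_rotA A Y x) d_gt0.
have [d2 [d2_gt0 h2]] := continuous_eps (@continuous_rotY A Y x) d_gt0.
have d12 : 0 < Rmin d1 d2 by exact: Rmin_glb_lt.
exists (mkposreal _ d12) => y hy.
have hy1 : Rabs (y - x) < d1 by apply: Rlt_le_trans hy (Rmin_l _ _).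
have hy2 : Rabs (y - x) < d2 by apply: Rlt_le_trans hy (Rmin_r _ _).
apply: Rle_lt_trans (lipF _ _ _ _ _ _ _ _ ht ht (Dom_rot y D) (Dom_rot x D)) _.
rewrite !Rminus_diag Rabs_R0 Rmult_0_r Rplus_0_l Rplus_0_r.
have -> : (eps : R) = G ^ 4 * (eps / (2 * G ^ 4) + eps / (2 * G ^ 4)) by field; lra.
by apply: Rmult_lt_compat_l => //; apply: Rplus_lt_compat; [exact: h1 | exact: h2].
Qed.

Section Fixed.
Variables (t A Y e th u : R).
Hypotheses (ht : a <= t <= b) (D : Dom (A ^ 2 + Y ^ 2) e).

Let e_gt0 : 0 < e.
Proof. exact: (e_gt0_of G10 (Dom_e D)). Qed.

Lemma is_derive_angle x : is_derive (angle A Y e th u) x (u * slow A Y e x).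
Proof.
rewrite /angle; have h := is_derive_phase A Y e_gt0 x.
auto_derive; first by eexists; exact: h.
by rewrite (is_derive_unique _ _ _ h); ring.
Qed.

Lemma continuous_corr_density x : continuous (corr_density t A Y e th u) x.
Proof.
apply: cont_mult; last exact: continuous_slow.
have ca := continuous_is_derive (is_derive_angle x).
apply: cont_plus; apply: cont_mult.
- by apply: cont_opp; exact: continuous_observable_rot.
- by apply: (continuous_comp (angle A Y e th u) cos) => //; exact: continuous_cos.
- exact: continuous_observable_rot.
- by apply: (continuous_comp (angle A Y e th u) sin) => //; exact: continuous_sin.
Qed.

Lemma corr_density_bracket_bound x :
  Rabs (- F1 t (rotA A Y x) (rotY A Y x) e * cos (angle A Y e th u x) +
        F2 t (rotA A Y x) (rotY A Y x) e * sin (angle A Y e th u x)) <= 2 * G.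
Proof.
have -> : 2 * G = G * 1 + G * 1 by ring.
apply: add_bound; apply: mul_bound.
- by rewrite Rabs_Ropp; apply: (proj1 regF1) => //; exact: Dom_rot.
- exact: abs_cos_le.
- by apply: (proj1 regF2) => //; exact: Dom_rot.
- exact: abs_sin_le.
Qed.

Lemma corr_integral_bound : Rabs (RInt (corr_density t A Y e th u) 0 (2 * PI)) <= G ^ 4.
Proof.
have P4 := PI_4; have P0 := PI_RGT_0.
apply: Rle_trans (RInt_abs_bound (C := 2 * G * G) _ _ _) _; first lra.
- exact: continuous_corr_density.
- move=> x _; apply: mul_bound; first exact: corr_density_bracket_bound.
  by have [h1 h2] := slow_bound G10 A Y (Dom_e D) x; rewrite Rabs_pos_eq //; lra.
rewrite Rminus_0_r; have -> : G ^ 4 = G * G * (G * G) by ring.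
have -> : 2 * G * G * (2 * PI) = G * G * (4 * PI) by ring.
by apply: Rmult_le_compat_l; nra.
Qed.

Lemma corrector_bound : eta <= Rabs (sin (u * period A Y e / 2)) ->
  Rabs (corrector t A Y e th u) <= G ^ 4 / eta.
Proof.
move=> hs; rewrite /corrector Rabs_div; last by move=> h0; move: hs; rewrite (_ : sin _ = 0) ?Rabs_R0; lra.
apply: Rmult_le_compat; first exact: Rabs_pos.
- by apply: Rlt_le; apply: Rinv_0_lt_compat; rewrite Rabs_mult (Rabs_pos_eq 2); lra.
- exact: corr_integral_bound.
- by apply: Rinv_le_contravar; [lra | rewrite Rabs_mult (Rabs_pos_eq 2); lra].
Qed.

(** Following the unperturbed flow only slides the window of integration: density, period and
    divisor are invariant. *)
Lemma corrector_rot x :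
  corrector t (rotA A Y x) (rotY A Y x) e (th + u * phase A Y e x) u =
  RInt (corr_density t A Y e th u) x (x + 2 * PI) / (2 * sin (u * period A Y e / 2)).
Proof.
rewrite /corrector period_rot //; congr (_ / _).
rewrite (RInt_ext _ (fun y => corr_density t A Y e th u (y + x))).
  by rewrite RInt_shift ?Rplus_0_l 1?Rplus_comm //; exact: continuous_corr_density.
move=> y _; rewrite /corr_density slow_rot rotA_add rotY_add.
suff -> : angle (rotA A Y x) (rotY A Y x) e (th + u * phase A Y e x) u y =
          angle A Y e th u (y + x) by [].
by rewrite /angle phase_rot // period_rot //; ring.
Qed.

(** By the fundamental theorem of calculus the derivative is the difference of the densities at the
    two ends of the window, where the rotation is the same and the phase differs by [u T]. The
    factor [slow] is dt/dx. *)
Lemma is_derive_corrector_rot : sin (u * period A Y e / 2) <> 0 ->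
  is_derive (fun x => corrector t (rotA A Y x) (rotY A Y x) e (th + u * phase A Y e x) u) 0
    ((F1 t A Y e * sin th + F2 t A Y e * cos th) * slow A Y e 0).
Proof.
move=> s0; set s := u * _ / 2 in s0 *.
apply: (is_derive_ext (fun x => (RInt (corr_density t A Y e th u) 0 (x + 2 * PI) -
    RInt (corr_density t A Y e th u) 0 x) / (2 * sin s))).
  move=> x; rewrite corrector_rot; congr (_ / _).
  rewrite (RInt_chasles 0 x (x + 2 * PI)); last exact: continuous_corr_density.
  have h : forall v w : R, v + w - v = w by move=> v w; ring.
  exact: h.
have h0 := is_derive_prim 0 0 continuous_corr_density.
have h1 := is_derive_prim 0 (0 + 2 * PI) continuous_corr_density.
set K := corr_density t A Y e th u in h0 h1 *.
have dd (Q : R -> R) q0 q1 : is_derive Q 0 q0 -> is_derive Q (0 + 2 * PI) q1 ->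
    is_derive (fun x => (Q (x + 2 * PI) - Q x) / (2 * sin s)) 0 ((q1 - q0) / (2 * sin s)).
  move=> k0 k1; auto_derive.
    by split; [exists q1 | split; [exists q0|]].
  by rewrite (is_derive_unique _ _ _ k0) (is_derive_unique _ _ _ k1); field.
have := dd (RInt K 0) _ _ h0 h1; rewrite Rplus_0_l.
set rhs := (_ - _) / _; suff -> : rhs = (F1 t A Y e * sin th + F2 t A Y e * cos th) * slow A Y e 0 by [].
rewrite /rhs {dd h0 h1}.
have ang0 : angle A Y e th u 0 = th - s by rewrite /angle phase_0 /s; ring.
have ang1 : angle A Y e th u (2 * PI) = th + s by rewrite /angle /s /period; field.
have -> : K (2 * PI) = (- F1 t A Y e * cos (th + s) + F2 t A Y e * sin (th + s)) * slow A Y e 0.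
  have := rotA_2PI A Y 0; have := rotY_2PI A Y 0; have := slow_2PI A Y e 0.
  by rewrite rotA_0 rotY_0 Rplus_0_l /K /corr_density ang1 => -> -> ->.
have -> : K 0 = (- F1 t A Y e * cos (th - s) + F2 t A Y e * sin (th - s)) * slow A Y e 0.
  by rewrite /K /corr_density ang0 rotA_0 rotY_0.
rewrite cos_plus cos_minus sin_plus sin_minus; field => //.
Qed.

End Fixed.

(** The exponent adds up the losses: [G ^ 8] for [u] times the phase, [G ^ 9] for the angle,
    [G ^ 12] for the density, and one more power for the length of the turn and the numerical
    factors. The square of [eta] comes from the difference of two inverse divisors. *)
Lemma corrector_lip t A Y e th u t' A' Y' e' th' u' r :
  a <= t <= b -> a <= t' <= b -> Dom (A ^ 2 + Y ^ 2) e -> Dom (A' ^ 2 + Y' ^ 2) e' ->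
  mu * Rabs (t - t') <= r -> Rabs (A - A') <= r -> Rabs (Y - Y') <= r -> Rabs (e - e') <= r ->
  Rabs (th - th') <= r -> Rabs (u - u') <= r -> Rabs u <= G ->
  eta <= Rabs (sin (u * period A Y e / 2)) -> eta <= Rabs (sin (u' * period A' Y' e' / 2)) ->
  Rabs (corrector t A Y e th u - corrector t' A' Y' e' th' u') <= G ^ 13 / eta ^ 2 * r.
Proof.
move=> ht ht' D D' dt dA dY de dth du uG hs hs'.
have r0 := r_ge0_of dA; have P4 := PI_4; have P0 := PI_RGT_0.
have ph x : 0 <= x <= 2 * PI ->
    Rabs (u * phase A Y e x - u' * phase A' Y' e' x) <= G ^ 8 * r.
  move=> hx.
  apply: Rle_trans (mul_diff_bound uG (phase_bound G10 (Dom_e D') (Dom_k D') hx) du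
    (phase_lip G10 (Dom_e D) (Dom_e D') (Dom_k D) (Dom_k D') dA dY de hx)) _.
  have := pow_G_gt0 G10 7; have := pow_G_10 G10 7; have := pow_G_le G10 (m := 2) (n := 7) ltac:(lia).
  have -> : G * (G ^ 6 * r) + r * G ^ 2 = (G ^ 7 + G ^ 2) * r by ring.
  by move=> *; apply: Rmult_le_compat_r => //; lra.
have per : Rabs (u * period A Y e / 2 - u' * period A' Y' e' / 2) <= G ^ 8 * r.
  have := ph (2 * PI) ltac:(lra); rewrite -/(period A Y e) -/(period A' Y' e') => h.
  have -> : u * period A Y e / 2 - u' * period A' Y' e' / 2 =
            (u * period A Y e - u' * period A' Y' e') * / 2 by field.
  rewrite Rabs_mult (Rabs_pos_eq (/ 2)); last lra.
  have := Rabs_pos (u * period A Y e - u' * period A' Y' e'); lra.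
have ang x : 0 <= x <= 2 * PI ->
    Rabs (angle A Y e th u x - angle A' Y' e' th' u' x) <= G ^ 9 * r.
  move=> hx.
  have -> : angle A Y e th u x - angle A' Y' e' th' u' x = (th - th') +
     (u * phase A Y e x - u' * phase A' Y' e' x) -
     (u * period A Y e / 2 - u' * period A' Y' e' / 2) by rewrite /angle; ring.
  apply: Rle_trans (sub_bound (add_bound dth (ph x hx)) per) _.
  have -> : r + G ^ 8 * r + G ^ 8 * r = (1 + 2 * G ^ 8) * r by ring.
  have := pow_G_10 G10 8; have := pow_G_ge1 G10 8.
  by move=> *; apply: Rmult_le_compat_r => //; lra.
have dens x : 0 <= x <= 2 * PI ->
    Rabs (corr_density t A Y e th u x - corr_density t' A' Y' e' th' u' x) <= G ^ 12 * r.
  move=> hx.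
  have [s1 s2] := slow_bound G10 A' Y' (Dom_e D') x.
  apply: Rle_trans (mul_diff_bound (corr_density_bracket_bound th u ht D x) (Cb := G) _
    (da := 4 * (G ^ 10 * r)) _
    (slow_lip G10 (Dom_e D) (Dom_e D') (Dom_k D) (Dom_k D') dA dY de x)) _.
  - by rewrite Rabs_pos_eq //; lra.
  - have G5 := pow_G_le G10 (m := 5) (n := 10) ltac:(lia).
    have trig (h : R -> R) : (forall x y, Rabs (h x - h y) <= Rabs (x - y)) ->
      Rabs (h (angle A Y e th u x) - h (angle A' Y' e' th' u' x)) <= G ^ 9 * r.
      by move=> lh; apply: Rle_trans (lh _ _) (ang x hx).
    have one F h : regular_observable F -> (forall x, Rabs (h x) <= 1) ->
      (forall x y, Rabs (h x - h y) <= Rabs (x - y)) ->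
      Rabs (F t (rotA A Y x) (rotY A Y x) e * h (angle A Y e th u x) -
        F t' (rotA A' Y' x) (rotY A' Y' x) e' * h (angle A' Y' e' th' u' x)) <= 2 * (G ^ 10 * r).
      move=> rF bh lh.
      apply: Rle_trans (mul_diff_bound (proj1 rF _ _ _ _ ht (Dom_rot x D)) (bh _)
        (observable_rot_lip x rF ht ht' D D' dt dA dY de) (trig h lh)) _.
      have -> : G * (G ^ 9 * r) + G ^ 5 * r * 1 = (G ^ 10 + G ^ 5) * r by ring.
      have -> : 2 * (G ^ 10 * r) = (2 * G ^ 10) * r by ring.
      by apply: Rmult_le_compat_r => //; lra.
    have -> : 4 * (G ^ 10 * r) = 2 * (G ^ 10 * r) + 2 * (G ^ 10 * r) by ring.
    apply: add_diff_bound; last exact: one regF2 abs_sin_le sin_lip.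
    rewrite !Ropp_mult_distr_l_reverse.
    rewrite (_ : forall v w, - v - - w = - (v - w)); last by move=> *; ring.
    by rewrite Rabs_Ropp; exact: one regF1 abs_cos_le cos_lip.
  have -> : 2 * G * (G ^ 5 * r) + 4 * (G ^ 10 * r) * G = (2 * G ^ 6 + 4 * G ^ 11) * r by ring.
  have := pow_G_le G10 (m := 6) (n := 11) ltac:(lia); have := pow_G_10 G10 11; have := pow_G_gt0 G10 11.
  by move=> *; apply: Rmult_le_compat_r => //; lra.
have int : Rabs (RInt (corr_density t A Y e th u) 0 (2 * PI) -
                 RInt (corr_density t' A' Y' e' th' u') 0 (2 * PI)) <= G ^ 12 * r * (2 * PI - 0).
  apply: RInt_diff_bound => //; first lra.
    exact: continuous_corr_density.
  exact: continuous_corr_density.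
have int' := corr_integral_bound th' u' ht' D'.
have sdiff := Rle_trans _ _ _ (sin_lip _ _) per.
rewrite /corrector.
set N := RInt _ _ _ in int *; set N' := RInt (corr_density t' _ _ _ _ _) _ _ in int int' *.
set s := sin _ in hs sdiff *; set s' := sin _ in hs' sdiff *.
have s_n0 : s <> 0 by move=> h0; move: hs; rewrite h0 Rabs_R0; lra.
have s'_n0 : s' <> 0 by move=> h0; move: hs'; rewrite h0 Rabs_R0; lra.
have inv x : eta <= Rabs x -> Rabs (/ x) <= / eta.
  move=> hx; rewrite Rabs_inv; apply: Rinv_le_contravar; lra.
have ie : 1 <= / eta by rewrite -Rinv_1; apply: Rinv_le_contravar; lra.
have -> : N / (2 * s) - N' / (2 * s') = / 2 * ((N - N') * / s - N' * (s - s') * (/ s * / s')).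
  by field.
rewrite Rabs_mult (Rabs_pos_eq (/ 2)); last lra.
have h := sub_bound (mul_bound int (inv _ hs)) (mul_bound (mul_bound int' sdiff) (mul_bound (inv _ hs) (inv _ hs'))).
have G12 := Rmult_le_pos _ _ (Rlt_le _ _ (pow_G_gt0 G10 12)) r0.
have -> : G ^ 13 / eta ^ 2 * r = G * (G ^ 12 * r) * (/ eta * / eta) by field; lra.
have hh : G ^ 4 * (G ^ 8 * r) = G ^ 12 * r by ring.
rewrite hh in h; set X := G ^ 12 * r in h G12 *.
have e2 : / eta <= / eta * / eta by nra.
have x1 : X * (2 * PI - 0) * / eta <= X * 8 * (/ eta * / eta).
  by apply: Rmult_le_compat => //; nra.
have x2 : 10 * X * (/ eta * / eta) <= G * X * (/ eta * / eta).
  by apply: Rmult_le_compat_r; [nra | apply: Rmult_le_compat_r].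
have x3 : 0 <= X * (/ eta * / eta) by apply: Rmult_le_pos => //; nra.
lra.
Qed.

Section Orbit.
Variables (A Y e th u acc dA dY de dth du : R -> R).
Hypothesis ab : a <= b.
Hypothesis D : forall t, a <= t <= b -> Dom (A t ^ 2 + Y t ^ 2) (e t).
Hypothesis uG : forall t, a <= t <= b -> Rabs (u t) <= G.
Hypothesis A' : forall t, a <= t <= b -> is_derive A t (dA t) /\
  Rabs (dA t - Y t * sqrt (e t + A t ^ 2)) <= G * mu.
Hypothesis Y' : forall t, a <= t <= b -> is_derive Y t (dY t) /\
  Rabs (dY t + A t * sqrt (e t + A t ^ 2)) <= G * mu.
Hypothesis e' : forall t, a <= t <= b -> is_derive e t (de t) /\ Rabs (de t) <= G * mu.
Hypothesis th' : forall t, a <= t <= b -> is_derive th t (dth t) /\ Rabs (dth t - u t) <= G * mu.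
Hypothesis u' : forall t, a <= t <= b -> is_derive u t (du t) /\ Rabs (du t) <= G * mu.
Hypothesis acc' : forall t, a <= t <= b -> is_derive acc t
  (mu * (F1 t (A t) (Y t) (e t) * sin (th t) + F2 t (A t) (Y t) (e t) * cos (th t))).
Hypothesis nonres : forall t, a <= t <= b ->
  eta <= Rabs (sin (u t * period (A t) (Y t) (e t) / 2)).

Let corr t := corrector t (A t) (Y t) (e t) (th t) (u t).

(** The quantity [acc - mu * corr] moves with speed O(mu^2). At each time the orbit is, up to a
    velocity O(mu), the unperturbed flow through its current point, along which the corrector
    cancels the harmonic exactly; the velocity error costs [mu] times the Lipschitz constant of the
    corrector. *)
Lemma nonresonant_drift :
  Rabs (acc b - acc a) <= mu * (2 * G ^ 4 / eta) + mu ^ 2 * (G ^ 14 / eta ^ 2) * (b - a).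
Proof.
set L := G ^ 13 / eta ^ 2.
have L_gt0 : 0 < L by apply: Rdiv_lt_0_compat; [exact: pow_G_gt0 | apply: pow_lt; lra].
have corrb t : a <= t <= b -> Rabs (corr t) <= G ^ 4 / eta.
  by move=> ht; apply: corrector_bound => //; [exact: D | exact: nonres].
suff : Rabs ((acc b - mu * corr b) - (acc a - mu * corr a)) <= mu * (L * (G * mu)) * (b - a).
  have -> : mu * (L * (G * mu)) * (b - a) = mu ^ 2 * (G ^ 14 / eta ^ 2) * (b - a).
    by rewrite /L; field; lra.
  move=> h.
  have -> : acc b - acc a = mu * corr b - mu * corr a +
    ((acc b - mu * corr b) - (acc a - mu * corr a)) by ring.
  have -> : mu * (2 * G ^ 4 / eta) = mu * (G ^ 4 / eta) + mu * (G ^ 4 / eta) by field; lra.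
  have muR : Rabs mu <= mu by rewrite Rabs_pos_eq; lra.
  apply: add_bound => //; apply: sub_bound; apply: mul_bound => //; apply: corrb; lra.
apply: (@dini_bound (fun t => acc t - mu * corr t)) => // t ht eps eps_gt0.
(* Three errors of size [e0] are made: in the derivative of [acc], in the coordinates fed to the
   corrector, and in the derivative of the corrector. With their weights they add up to [eps]. *)
pose e0 := eps / (1 + mu * L + mu).
have den : 0 < 1 + mu * L + mu by have := Rmult_le_pos _ _ mu_ge0 (Rlt_le _ _ L_gt0); lra.
have e0_gt0 : 0 < e0 by apply: Rdiv_lt_0_compat.
have e0E : eps = e0 + mu * (L * e0) + mu * e0 by rewrite /e0; field; lra.
have eg : 0 < e t by apply: (e_gt0_of G10); exact: Dom_e (D ht).
have Bgt0 := speed_gt0 (A t) (Y t) eg 0; rewrite rotA_0 in Bgt0.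
set B := sqrt _ in Bgt0.
have slowB : slow (A t) (Y t) (e t) 0 = / B by rewrite /slow rotA_0.
(* The rotation angle with its speed frozen at time [t]: it is only tangent to the true one, which
   is all that [dini_bound] requires. *)
pose x s := (s - t) * B.
have x0 : x t = 0 by rewrite /x; ring.
have hx : is_derive x t B by rewrite /x; auto_derive => //; ring.
have sh f df : is_derive f 0 df -> is_derive (fun s => f (x s)) t (B * df).
  by move=> hf; apply: (is_derive_comp f x) => //; rewrite x0.
have [hA bA] := A' ht; have [hY bY] := Y' ht; have [he be] := e' ht.
have [hth bth] := th' ht; have [hu bu] := u' ht.
pose rA s := rotA (A t) (Y t) (x s); pose rY s := rotY (A t) (Y t) (x s).
pose rth s := th t + u t * phase (A t) (Y t) (e t) (x s).
have [d1 [d1_gt0 cA]] : exists d, 0 < d /\ forall s, Rabs (s - t) < d ->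
    Rabs (A s - rA s) <= (G * mu + e0) * Rabs (s - t).
  apply: (derive_close hA (sh _ _ (is_derive_rotA _ _ _))) => //; first by rewrite x0 rotA_0.
  by rewrite rotY_0 Rmult_comm.
have [d2 [d2_gt0 cY]] : exists d, 0 < d /\ forall s, Rabs (s - t) < d ->
    Rabs (Y s - rY s) <= (G * mu + e0) * Rabs (s - t).
  apply: (derive_close hY (sh _ _ (is_derive_rotY _ _ _))) => //; first by rewrite x0 rotY_0.
  by rewrite rotA_0; have -> : dY t - B * - A t = dY t + A t * B by ring.
have [d3 [d3_gt0 ce]] : exists d, 0 < d /\ forall s, Rabs (s - t) < d ->
    Rabs (e s - e t) <= (G * mu + e0) * Rabs (s - t).
  by apply: (derive_close he (is_derive_const (e t) t)) => //; rewrite Rminus_0_r.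
have [d4 [d4_gt0 cth]] : exists d, 0 < d /\ forall s, Rabs (s - t) < d ->
    Rabs (th s - rth s) <= (G * mu + e0) * Rabs (s - t).
  have hp := sh _ _ (is_derive_phase (A t) (Y t) eg 0).
  have affine (f : R -> R) l : is_derive f t l -> is_derive (fun s => th t + u t * f s) t (u t * l).
    by move=> hf; auto_derive; [exists l | rewrite (is_derive_unique _ _ _ hf); ring].
  apply: (derive_close hth (affine _ _ hp)) => //; first by rewrite x0 phase_0; ring.
  by rewrite slowB Rinv_r ?Rmult_1_r //; lra.
have [d5 [d5_gt0 cu]] : exists d, 0 < d /\ forall s, Rabs (s - t) < d ->
    Rabs (u s - u t) <= (G * mu + e0) * Rabs (s - t).
  by apply: (derive_close hu (is_derive_const (u t) t)) => //; rewrite Rminus_0_r.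
have [d6 [d6_gt0 cacc]] := derive_eps (acc' ht) e0_gt0.
set c := F1 _ _ _ _ * _ + _ in cacc.
have sn0 : sin (u t * period (A t) (Y t) (e t) / 2) <> 0.
  by move=> h; have := nonres ht; rewrite h Rabs_R0; lra.
have := derive_eps (sh _ _ (is_derive_corrector_rot (th t) ht (D ht) sn0)) e0_gt0.
rewrite -/c x0 rotA_0 rotY_0 phase_0 Rmult_0_r Rplus_0_r slowB -/(corr t) => -[d7 [d7_gt0 ccorr]].
have muR : Rabs mu <= mu by rewrite Rabs_pos_eq; lra.
exists (Rmin (Rmin (Rmin d1 d2) (Rmin d3 d4)) (Rmin (Rmin d5 d6) d7)); split.
  by repeat apply: Rmin_glb_lt.
move=> s hs hst.
have split_min p q : Rabs (s - t) < Rmin p q -> Rabs (s - t) < p /\ Rabs (s - t) < q.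
  by move=> h; split; [exact: Rlt_le_trans h (Rmin_l _ _) | exact: Rlt_le_trans h (Rmin_r _ _)].
have [/split_min[/split_min[k1 k2] /split_min[k3 k4]] /split_min[/split_min[k5 k6] k7]] := split_min _ _ hst.
have r := Rabs_pos (s - t).
have lip : Rabs (corr s - corrector t (rA s) (rY s) (e t) (rth s) (u t)) <=
    L * ((G * mu + e0) * Rabs (s - t)).
  apply: corrector_lip => //.
  - exact: D.
  - by rewrite /rA /rY; apply: Dom_rot; exact: D.
  - by apply: Rmult_le_compat_r => //; nra.
  - exact: cA.
  - exact: cY.
  - exact: ce.
  - exact: cth.
  - exact: cu.
  - exact: uG.
  - exact: nonres.
  - by rewrite /rA /rY period_rot //; exact: nonres.
have := ccorr s k7; rewrite -/(rA s) -/(rY s) -/(rth s).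
set W := corrector _ _ _ _ _ _ in lip *; move=> h7.
have h6 := cacc s k6.
have -> : acc s - mu * corr s - (acc t - mu * corr t) =
  (acc s - acc t - mu * c * (s - t)) - mu * (corr s - W) -
  mu * (W - corr t - B * (c * / B) * (s - t)) by field; lra.
apply: Rle_trans (sub_bound (sub_bound h6 (mul_bound muR lip)) (mul_bound muR h7)) _.
rewrite e0E; right; ring.
Qed.

End Orbit.
End Corrector.

(** * The period as a function of the energy *)

(* [ch = 1] for librations and [ch = 0] for rotations; the period of the
   double angle is used in the latter case. *)
Definition well (ch e x : R) := e + (1 - ch * e) * sin x ^ 2.
Definition per (ch e : R) := RInt (fun x => / sqrt (well ch e x)) 0 (2 * PI).

Section Period.
Variables (G ch : R).
Hypothesis G10 : 10 <= G.
Hypothesis ch01 : ch = 0 \/ ch = 1.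

Definition energy_range e := / G <= e <= G /\ ch * e <= 1.

Lemma well_bounds e x : energy_range e -> / G <= well ch e x <= G ^ 2.
Proof.
move=> [[e1 e2] e3].
have s1 := pow2_ge_0 (sin x); have s2 : sin x ^ 2 <= 1.
  by have := sin2_cos2 x; have := pow2_ge_0 (cos x); rewrite /Rsqr; nra.
have e0 : 0 < / G by apply: Rinv_0_lt_compat; lra.
have ce : 0 <= 1 - ch * e <= 1 by split; [lra | case: ch01 => ->; nra].
rewrite /well; nra.
Qed.

Lemma well_gt0 e x : energy_range e -> 0 < well ch e x.
Proof.
move=> he; have [h _] := well_bounds x he; apply: Rlt_le_trans h.
by apply: Rinv_0_lt_compat; lra.
Qed.

Lemma sqrt_well_bounds e x : energy_range e -> / G <= sqrt (well ch e x) <= G.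
Proof.
move=> he; have [h1 h2] := well_bounds x he; split; first exact: sqrt_ge_invG.
rewrite -(sqrt_Rsqr G); last lra.
by apply: sqrt_le_1_alt; rewrite /Rsqr; lra.
Qed.

Lemma inv_sqrt_well_bounds e x : energy_range e -> / G <= / sqrt (well ch e x) <= G.
Proof.
move=> he; have [h1 h2] := sqrt_well_bounds x he.
have g0 : 0 < / G by apply: Rinv_0_lt_compat; lra.
split; first by apply: Rinv_le_contravar => //; lra.
exact: inv_le_G.
Qed.

Lemma continuous_well e x : continuous (well ch e) x.
Proof. by apply: ex_derive_continuous; rewrite /well; auto_derive. Qed.

Lemma continuous_inv_sqrt_well e x : energy_range e ->
  continuous (fun y => / sqrt (well ch e y)) x.
Proof.
move=> he; apply: (continuous_comp (fun y => sqrt (well ch e y)) Rinv).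
  by apply: (continuous_comp (well ch e) sqrt); [exact: continuous_well | exact: continuous_sqrt].
by apply: continuous_Rinv; have := sqrt_lt_R0 _ (well_gt0 x he); lra.
Qed.

Lemma per_bounds e : energy_range e -> / G <= per ch e <= G ^ 2.
Proof.
move=> he; have P4 := PI_4; have P2 := PI2_1.
have g0 : 0 < / G by apply: Rinv_0_lt_compat; lra.
have h (f : R -> R) c : RInt (fun _ : R => c) 0 (2 * PI) = 2 * PI * c.
  by rewrite RInt_const /scal /= /mult /=; ring.
have lo : 2 * PI * / G <= per ch e.
  rewrite -h //; apply: RInt_ge; first lra.
  - by move=> x; exact: continuous_inv_sqrt_well.
  - by move=> x; exact: continuous_const.
  - by move=> x; have := inv_sqrt_well_bounds x he; lra.
have hi : per ch e <= 2 * PI * G.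
  rewrite -h //; apply: RInt_ge; first lra.
  - by move=> x; exact: continuous_const.
  - by move=> x; exact: continuous_inv_sqrt_well.
  - by move=> x; have := inv_sqrt_well_bounds x he; lra.
split; first by nra.
by apply: Rle_trans hi _; nra.
Qed.

Lemma per_gt0 e : energy_range e -> 0 < per ch e.
Proof.
move=> he; have [h _] := per_bounds he; apply: Rlt_le_trans h.
by apply: Rinv_0_lt_compat; lra.
Qed.

Lemma well_sub e e' x : well ch e x - well ch e' x = (e - e') * (1 - ch * sin x ^ 2).
Proof. by rewrite /well; ring. Qed.

Lemma per_lip e e' : energy_range e -> energy_range e' ->
  Rabs (per ch e - per ch e') <= G ^ 4 * Rabs (e - e').
Proof.
move=> he he'; have P4 := PI_4; have P2 := PI2_1.
have h : Rabs (per ch e - per ch e') <= G ^ 3 * Rabs (e - e') * (2 * PI - 0).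
  apply: RInt_diff_bound; first lra.
  - by move=> x; exact: continuous_inv_sqrt_well.
  - by move=> x; exact: continuous_inv_sqrt_well.
  move=> x _; apply: Rle_trans (inv_sqrt_lip G10 (proj1 (well_bounds x he)) (proj1 (well_bounds x he'))) _.
  apply: Rmult_le_compat_l; first by apply: Rlt_le; exact: pow_G_gt0.
  rewrite well_sub Rabs_mult -{2}(Rmult_1_r (Rabs (e - e'))).
  apply: Rmult_le_compat_l; first exact: Rabs_pos.
  have := pow2_ge_0 (sin x); have := sin2_cos2 x; have := pow2_ge_0 (cos x); rewrite /Rsqr => *.
  by apply/Rabs_le_between; case: ch01 => ->; nra.
apply: Rle_trans h _; have := Rmult_le_pos _ _ (Rlt_le _ _ (pow_G_gt0 G10 3)) (Rabs_pos (e - e')).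
have -> : G ^ 4 * Rabs (e - e') = G ^ 3 * Rabs (e - e') * G by ring.
by move=> *; apply: Rmult_le_compat_l => //; lra.
Qed.

Lemma RInt_antiderivative (F f : R -> R) u v :
  (forall x, is_derive F x (f x)) -> (forall x, continuous f x) -> RInt f u v = F v - F u :> R.
Proof.
move=> dF cf; apply: is_RInt_unique.
by apply: (is_RInt_derive F f) => x _; [exact: dF | exact: cf].
Qed.

Lemma RInt_cos2 : RInt (fun x => cos x ^ 2) 0 (2 * PI) = PI :> R.
Proof.
rewrite (@RInt_antiderivative (fun x => (x + sin x * cos x) / 2)).
- by rewrite sin_2PI sin_0; field.
- move=> x; auto_derive => //; have := sin2_cos2 x; rewrite /Rsqr => h.
  have -> : cos x ^ 2 = (cos x * cos x + (1 - sin x * sin x)) / 2 by rewrite -h; field.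
  by field.
- by move=> x; apply: ex_derive_continuous; auto_derive.
Qed.

(** The derivative of the well in the energy is [1 - ch * sin x ^ 2], which is at least [cos x ^ 2]
    in both cases, and the integral of the latter is [PI]. This is the twist that separates
    frequencies of distinct energies. *)
Lemma per_decr e e' : energy_range e -> energy_range e' -> e <= e' ->
  (e' - e) / G ^ 3 <= per ch e - per ch e'.
Proof.
move=> he he' ee'; have P4 := PI_4; have P2 := PI2_1.
have G3 := pow_G_gt0 G10 3.
have key : RInt (fun x => (e' - e) / (2 * G ^ 3) * cos x ^ 2) 0 (2 * PI) <=
    RInt (fun x => / sqrt (well ch e x) + -1 * / sqrt (well ch e' x)) 0 (2 * PI).
  apply: RInt_ge; first lra.
  - move=> x; apply: cont_plus; first exact: continuous_inv_sqrt_well.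
    apply: cont_mult; [exact: continuous_const | exact: continuous_inv_sqrt_well].
  - by move=> x; apply: ex_derive_continuous; auto_derive.
  move=> x; have u0 := well_gt0 x he; have v0 := well_gt0 x he'.
  have -> : / sqrt (well ch e x) + -1 * / sqrt (well ch e' x) =
    / sqrt (well ch e x) - / sqrt (well ch e' x) by ring.
  rewrite inv_sqrt_diff // well_sub.
  have [s1 s1'] := sqrt_well_bounds x he; have [s2 s2'] := sqrt_well_bounds x he'.
  have r1 := sqrt_lt_R0 _ u0; have r2 := sqrt_lt_R0 _ v0.
  set a := sqrt _ in s1 s1' r1 *; set b := sqrt _ in s2 s2' r2 *.
  have -> : (e' - e) / (2 * G ^ 3) * cos x ^ 2 = (e' - e) * (cos x ^ 2 * / (2 * G ^ 3)) by field; lra.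
  rewrite Rmult_assoc; apply: Rmult_le_compat_l; first lra.
  have c0 := pow2_ge_0 (cos x); apply: Rmult_le_compat => //.
  - by apply: Rlt_le; apply: Rinv_0_lt_compat; lra.
  - by have := pow2_ge_0 (sin x); have := sin2_cos2 x; rewrite /Rsqr; case: ch01 => ->; nra.
  have -> : / a * / b * / (a + b) = / (a * b * (a + b)) by field; lra.
  apply: Rinv_le_contravar; first by repeat apply: Rmult_lt_0_compat; lra.
  have -> : 2 * G ^ 3 = G * G * (G + G) by ring.
  apply: Rmult_le_compat; [nra | lra | | lra].
  by apply: Rmult_le_compat; lra.
move: key; rewrite RInt_scale; last by move=> x; apply: ex_derive_continuous; auto_derive.
rewrite RInt_cos2 RInt_add.
- rewrite RInt_scale; last by move=> x; exact: continuous_inv_sqrt_well.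
  rewrite -/(per ch e) -/(per ch e') => h.
  have -> : per ch e - per ch e' = per ch e + -1 * per ch e' by ring.
  apply: Rle_trans h.
  have -> : (e' - e) / (2 * G ^ 3) * PI = (e' - e) / G ^ 3 * (PI / 2) by field; lra.
  rewrite -{1}(Rmult_1_r (_ / _)); apply: Rmult_le_compat_l; last lra.
  by apply: Rdiv_le_0_compat; lra.
- by move=> x; exact: continuous_inv_sqrt_well.
- by move=> x; apply: cont_mult; [exact: continuous_const | exact: continuous_inv_sqrt_well].
Qed.

Lemma RInt_sin2_poly (Q P : R) :
  RInt (fun x => (Q + P * sin x ^ 2) ^ 2) 0 (2 * PI) = 2 * PI * (Q ^ 2 + Q * P + 3 / 8 * P ^ 2) :> R.
Proof.
pose F x := (Q ^ 2 + Q * P + 3 / 8 * P ^ 2) * x - (Q * P + 3 / 8 * P ^ 2) * (sin x * cos x)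
  - P ^ 2 / 4 * (sin x ^ 3 * cos x).
rewrite (@RInt_antiderivative F).
- by rewrite /F sin_2PI sin_0; field.
- move=> x; rewrite /F; auto_derive => //; have := sin2_cos2 x; rewrite /Rsqr => h.
  have h' : cos x * cos x = 1 - sin x * sin x by lra.
  transitivity ((Q ^ 2 + Q * P + 3 / 8 * P ^ 2) - (Q * P + 3 / 8 * P ^ 2) * ((cos x * cos x) - sin x * sin x)
     - P ^ 2 / 4 * (3 * sin x ^ 2 * (cos x * cos x) - sin x ^ 4)); first by field.
  by rewrite h'; field.
- by move=> x; apply: ex_derive_continuous; auto_derive.
Qed.

(* The tangent line of x -> x^{-1/2} at y^-2, with its quadratic defect. *)
Lemma inv_sqrt_tangent (x y : R) : 0 < x -> 0 < y ->
  3 / 2 * y - y ^ 3 / x ^ 2 / 2 + (x - y) ^ 2 / x <= x.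
Proof.
move=> x0 y0.
have -> : 3 / 2 * y - y ^ 3 / x ^ 2 / 2 + (x - y) ^ 2 / x = x - (x - y) ^ 2 * y / (2 * x ^ 2) by field; lra.
have : 0 <= (x - y) ^ 2 * y / (2 * x ^ 2); last lra.
apply: Rdiv_le_0_compat; last by have := pow_lt x 2 x0; lra.
by have := pow2_ge_0 (x - y); nra.
Qed.

(** The defect of the tangent line at [y = (s g1) ^ (-1/2)], evaluated at [x = g ^ (-1/2)], detects
    how far [g] is from [s g1], because [x ^ 2 - y ^ 2] is proportional to [s g1 - g]. *)
Lemma inv_sqrt_gap (g g1 s x y : R) : / G <= x <= G -> 0 < y <= G ^ 3 ->
  0 < g <= G ^ 2 -> 0 < g1 <= G ^ 2 -> 0 < s <= G ^ 4 ->
  x ^ 2 = / g -> y ^ 2 = / (s * g1) ->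
  / G ^ 25 * (g - s * g1) ^ 2 <= (x - y) ^ 2 / x.
Proof.
move=> [x1 x2] [y1 y2] [g0 gG] [g10 g1G] [s0 sG] xg yg.
have gi : 0 < / G by apply: Rinv_0_lt_compat; lra.
have x0 : 0 < x by lra.
have sg0 : 0 < s * g1 by exact: Rmult_lt_0_compat.
have d : (x - y) * (x + y) * (g * (s * g1)) = s * g1 - g.
  have -> : (x - y) * (x + y) = x ^ 2 - y ^ 2 by ring.
  by rewrite xg yg; field; lra.
have e1 : (g - s * g1) ^ 2 = (x - y) ^ 2 * ((x + y) * (g * (s * g1))) ^ 2.
  by rewrite -(Rpow_mult_distr (x - y)) -Rmult_assoc d; ring.
have e2 : (x + y) * (g * (s * g1)) <= G ^ 12.
  have -> : G ^ 12 = G ^ 4 * (G ^ 2 * (G ^ 4 * G ^ 2)) by ring.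
  have p2 := pow_G_gt0 G10 2; have p3 := pow_G_10 G10 3; have q3 := pow_G_10 G10 2.
  apply: Rmult_le_compat; [lra | by apply: Rlt_le; exact: Rmult_lt_0_compat | | ].
    by have := pow_G_le G10 (m := 1) (n := 3) ltac:(lia); rewrite pow_1; lra.
  apply: Rmult_le_compat => //; try lra.
  by apply: Rmult_le_compat; lra.
have e3 : 0 < (x + y) * (g * (s * g1)).
  by repeat apply: Rmult_lt_0_compat => //; lra.
rewrite e1; set m := (x + y) * (g * (s * g1)) in e2 e3 *.
have G24 := pow_G_gt0 G10 24.
have m2 : m ^ 2 <= G ^ 24.
  rewrite (_ : G ^ 24 = (G ^ 12) ^ 2); last ring.
  by apply: pow_incr; lra.
have xm : / G <= / x by apply: Rinv_le_contravar.
have q := pow2_ge_0 (x - y).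
apply: Rle_trans (_ : / G * (x - y) ^ 2 <= _); last by rewrite /Rdiv; nra.
have -> : / G ^ 25 * ((x - y) ^ 2 * m ^ 2) = (/ G * (x - y) ^ 2) * (m ^ 2 / G ^ 24) by field; lra.
rewrite -{2}(Rmult_1_r (/ G * _)); apply: Rmult_le_compat_l; first nra.
by apply/Rle_div_l; lra.
Qed.

(** No well is a multiple of another one. The quadratic form is positive definite since
    [3 / 8 > 1 / 4], so it controls [Q] and [P], and [e - e1] is the combination
    [(1 - ch * e1) * Q - e1 * P], from which [s] has been eliminated. *)
Lemma quadratic_lower (e e1 s : R) : 0 < e1 <= G ->
  let Q := e - s * e1 in let P := (1 - ch * e) - s * (1 - ch * e1) in
  (e - e1) ^ 2 / G ^ 3 <= 2 * PI * (Q ^ 2 + Q * P + 3 / 8 * P ^ 2).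
Proof.
move=> [e10 e1G] Q P; have P2 := PI2_1.
set X := Q ^ 2 + _ + _.
have X1 : Q ^ 2 <= 3 * X by rewrite /X; have := pow2_ge_0 (Q + 3 / 4 * P); nra.
have X2 : P ^ 2 <= 8 * X by rewrite /X; have := pow2_ge_0 (Q + P / 2); nra.
have h : e - e1 = Q - (P + ch * Q) * e1 by rewrite /P /Q; ring.
have c : Rabs (1 - ch * e1) <= G by case: ch01 => ->; apply/Rabs_le_between; lra.
have -> : e - e1 = (1 - ch * e1) * Q - P * e1 by rewrite h; ring.
have h2 : ((1 - ch * e1) * Q - P * e1) ^ 2 <= 2 * (G * Q) ^ 2 + 2 * (G * P) ^ 2.
  have c2 : (1 - ch * e1) ^ 2 <= G ^ 2.
    by rewrite -(pow2_abs (1 - _)); apply: pow_incr; split=> //; exact: Rabs_pos.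
  have c3 : e1 ^ 2 <= G ^ 2 by apply: pow_incr; lra.
  have q0 := pow2_ge_0 Q; have p0 := pow2_ge_0 P.
  have a1 := Rmult_le_compat_r _ _ _ q0 c2; have a2 := Rmult_le_compat_r _ _ _ p0 c3.
  have := pow2_ge_0 ((1 - ch * e1) * Q + P * e1); rewrite !Rpow_mult_distr; nra.
apply/Rle_div_l; first exact: pow_G_gt0.
apply: Rle_trans h2 _; rewrite !Rpow_mult_distr.
have g2 := pow_G_gt0 G10 2; have X0 : 0 <= X by have := pow2_ge_0 Q; lra.
have -> : 2 * PI * X * G ^ 3 = G ^ 2 * (2 * PI * G * X) by ring.
have -> : 2 * (G ^ 2 * Q ^ 2) + 2 * (G ^ 2 * P ^ 2) = G ^ 2 * (2 * Q ^ 2 + 2 * P ^ 2) by ring.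
apply: Rmult_le_compat_l; first lra.
apply: Rle_trans (_ : 22 * X <= _); first lra.
by apply: Rmult_le_compat_r => //; nra.
Qed.

(* Reverse Minkowski: (int g^{-1/2})^{-2} is a strictly concave function of g. *)
Lemma per_concave e1 : energy_range e1 -> exists kap, forall e, energy_range e ->
  / per ch e ^ 2 <= / per ch e1 ^ 2 * (1 + kap * (e - e1)) - (e - e1) ^ 2 / G ^ 34.
Proof.
move=> he1; have P2 := PI2_1; have P4 := PI_4.
have T1_gt0 := per_gt0 he1; have gi : 0 < / G by apply: Rinv_0_lt_compat; lra.
pose be x := / sqrt (well ch e1 x).
have cbe x : continuous be x by exact: continuous_inv_sqrt_well.
have cbe3 x : continuous (fun y => be y ^ 3) x.
  by apply: (continuous_comp be (fun z => z ^ 3)) => //; apply: ex_derive_continuous; auto_derive.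
have csin x : continuous (fun y => 1 - ch * sin y ^ 2) x by apply: ex_derive_continuous; auto_derive.
(* The logarithmic derivative of [1 / per ^ 2] at [e1]. As the well is affine in the energy,
   [1 + kap * (e - e1)] is exactly the mean of [well e / well e1] for the weight
   [well e1 ^ (-1/2)]. *)
exists (RInt (fun x => (1 - ch * sin x ^ 2) * be x ^ 3) 0 (2 * PI) / per ch e1) => e he.
set kap := _ / _; set s := 1 + kap * (e - e1).
have be2 x : be x ^ 2 = / well ch e1 x.
  by rewrite /be pow_inv pow2_sqrt //; apply: Rlt_le; exact: well_gt0.
have sT1 : RInt (fun x => well ch e x * be x ^ 3) 0 (2 * PI) = s * per ch e1 :> R.
  have -> : s * per ch e1 = per ch e1 + (e - e1) * RInt (fun x => (1 - ch * sin x ^ 2) * be x ^ 3) 0 (2 * PI).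
    by rewrite /s /kap; field; lra.
  rewrite -RInt_scale; last by move=> x; exact: cont_mult.
  rewrite -RInt_add //; last by move=> x; apply: cont_mult; [exact: cont_cst | exact: cont_mult].
  apply: RInt_eq => x; rewrite -/(be x).
  have -> : well ch e x = well ch e1 x + (e - e1) * (1 - ch * sin x ^ 2) by have := well_sub e e1 x; lra.
  have -> : be x ^ 3 = be x ^ 2 * be x by ring.
  by rewrite be2; field; apply: Rgt_not_eq; exact: well_gt0.
have cw3 x : continuous (fun y => well ch e y * be y ^ 3) x.
  by apply: cont_mult => //; exact: continuous_well.
have s_lo : / G ^ 3 <= s.
  apply: (Rmult_le_reg_r (per ch e1)) => //; rewrite -sT1 /per -RInt_scale //.
  apply: RInt_ge => // [||x]; first lra.
    by move=> x; apply: cont_mult => //; exact: cont_cst.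
  have [w1 _] := well_bounds x he; have [b1 b2] := inv_sqrt_well_bounds x he1.
  rewrite -/(be x) in b1 b2 *.
  have -> : be x ^ 3 = be x ^ 2 * be x by ring.
  rewrite -Rmult_assoc; apply: Rmult_le_compat_r; first lra.
  have -> : / G ^ 3 = / G * (/ G) ^ 2 by field; lra.
  by apply: Rmult_le_compat; [lra | nra | done | apply: pow_incr; lra].
have s_hi : s <= G ^ 4.
  apply: (Rmult_le_reg_r (per ch e1)) => //; rewrite -sT1 /per -RInt_scale //.
  apply: RInt_ge => // [||x]; first lra.
    by move=> x; apply: cont_mult => //; exact: cont_cst.
  have [w1 w2] := well_bounds x he; have [b1 b2] := inv_sqrt_well_bounds x he1.
  rewrite -/(be x) in b1 b2 *.
  have -> : be x ^ 3 = be x ^ 2 * be x by ring.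
  rewrite -Rmult_assoc; apply: Rmult_le_compat_r; first lra.
  have -> : G ^ 4 = G ^ 2 * G ^ 2 by ring.
  by apply: Rmult_le_compat; [lra | exact: pow2_ge_0 | done | apply: pow_incr; lra].
have s_gt0 : 0 < s by apply: Rlt_le_trans s_lo; apply: Rinv_0_lt_compat; exact: pow_G_gt0.
have rs := sqrt_lt_R0 _ s_gt0; pose sg := / sqrt s.
have sg_gt0 : 0 < sg by exact: Rinv_0_lt_compat.
have sg2 : sg ^ 2 = / s by rewrite /sg pow_inv pow2_sqrt //; lra.
have sg_hi : sg <= G ^ 2.
  have : / s <= G ^ 3 by rewrite -(Rinv_inv (G ^ 3)); apply: Rinv_le_contravar => //; apply: Rinv_0_lt_compat; exact: pow_G_gt0.
  rewrite -sg2 => h; rewrite -(Rabs_pos_eq sg); last lra.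
  apply: abs_le_sqr; first by apply: Rlt_le; exact: pow_G_gt0.
  apply: Rle_trans h _; have -> : (G ^ 2) ^ 2 = G ^ 4 by ring.
  by apply: pow_G_le => //; lia.
pose Q := e - s * e1; pose P := (1 - ch * e) - s * (1 - ch * e1).
have cQP x : continuous (fun x => (Q + P * sin x ^ 2) ^ 2) x by apply: ex_derive_continuous; auto_derive.
have [[e1lo e1hi] _] := he1.
have quad := quadratic_lower e s (conj (Rlt_le_trans _ _ _ gi e1lo) e1hi); rewrite -/Q -/P /= in quad.
(* The exponent is 25 from [inv_sqrt_gap] plus 3 from [quadratic_lower]; passing from the period to
   its inverse square costs 6 more. *)
set del := (e - e1) ^ 2 / G ^ 28.
have T_lo : sg * per ch e1 + del <= per ch e.
  (* The tangent line at [sg * be x], with its defect. The choice of [s] makes the two linear terms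
     integrate to [3 / 2 - 1 / 2] times [sg * per ch e1]. *)
  pose low x := (3 / 2 * sg) * be x + (- (sg ^ 3 / 2)) * (well ch e x * be x ^ 3) + / G ^ 25 * (Q + P * sin x ^ 2) ^ 2.
  have c1 x : continuous (fun x => (3 / 2 * sg) * be x) x by apply: cont_mult => //; exact: cont_cst.
  have c2 x : continuous (fun x => (- (sg ^ 3 / 2)) * (well ch e x * be x ^ 3)) x.
    by apply: cont_mult => //; exact: cont_cst.
  have c3 x : continuous (fun x => / G ^ 25 * (Q + P * sin x ^ 2) ^ 2) x.
    by apply: cont_mult => //; exact: cont_cst.
  have c12 x : continuous (fun x => (3 / 2 * sg) * be x + (- (sg ^ 3 / 2)) * (well ch e x * be x ^ 3)) x.
    exact: cont_plus.
  have I : RInt low 0 (2 * PI) = 3 / 2 * sg * per ch e1 + - (sg ^ 3 / 2) * (s * per ch e1) +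
      / G ^ 25 * (2 * PI * (Q ^ 2 + Q * P + 3 / 8 * P ^ 2)).
    by rewrite /low RInt_add // RInt_add // !RInt_scale // sT1 RInt_sin2_poly.
  have low_le : RInt low 0 (2 * PI) <= per ch e.
    apply: RInt_ge; [lra | by move=> x; exact: continuous_inv_sqrt_well | by move=> x; exact: cont_plus|].
    move=> x; have [a1 a2] := inv_sqrt_well_bounds x he.
    have [b1 b2] := inv_sqrt_well_bounds x he1; rewrite -/(be x) in b1 b2.
    have w0 := well_gt0 x he; have w10 := well_gt0 x he1.
    have [_ wG] := well_bounds x he; have [_ w1G] := well_bounds x he1.
    set al := / sqrt _ in a1 a2 *.
    have al2 : al ^ 2 = / well ch e x by rewrite /al pow_inv pow2_sqrt //; lra.
    have y0 : 0 < sg * be x by apply: Rmult_lt_0_compat; lra.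
    have tan := inv_sqrt_tangent (Rlt_le_trans _ _ _ gi a1) y0.
    have gap := inv_sqrt_gap (conj a1 a2) (y := sg * be x) _ (conj w0 wG) (conj w10 w1G) (conj s_gt0 s_hi) al2.
    apply: Rle_trans tan; rewrite /low.
    have -> : (Q + P * sin x ^ 2) = well ch e x - s * well ch e1 x by rewrite /Q /P /well; ring.
    have -> : 3 / 2 * (sg * be x) - (sg * be x) ^ 3 / al ^ 2 / 2 =
       3 / 2 * sg * be x + - (sg ^ 3 / 2) * (well ch e x * be x ^ 3) by rewrite al2; field; lra.
    apply: Rplus_le_compat_l; apply: gap.
      split=> //; have -> : G ^ 3 = G ^ 2 * G by ring.
      by apply: Rmult_le_compat; lra.
    by rewrite Rpow_mult_distr sg2 be2; field; lra.
  apply: Rle_trans low_le; rewrite I.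
  have -> : 3 / 2 * sg * per ch e1 + - (sg ^ 3 / 2) * (s * per ch e1) = sg * per ch e1.
    have -> : sg ^ 3 = sg ^ 2 * sg by ring.
    by rewrite sg2; field; lra.
  apply: Rplus_le_compat_l.
  have -> : del = / G ^ 25 * ((e - e1) ^ 2 / G ^ 3) by rewrite /del; field; lra.
  apply: Rmult_le_compat_l; last exact: quad.
  by apply: Rlt_le; apply: Rinv_0_lt_compat; exact: pow_G_gt0.
have [_ TG] := per_bounds he; have T_gt0 := per_gt0 he.
have S_gt0 : 0 < sg * per ch e1 by exact: Rmult_lt_0_compat.
have -> : / per ch e1 ^ 2 * s = / (sg * per ch e1) ^ 2.
  by rewrite Rpow_mult_distr sg2; field; lra.
have del0 : 0 <= del by apply: Rdiv_le_0_compat; [exact: pow2_ge_0 | exact: pow_G_gt0].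
have -> : (e - e1) ^ 2 / G ^ 34 = del / G ^ 6 by rewrite /del; field; lra.
set S := sg * _ in T_lo S_gt0 *; set T := per ch e in T_lo TG T_gt0 *.
have -> : / T ^ 2 = / S ^ 2 - (T - S) * (T + S) / (S ^ 2 * T ^ 2) by field; lra.
suff : del / G ^ 6 <= (T - S) * (T + S) / (S ^ 2 * T ^ 2) by lra.
have h1 : del / T ^ 3 <= (T - S) * (T + S) / (S ^ 2 * T ^ 2).
  have -> : del / T ^ 3 = del * (T * S ^ 2 / T ^ 2) / (S ^ 2 * T ^ 2) by field; lra.
  apply: Rmult_le_compat_r; first by apply: Rlt_le; apply: Rinv_0_lt_compat; apply: Rmult_lt_0_compat; exact: pow_lt.
  apply: Rmult_le_compat => //; [| lra |].
    by apply: Rdiv_le_0_compat; [apply: Rmult_le_pos; [lra | exact: pow2_ge_0] | exact: pow_lt].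
  have -> : T * S ^ 2 / T ^ 2 = T * (S ^ 2 / T ^ 2) by field; lra.
  have : S ^ 2 / T ^ 2 <= 1.
    apply/Rle_div_l; first exact: pow_lt.
    by rewrite Rmult_1_l; apply: pow_incr; lra.
  by move=> ?; nra.
apply: Rle_trans h1; apply: Rmult_le_compat_l => //.
apply: Rinv_le_contravar; first exact: pow_lt.
have -> : G ^ 6 = (G ^ 2) ^ 3 by ring.
by apply: pow_incr; lra.
Qed.

End Period.

(** * Steepness: no drift inside a resonance *)

Definition dot (d : nat) (x y : 'I_d -> R) := rsum (fun j => x j * y j).

Section Steepness.
Variables (G : R) (d : nat) (T : finType) (nn : T -> 'I_d -> R) (ll : T -> R) (S : {set T}).
Hypothesis G10 : 10 <= G.
Hypothesis cardT : INR #|T| <= G.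

Let freq (I : 'I_d -> R) i := dot (nn i) I + ll i.

Lemma freq_sub I J i : freq J i - freq I i = dot (nn i) (fun j => J j - I j).
Proof.
rewrite /freq /dot (@rsum_ext _ (fun j => nn i j * (J j - I j)) (fun j => nn i j * J j - nn i j * I j)).
  by rewrite rsum_sub; ring.
by move=> j; ring.
Qed.

Lemma dot_combination (a : T -> R) (x y : 'I_d -> R) :
  (forall j, x j = rsum (fun i => nn i j * a i)) ->
  dot x y = rsum (fun i => a i * dot (nn i) y).
Proof.
move=> hx; rewrite /dot.
rewrite (@rsum_ext _ _ (fun j => rsum (fun i => a i * (nn i j * y j)))).
  by rewrite rsum_exchange; apply: rsum_ext => i; rewrite rsum_scal.
move=> j; rewrite hx Rmult_comm -rsum_scal; apply: rsum_ext => i; ring.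
Qed.

Section TwoTimes.
Variables (I0 I1 : 'I_d -> R) (E0 E1 w0 w1 : R) (a M : T -> R) (del : R).
Hypothesis dI : forall j, I1 j - I0 j = rsum (fun i => nn i j * a i).
Hypothesis dE : Rabs (E1 - E0 + rsum (fun i => a i * ((freq I0 i + freq I1 i) / 2))) <= del.
Hypothesis w0G : Rabs w0 <= G.
Hypothesis w1G : Rabs w1 <= G.
Hypothesis aG : forall i, Rabs (a i) <= G ^ 2.
Hypothesis uG0 : forall i, Rabs (freq I0 i) <= G ^ 3.
Hypothesis uG1 : forall i, Rabs (freq I1 i) <= G ^ 3.
Hypothesis res0 : forall i, i \in S -> Rabs (freq I0 i - M i * w0) <= del.
Hypothesis res1 : forall i, i \in S -> Rabs (freq I1 i - M i * w1) <= del.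
Hypothesis nonres : forall i, i \notin S -> Rabs (a i) <= del.

Let P j := I1 j - I0 j.

Lemma del_ge0 : 0 <= del.
Proof. exact: Rle_trans (Rabs_pos _) dE. Qed.

(** Both [dot P P] and [E0 - E1] are sums over the [a i], weighted by the increments and by the
    means of the frequencies. For exact resonances both are multiples of the single number given by
    the sum of [a i * M i], with factors [w1 - w0] and [(w0 + w1) / 2], so the combination cancels
    term by term. Off the resonances [a i] itself is small. *)
Lemma steep_two : Rabs ((w0 + w1) / 2 * dot P P + (E1 - E0) * (w1 - w0)) <= G ^ 6 * del.
Proof.
have d0 := del_ge0; have half x C : Rabs x <= C -> Rabs (x / 2) <= C / 2.
  by move=> h; rewrite Rabs_div; [rewrite (Rabs_pos_eq 2); lra | lra].
have wbar : Rabs ((w0 + w1) / 2) <= G.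
  by have := half _ _ (add_bound w0G w1G); lra.
have dw : Rabs (w1 - w0) <= 2 * G by have := sub_bound w1G w0G; lra.
have ubar i : Rabs ((freq I0 i + freq I1 i) / 2) <= G ^ 3.
  by have := half _ _ (add_bound (uG0 i) (uG1 i)); lra.
have du i : Rabs (freq I1 i - freq I0 i) <= 2 * G ^ 3 by have := sub_bound (uG1 i) (uG0 i); lra.
pose br i := (w0 + w1) / 2 * (freq I1 i - freq I0 i) - (freq I0 i + freq I1 i) / 2 * (w1 - w0).
have -> : (w0 + w1) / 2 * dot P P + (E1 - E0) * (w1 - w0) = rsum (fun i => a i * br i) +
    (E1 - E0 + rsum (fun i => a i * ((freq I0 i + freq I1 i) / 2))) * (w1 - w0).
  rewrite (dot_combination P dI).
  have -> : rsum (fun i => a i * br i) = (w0 + w1) / 2 * rsum (fun i => a i * dot (nn i) P) -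
      (w1 - w0) * rsum (fun i => a i * ((freq I0 i + freq I1 i) / 2)).
    rewrite -!rsum_scal -rsum_sub; apply: rsum_ext => i; rewrite /br freq_sub -/P; ring.
  by ring.
have term i : Rabs (a i * br i) <= 4 * G ^ 4 * del.
  have G4 := pow_G_gt0 G10 4; have G3 := pow_G_le G10 (m := 3) (n := 4) ltac:(lia).
  case: (boolP (i \in S)) => iS.
    have -> : br i = (w0 + w1) / 2 * ((freq I1 i - M i * w1) - (freq I0 i - M i * w0)) -
        ((freq I0 i - M i * w0) + (freq I1 i - M i * w1)) / 2 * (w1 - w0) by rewrite /br; field.
    apply: Rle_trans (mul_bound (aG i) (sub_bound (mul_bound wbar (sub_bound (res1 iS) (res0 iS)))
      (mul_bound (half _ _ (add_bound (res0 iS) (res1 iS))) dw))) _.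
    have -> : G ^ 2 * (G * (del + del) + (del + del) / 2 * (2 * G)) = 4 * G ^ 3 * del by field.
    by apply: Rmult_le_compat_r => //; lra.
  apply: Rle_trans (mul_bound (nonres iS) (sub_bound (mul_bound wbar (du i)) (mul_bound (ubar i) dw))) _.
  by right; ring.
apply: Rle_trans (add_bound (rsum_bound term) (mul_bound dE dw)) _.
have h : INR #|T| * (4 * G ^ 4 * del) <= G * (4 * G ^ 4 * del).
  apply: Rmult_le_compat_r => //; have := pow_G_gt0 G10 4; nra.
apply: Rle_trans (Rplus_le_compat_r _ _ _ h) _.
have -> : G * (4 * G ^ 4 * del) + del * (2 * G) = (4 * G ^ 5 + 2 * G) * del by ring.
apply: Rmult_le_compat_r => //.
have := pow_G_10 G10 5; have := pow_G_le G10 (m := 1) (n := 5) ltac:(lia); rewrite pow_1; lra.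
Qed.

End TwoTimes.

Section ThreeTimes.
Variables (I0 I1 I2 : 'I_d -> R) (E0 E1 E2 w0 w1 w2 : R) (a a' M : T -> R) (del : R).
Hypothesis dI : forall j, I1 j - I0 j = rsum (fun i => nn i j * a i).
Hypothesis dI' : forall j, I2 j - I1 j = rsum (fun i => nn i j * a' i).
Hypothesis dE : Rabs (E1 - E0 + rsum (fun i => a i * ((freq I0 i + freq I1 i) / 2))) <= del.
Hypothesis dE' : Rabs (E2 - E1 + rsum (fun i => a' i * ((freq I1 i + freq I2 i) / 2))) <= del.
Hypothesis w0G : 0 < w0 <= G.
Hypothesis w1G : 0 < w1 <= G.
Hypothesis w2G : 0 < w2 <= G.
Hypothesis aG : forall i, Rabs (a i) <= G ^ 2.
Hypothesis aG' : forall i, Rabs (a' i) <= G ^ 2.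
Hypothesis uG0 : forall i, Rabs (freq I0 i) <= G ^ 3.
Hypothesis uG1 : forall i, Rabs (freq I1 i) <= G ^ 3.
Hypothesis uG2 : forall i, Rabs (freq I2 i) <= G ^ 3.
Hypothesis res0 : forall i, i \in S -> Rabs (freq I0 i - M i * w0) <= del.
Hypothesis res1 : forall i, i \in S -> Rabs (freq I1 i - M i * w1) <= del.
Hypothesis res2 : forall i, i \in S -> Rabs (freq I2 i - M i * w2) <= del.
Hypothesis nonres : forall i, i \notin S -> Rabs (a i) <= del.
Hypothesis nonres' : forall i, i \notin S -> Rabs (a' i) <= del.

Let P j := I1 j - I0 j.
Let Q j := I2 j - I1 j.
Let x := w1 - w0.
Let y := w2 - w1.

Let d0 : 0 <= del.
Proof. exact: Rle_trans (Rabs_pos _) dE. Qed.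

Let xG : Rabs x <= G.
Proof. by apply/Rabs_le_between; rewrite /x; lra. Qed.

Let yG : Rabs y <= G.
Proof. by apply/Rabs_le_between; rewrite /y; lra. Qed.

(* On a resonance the velocities dI / dw along the drift are constant. *)
Lemma steep_parallel : Rabs (x ^ 2 * dot Q Q - y ^ 2 * dot P P) <= G ^ 8 * del.
Proof.
pose V j := x * Q j - y * P j; pose W j := x * Q j + y * P j.
have -> : x ^ 2 * dot Q Q - y ^ 2 * dot P P = dot W V.
  rewrite /dot -!rsum_scal -rsum_sub; apply: rsum_ext => j; rewrite /W /V; ring.
rewrite (@dot_combination (fun i => x * a' i + y * a i)); last first.
  move=> j; rewrite /W /P /Q dI dI' -!rsum_scal -rsum_add; apply: rsum_ext => i; ring.
have nV i : dot (nn i) V = x * (freq I2 i - freq I1 i) - y * (freq I1 i - freq I0 i).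
  rewrite !freq_sub /dot -!rsum_scal -rsum_sub; apply: rsum_ext => j; rewrite /V /P /Q; ring.
have term i : Rabs ((x * a' i + y * a i) * dot (nn i) V) <= G ^ 6 * del.
  have G5 := pow_G_10 G10 5; have G6 := pow_G_gt0 G10 5.
  rewrite nV; case: (boolP (i \in S)) => iS.
    have -> : x * (freq I2 i - freq I1 i) - y * (freq I1 i - freq I0 i) =
       x * ((freq I2 i - M i * w2) - (freq I1 i - M i * w1)) -
       y * ((freq I1 i - M i * w1) - (freq I0 i - M i * w0)) by rewrite /x /y; ring.
    apply: Rle_trans (mul_bound (add_bound (mul_bound xG (aG' i)) (mul_bound yG (aG i)))
      (sub_bound (mul_bound xG (sub_bound (res2 iS) (res1 iS)))
                 (mul_bound yG (sub_bound (res1 iS) (res0 iS))))) _.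
    have -> : (G * G ^ 2 + G * G ^ 2) * (G * (del + del) + G * (del + del)) = 8 * G ^ 4 * del by ring.
    apply: Rmult_le_compat_r => //.
    by have := pow_G_10 G10 4; have := pow_G_gt0 G10 4; lra.
  apply: Rle_trans (mul_bound (add_bound (mul_bound xG (nonres' iS)) (mul_bound yG (nonres iS)))
      (sub_bound (mul_bound xG (sub_bound (uG2 i) (uG1 i)))
                 (mul_bound yG (sub_bound (uG1 i) (uG0 i))))) _.
  have -> : (G * del + G * del) * (G * (G ^ 3 + G ^ 3) + G * (G ^ 3 + G ^ 3)) = 8 * G ^ 5 * del by ring.
  by apply: Rmult_le_compat_r => //; lra.
apply: Rle_trans (rsum_bound term) _.
apply: Rle_trans (_ : G * (G ^ 6 * del) <= _).
  by apply: Rmult_le_compat_r => //; have := pow_G_gt0 G10 6; nra.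
have -> : G * (G ^ 6 * del) = G ^ 7 * del by ring.
by apply: Rmult_le_compat_r => //; apply: pow_G_le => //; lia.
Qed.

(** Eliminating [dot P P] and [dot Q Q] between the two instances of [steep_two] and
    [steep_parallel] compares the increments of [w ^ 2] over two equal increments of the energy:
    unless the energy or [w] stands still, they must nearly agree. *)
Lemma steep_three : E1 - E0 = E2 - E1 ->
  Rabs ((E1 - E0) * x * y * ((2 * w1 ^ 2 - w0 ^ 2 - w2 ^ 2) / 2)) <= G ^ 11 * del.
Proof.
move=> mid; have G8 := pow_G_gt0 G10 8.
have ab u : 0 < u <= G -> Rabs u <= G by move=> ?; apply/Rabs_le_between; lra.
have s1 := steep_two dI dE (ab _ w0G) (ab _ w1G) aG uG0 uG1 res0 res1 nonres.
have s2 := steep_two dI' dE' (ab _ w1G) (ab _ w2G) aG' uG1 uG2 res1 res2 nonres'.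
rewrite -/P -/x in s1; rewrite -/Q -/y -mid in s2.
have s3 := steep_parallel.
set r1 := _ + _ in s1; set r2 := _ + _ in s2; set r3 := _ - _ in s3.
set w01 := (w0 + w1) / 2 in r1 s1; set w12 := (w1 + w2) / 2 in r2 s2.
have -> : (E1 - E0) * x * y * ((2 * w1 ^ 2 - w0 ^ 2 - w2 ^ 2) / 2) =
   w01 * x ^ 2 * r2 - w12 * y ^ 2 * r1 - w01 * w12 * r3.
  by rewrite /r1 /r2 /r3 /w01 /w12 /x /y; field.
have w01G : Rabs w01 <= G by apply/Rabs_le_between; rewrite /w01; lra.
have w12G : Rabs w12 <= G by apply/Rabs_le_between; rewrite /w12; lra.
have sq u : Rabs u <= G -> Rabs (u ^ 2) <= G ^ 2.
  by move=> h; rewrite -RPow_abs; apply: pow_incr; split=> //; exact: Rabs_pos.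
apply: Rle_trans (sub_bound (sub_bound (mul_bound (mul_bound w01G (sq _ xG)) s2)
   (mul_bound (mul_bound w12G (sq _ yG)) s1)) (mul_bound (mul_bound w01G w12G) s3)) _.
have -> : G * G ^ 2 * (G ^ 6 * del) + G * G ^ 2 * (G ^ 6 * del) + G * G * (G ^ 8 * del) =
  (2 * G ^ 9 + G ^ 10) * del by ring.
apply: Rmult_le_compat_r => //.
have := pow_G_10 G10 10; have := pow_G_10 G10 9; have := pow_G_gt0 G10 9; lra.
Qed.

End ThreeTimes.
End Steepness.

(** * Orbits of the perturbed pendulum coupled to rotators *)

Definition energy (p q : R) := p ^ 2 / 2 + cos q - 1.

Definition frequency (d : nat) (T : finType) (nn : T -> 'I_d -> R) (ll : T -> R)
  (I : 'I_d -> R) (i : T) := dot (nn i) I + ll i.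

(* What is used of an orbit on a time interval: [c i] is the harmonic of
   -df/dphi and -df/dt of frequency [frequency i], [acc i] a primitive of it. *)
Record orbit (d : nat) (T : finType) (nn : T -> 'I_d -> R) (ll : T -> R) (K mu a b : R)
  (I : R -> 'I_d -> R) (p q : R -> R) (th c acc : T -> R -> R) (f : R -> R)
  (F1 F2 : T -> R -> R -> R -> R) : Prop := {
  o_K : 2 <= K;
  o_mu : 0 <= mu;
  o_d : INR d <= K;
  o_T : INR #|T| <= K;
  o_nn : forall i j, Rabs (nn i j) <= K;
  o_ll : forall i, Rabs (ll i) <= K;
  o_Ib : forall t j, a <= t <= b -> Rabs (I t j) <= K;
  o_Eb : forall t, a <= t <= b -> 4 + 2 * energy (p t) (q t) <= K ^ 2;
  o_fb : forall t, a <= t <= b -> Rabs (f t) <= K;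
  o_F1b : forall i t y x, a <= t <= b -> Rabs y <= K -> Rabs (F1 i t y x) <= K;
  o_F2b : forall i t y x, a <= t <= b -> Rabs y <= K -> Rabs (F2 i t y x) <= K;
  o_F1l : forall i t t' y y' x x', a <= t <= b -> a <= t' <= b -> Rabs y <= K -> Rabs y' <= K ->
    Rabs (F1 i t y x - F1 i t' y' x') <= K * (mu * Rabs (t - t') + Rabs (y - y') +
      Rabs (cos (x / 2) - cos (x' / 2)) + Rabs (sin (x / 2) - sin (x' / 2)));
  o_F2l : forall i t t' y y' x x', a <= t <= b -> a <= t' <= b -> Rabs y <= K -> Rabs y' <= K ->
    Rabs (F2 i t y x - F2 i t' y' x') <= K * (mu * Rabs (t - t') + Rabs (y - y') +
      Rabs (cos (x / 2) - cos (x' / 2)) + Rabs (sin (x / 2) - sin (x' / 2)));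
  o_F1s : forall i t y x, a <= t <= b -> Rabs y <= K ->
    Rabs (F1 i t y x - F1 i t y 0) <= K * Rabs (sin (x / 2));
  o_F2s : forall i t y x, a <= t <= b -> Rabs y <= K ->
    Rabs (F2 i t y x - F2 i t y 0) <= K * Rabs (sin (x / 2));
  o_c : forall i t, a <= t <= b ->
    c i t = F1 i t (p t) (q t) * sin (th i t) + F2 i t (p t) (q t) * cos (th i t);
  o_acc : forall i t, a <= t <= b -> is_derive (acc i) t (mu * c i t);
  o_I : forall t j, a <= t <= b ->
    is_derive (fun s => I s j) t (mu * rsum (fun i => nn i j * c i t));
  o_th : forall i t, a <= t <= b -> exists v, is_derive (th i) t v /\
    Rabs (v - frequency nn ll (I t) i) <= K * mu;
  o_q : forall t, a <= t <= b -> exists v, is_derive q t v /\ Rabs (v - p t) <= K * mu;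
  o_p : forall t, a <= t <= b -> exists v, is_derive p t v /\ Rabs (v - sin (q t)) <= K * mu;
  o_E : forall t, a <= t <= b -> exists v,
    is_derive (fun s => energy (p s) (q s) + mu * f s + dot (I s) (I s) / 2) t v /\
    Rabs (v + mu * rsum (fun i => ll i * c i t)) <= K * mu ^ 2
}.

Lemma orbit_sub d T nn ll K mu a b I p q th c acc f F1 F2 a' b' :
  @orbit d T nn ll K mu a b I p q th c acc f F1 F2 -> a <= a' -> b' <= b ->
  @orbit d T nn ll K mu a' b' I p q th c acc f F1 F2.
Proof.
move=> O aa bb; have w t : a' <= t <= b' -> a <= t <= b by lra.
case: O => *; split => // *; eauto.
Qed.

Lemma energy_ge p q : -2 <= energy p q.
Proof. by rewrite /energy; have := COS_bound q; have := pow2_ge_0 p; lra. Qed.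

Lemma sin_double q : sin q = 2 * sin (q / 2) * cos (q / 2).
Proof. by rewrite -sin_2a; congr sin; field. Qed.

Lemma cos_double q : cos q = 1 - 2 * sin (q / 2) ^ 2.
Proof.
have h : cos q = cos (2 * (q / 2)) by congr cos; field.
by rewrite h cos_2a_sin; ring.
Qed.

Lemma half_angle Y Z : Y ^ 2 + Z ^ 2 = 1 -> exists q, cos (q / 2) = Y /\ sin (q / 2) = Z.
Proof.
move=> h; have [x] := polar Z Y.
have -> : Z ^ 2 + Y ^ 2 = 1 by lra.
rewrite sqrt_1 /rotA /rotY => -[-> ->]; exists (2 * x).
have -> : 2 * x / 2 = x by field.
by split; ring.
Qed.

(** Recovers [q] modulo 4 PI from its half angle, in order to express observables of [(p, q)] in the
    rotating coordinates; by [observable_eq] their values do not depend on the choice. *)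
Definition angle_of (Y Z : R) := epsilon (inhabits 0) (fun q => cos (q / 2) = Y /\ sin (q / 2) = Z).

Lemma angle_ofP Y Z : Y ^ 2 + Z ^ 2 = 1 ->
  cos (angle_of Y Z / 2) = Y /\ sin (angle_of Y Z / 2) = Z.
Proof. by move=> h; exact: (epsilon_spec (inhabits 0) _ (half_angle h)). Qed.

Lemma sqrt_lip (G x y : R) : 10 <= G -> / G <= x -> / G <= y ->
  Rabs (sqrt x - sqrt y) <= G * Rabs (x - y).
Proof.
move=> G10 hx hy; have gi : 0 < / G by apply: Rinv_0_lt_compat; lra.
have sx := sqrt_ge_invG G10 hx; have sy := sqrt_ge_invG G10 hy.
have -> : x - y = (sqrt x - sqrt y) * (sqrt x + sqrt y).
  by have := sqrt_sqrt x; have := sqrt_sqrt y; nra.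
rewrite Rabs_mult (Rabs_pos_eq (sqrt x + _)); last lra.
have p0 := Rabs_pos (sqrt x - sqrt y).
have -> : G * (Rabs (sqrt x - sqrt y) * (sqrt x + sqrt y)) =
  Rabs (sqrt x - sqrt y) * (G * (sqrt x + sqrt y)) by ring.
rewrite -{1}(Rmult_1_r (Rabs _)); apply: Rmult_le_compat_l => //.
have := Rinv_r G ltac:(lra); nra.
Qed.

(** * Balances of the actions and of the energy between two times *)

Section FarOrbit.
Variables (d : nat) (T : finType) (nn : T -> 'I_d -> R) (ll : T -> R) (K mu a b G : R).
Variables (I : R -> 'I_d -> R) (p q : R -> R) (th c acc : T -> R -> R) (f : R -> R).
Variables (F1 F2 : T -> R -> R -> R -> R).
Hypothesis O : orbit nn ll K mu a b I p q th c acc f F1 F2.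
Hypothesis KG : 10 * K <= G.

Let G10 : 10 <= G.
Proof. have := o_K O; lra. Qed.

Let E t := energy (p t) (q t).
Let u i t := frequency nn ll (I t) i.

Lemma p_bound t : a <= t <= b -> Rabs (p t) <= K.
Proof.
move=> ht; apply: abs_le_sqr; first by have := o_K O; lra.
by have := o_Eb O ht; rewrite /energy; have := COS_bound (q t); lra.
Qed.

Lemma c_bound i t : a <= t <= b -> Rabs (c i t) <= 2 * K.
Proof.
move=> ht; rewrite (o_c O) //; have pb := p_bound ht.
have -> : 2 * K = K * 1 + K * 1 by ring.
by apply: add_bound; apply: mul_bound;
  [exact: (o_F1b O) | exact: abs_sin_le | exact: (o_F2b O) | exact: abs_cos_le].
Qed.

Lemma dI_acc s t j : a <= s <= b -> a <= t <= b ->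
  I t j - I s j = rsum (fun i => nn i j * (acc i t - acc i s)).
Proof.
have key x y : a <= x -> x <= y -> y <= b ->
    I y j - I x j = rsum (fun i => nn i j * (acc i y - acc i x)).
  move=> ax xy yb.
  have : Rabs ((I y j - rsum (fun i => nn i j * acc i y)) -
               (I x j - rsum (fun i => nn i j * acc i x))) <= 0 * (y - x).
    apply: (@derive_bound (fun r => I r j - rsum (fun i => nn i j * acc i r)) (fun=> 0)) => //;
      last by move=> r _; rewrite Rabs_R0; lra.
    move=> r hr; have hr' : a <= r <= b by lra.
    have e0 : 0 = minus (mu * rsum (fun i => nn i j * c i r)) (rsum (fun i => nn i j * (mu * c i r))).
      rewrite -rsum_scal (@rsum_ext _ (fun i => mu * (nn i j * c i r)) (fun i => nn i j * (mu * c i r))).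
        by rewrite /minus /plus /opp /=; ring.
      by move=> i; ring.
    rewrite {1}e0; apply: (is_derive_minus (fun r => I r j)); first exact: (o_I O).
    apply: (is_derive_rsum (F := fun i r => nn i j * acc i r)) => i.
    exact: is_derive_scal (o_acc O i hr').
  rewrite Rmult_0_l => h.
  have e0 : (I y j - rsum (fun i => nn i j * acc i y)) - (I x j - rsum (fun i => nn i j * acc i x)) = 0.
    by apply: NNPP => n0; have := Rabs_pos_lt _ n0; lra.
  rewrite (@rsum_ext _ (fun i => nn i j * (acc i y - acc i x)) (fun i => nn i j * acc i y - nn i j * acc i x)).
    by rewrite rsum_sub; lra.
  by move=> i; ring.
move=> [as_ sb] [at_ tb]; case: (Rle_lt_dec s t) => st; first exact: key.
have := key t s at_ ltac:(lra) sb.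
rewrite (@rsum_ext _ (fun i => nn i j * (acc i t - acc i s)) (fun i => -1 * (nn i j * (acc i s - acc i t)))).
  by rewrite rsum_scal; lra.
by move=> i; ring.
Qed.

Lemma acc_bound i s t : a <= s -> s <= t -> t <= b ->
  Rabs (acc i t - acc i s) <= mu * (2 * K) * (t - s).
Proof.
move=> as_ st tb; apply: (@derive_bound _ (fun r => mu * c i r)) => // r hr.
  by apply: (o_acc O); lra.
apply: mul_bound; first by rewrite Rabs_pos_eq; [lra | exact: (o_mu O)].
by apply: c_bound; lra.
Qed.

(** The total energy corrected by the [ll i * acc i] has derivative O(mu^2). The increment of |I|^2
    / 2 is the scalar product of the increment of I with the mean of its end values, without
    remainder; together with the [ll i] this produces the mean frequencies. The term [mu * (2 * K)]
    comes from [mu * f]. *)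
Lemma dE_acc s t : a <= s -> s <= t -> t <= b ->
  Rabs (E t - E s + rsum (fun i => (acc i t - acc i s) * ((u i s + u i t) / 2))) <=
    mu * (2 * K) + K * mu ^ 2 * (t - s).
Proof.
move=> as_ st tb.
pose H r := E r + mu * f r + dot (I r) (I r) / 2 + rsum (fun i => ll i * acc i r).
have h : Rabs (H t - H s) <= K * mu ^ 2 * (t - s).
  pose dH r := epsilon (inhabits 0) (fun v => is_derive (fun s => energy (p s) (q s) + mu * f s + dot (I s) (I s) / 2) r v /\
    Rabs (v + mu * rsum (fun i => ll i * c i r)) <= K * mu ^ 2).
  apply: (@derive_bound _ (fun r => dH r + rsum (fun i => ll i * (mu * c i r)))) => // r hr;
    have hr' : a <= r <= b by [lra]; have [h1 h2] := epsilon_spec (inhabits 0) _ (o_E O hr').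
    apply: (is_derive_plus _ _ _ _ _ h1).
    apply: (is_derive_rsum (F := fun i r => ll i * acc i r)) => i.
    exact: is_derive_scal (o_acc O i hr').
  have <- : mu * rsum (fun i => ll i * c i r) = rsum (fun i => ll i * (mu * c i r)).
    by rewrite -rsum_scal; apply: rsum_ext => i; ring.
  exact: h2.
have hs : a <= s <= b by lra.
have ht : a <= t <= b by lra.
have mu_ge0 := o_mu O; have K2 := o_K O.
have muR : Rabs mu <= mu by rewrite Rabs_pos_eq; lra.
have hf := mul_bound muR (sub_bound (o_fb O ht) (o_fb O hs)).
have sq : dot (I t) (I t) / 2 - dot (I s) (I s) / 2 =
    rsum (fun i => (acc i t - acc i s) * (dot (nn i) (fun j => (I s j + I t j) / 2))).
  rewrite -(@dot_combination _ _ nn _ (fun j => I t j - I s j)); last by move=> j; exact: dI_acc.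
  rewrite /dot -(Rmult_1_l (rsum _ / 2)).
  have -> : 1 * (rsum (fun j => I t j * I t j) / 2) - rsum (fun j => I s j * I s j) / 2 =
     / 2 * (rsum (fun j => I t j * I t j) - rsum (fun j => I s j * I s j)) by field.
  rewrite -rsum_sub -rsum_scal; apply: rsum_ext => j; field.
have ub : rsum (fun i => (acc i t - acc i s) * ((u i s + u i t) / 2)) =
    rsum (fun i => (acc i t - acc i s) * (dot (nn i) (fun j => (I s j + I t j) / 2))) +
    (rsum (fun i => ll i * acc i t) - rsum (fun i => ll i * acc i s)).
  rewrite -rsum_sub -rsum_add; apply: rsum_ext => i; rewrite /u /frequency.
  have -> : dot (nn i) (fun j => (I s j + I t j) / 2) = (dot (nn i) (I s) + dot (nn i) (I t)) / 2.
    have -> : (dot (nn i) (I s) + dot (nn i) (I t)) / 2 = / 2 * (dot (nn i) (I s) + dot (nn i) (I t)) by field.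
    rewrite /dot -rsum_add -rsum_scal; apply: rsum_ext => j; field.
  by field.
have -> : E t - E s + rsum (fun i => (acc i t - acc i s) * ((u i s + u i t) / 2)) =
   (H t - H s) - mu * (f t - f s) by rewrite ub -sq /H; ring.
by have := sub_bound h hf; lra.
Qed.

End FarOrbit.

Lemma is_derive_half (h : R -> R) (t l : R) : is_derive h t l -> is_derive (fun r => h r / 2) t (l / 2).
Proof.
by move=> h1; auto_derive; [exists l | rewrite (is_derive_unique _ _ _ h1) /Rdiv; ring].
Qed.

Lemma is_derive_cos_half (k : R) (h : R -> R) (t l : R) : is_derive h t l ->
  is_derive (fun r => k * cos (h r / 2)) t (- (k * sin (h t / 2) * l / 2)).
Proof.
by move=> h1; auto_derive; [exists l | rewrite (is_derive_unique _ _ _ h1) /Rdiv; ring].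
Qed.

Lemma is_derive_sin_half (h : R -> R) (t l : R) : is_derive h t l ->
  is_derive (fun r => sin (h r / 2)) t (cos (h t / 2) * l / 2).
Proof.
by move=> h1; auto_derive; [exists l | rewrite (is_derive_unique _ _ _ h1) /Rdiv; ring].
Qed.

Lemma choose_derivative (h : R -> R) (P : R -> R -> Prop) (a b : R) :
  (forall t, a <= t <= b -> exists v, is_derive h t v /\ P t v) ->
  exists dh, forall t, a <= t <= b -> is_derive h t (dh t) /\ P t (dh t).
Proof.
move=> ex; exists (fun t => epsilon (inhabits 0) (fun v => is_derive h t v /\ P t v)) => t ht.
exact: (epsilon_spec (inhabits 0) _ (ex t ht)).
Qed.

(** * Non-resonant drift away from the separatrix, in the two charts *)

Section FarDrift.
Variables (d : nat) (T : finType) (nn : T -> 'I_d -> R) (ll : T -> R) (K mu a b G : R).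
Variables (I : R -> 'I_d -> R) (p q : R -> R) (th c acc : T -> R -> R) (f : R -> R).
Variables (F1 F2 : T -> R -> R -> R -> R).
Hypothesis O : orbit nn ll K mu a b I p q th c acc f F1 F2.
Hypothesis KG : 10 * K ^ 6 <= G.
Hypothesis ab : a <= b.

Let E t := energy (p t) (q t).
Let u i t := frequency nn ll (I t) i.

Let K2 : 2 <= K.
Proof. exact: o_K O. Qed.

Let mu0 : 0 <= mu.
Proof. exact: o_mu O. Qed.

Lemma pow_K_le m : (m <= 6)%coq_nat -> K ^ m <= K ^ 6.
Proof. by move=> h; apply: Rle_pow => //; lra. Qed.

Lemma KG1 : 10 * K <= G.
Proof. by have := @pow_K_le 1 ltac:(lia); rewrite pow_1; lra. Qed.

Let G10 : 10 <= G.
Proof. have := KG1; lra. Qed.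

Lemma abs_frequency_le i t : a <= t <= b -> Rabs (u i t) <= K ^ 3 + K.
Proof.
move=> ht; rewrite /u /frequency /dot; apply: add_bound; last exact: (o_ll O).
apply: Rle_trans (rsum_bound (C := K * K) _) _.
  by move=> j; apply: mul_bound; [exact: (o_nn O) | exact: (o_Ib O)].
rewrite card_ord; have -> : K ^ 3 = K * (K * K) by ring.
by apply: Rmult_le_compat_r; [nra | exact: o_d O].
Qed.

Lemma abs_frequency_le_G i t : a <= t <= b -> Rabs (u i t) <= G.
Proof.
move=> ht; apply: Rle_trans (abs_frequency_le i ht) _.
have := @pow_K_le 3 ltac:(lia); have := @pow_K_le 1 ltac:(lia); rewrite pow_1.
by have := pow_lt K 6 ltac:(lra); lra.
Qed.

Lemma is_derive_energy t : a <= t <= b -> exists v, is_derive E t v /\ Rabs v <= G * mu.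
Proof.
move=> ht; have [vq [hq bq]] := o_q O ht; have [vp [hp bp]] := o_p O ht.
exists (p t * vp - sin (q t) * vq); split.
  rewrite /E /energy; auto_derive; first by split; [exists vp | split=> //; exists vq].
  by rewrite (is_derive_unique _ _ _ hp) (is_derive_unique _ _ _ hq); field.
have -> : p t * vp - sin (q t) * vq = p t * (vp - sin (q t)) - sin (q t) * (vq - p t) by ring.
apply: Rle_trans (sub_bound (mul_bound (p_bound O ht) bp) (mul_bound (abs_sin_le _) bq)) _.
have -> : K * (K * mu) + 1 * (K * mu) = (K ^ 2 + K) * mu by ring.
apply: Rmult_le_compat_r => //; have := @pow_K_le 2 ltac:(lia); have := @pow_K_le 1 ltac:(lia); rewrite pow_1.
by have := pow_lt K 6 ltac:(lra); lra.
Qed.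

Lemma is_derive_frequency i t : a <= t <= b ->
  exists v, is_derive (u i) t v /\ Rabs v <= G * mu.
Proof.
move=> ht; exists (rsum (fun j => nn i j * (mu * rsum (fun k => nn k j * c k t)))); split.
  have -> : rsum (fun j => nn i j * (mu * rsum (fun k => nn k j * c k t))) =
     plus (rsum (fun j => nn i j * (mu * rsum (fun k => nn k j * c k t)))) 0 by rewrite /plus /=; ring.
  apply: (is_derive_plus (fun s => dot (nn i) (I s)) (fun=> ll i)); last exact: is_derive_const.
  apply: (is_derive_rsum (F := fun j s => nn i j * I s j)) => j.
  exact: is_derive_scal (o_I O j ht).
have in_ j : Rabs (rsum (fun k => nn k j * c k t)) <= 2 * K ^ 3.
  apply: Rle_trans (rsum_bound (C := K * (2 * K)) _) _.
    by move=> k; apply: mul_bound; [exact: (o_nn O) | exact: (c_bound O)].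
  have -> : 2 * K ^ 3 = K * (K * (2 * K)) by ring.
  by apply: Rmult_le_compat_r; [nra | exact: o_T O].
apply: Rle_trans (rsum_bound (C := K * (mu * (2 * K ^ 3))) _) _.
  move=> j; apply: mul_bound; first exact: (o_nn O).
  by apply: mul_bound => //; rewrite Rabs_pos_eq; lra.
rewrite card_ord.
apply: Rle_trans (_ : K * (K * (mu * (2 * K ^ 3))) <= _).
  apply: Rmult_le_compat_r; last exact: o_d O.
  by have := pow_lt K 3 ltac:(lra) => ?; apply: Rmult_le_pos; [lra | apply: Rmult_le_pos => //; lra].
have -> : K * (K * (mu * (2 * K ^ 3))) = 2 * K ^ 5 * mu by ring.
apply: Rmult_le_compat_r => //; have := @pow_K_le 5 ltac:(lia).
by have := pow_lt K 6 ltac:(lra); lra.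
Qed.

Lemma observable_eq (F : R -> R -> R -> R) t y x x' : a <= t <= b -> Rabs y <= K ->
  (forall t t' y y' x x', a <= t <= b -> a <= t' <= b -> Rabs y <= K -> Rabs y' <= K ->
    Rabs (F t y x - F t' y' x') <= K * (mu * Rabs (t - t') + Rabs (y - y') +
      Rabs (cos (x / 2) - cos (x' / 2)) + Rabs (sin (x / 2) - sin (x' / 2)))) ->
  cos (x / 2) = cos (x' / 2) -> sin (x / 2) = sin (x' / 2) -> F t y x = F t y x'.
Proof.
move=> ht hy lF hc hs; have := lF t t y y x x' ht ht hy hy.
rewrite hc hs !Rminus_diag Rabs_R0 => h.
by apply: NNPP => n0; have := Rabs_pos_lt (F t y x - F t y x') ltac:(lra); lra.
Qed.

Section Observable.
Variables (Dom : R -> R -> Prop) (pf cf sf : R -> R -> R -> R).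
Hypothesis pf_bound : forall A Y e, Dom (A ^ 2 + Y ^ 2) e -> Rabs (pf A Y e) <= K.
Hypothesis circle : forall A Y e, Dom (A ^ 2 + Y ^ 2) e -> cf A Y e ^ 2 + sf A Y e ^ 2 = 1.

(** The worst case is the momentum of a rotation, [2 * sqrt (e + A ^ 2)]: a square root above [/ G]
    has Lipschitz constant at most [G], and the rest of the factor comes from the 2 and from the
    square of [A]. *)
Definition coordinate_lip (h : R -> R -> R -> R) := forall A Y e A' Y' e',
  Dom (A ^ 2 + Y ^ 2) e -> Dom (A' ^ 2 + Y' ^ 2) e' ->
  Rabs (h A Y e - h A' Y' e') <= 4 * G * (Rabs (A - A') + Rabs (Y - Y') + Rabs (e - e')).

Hypothesis pf_lip : coordinate_lip pf.
Hypothesis cf_lip : coordinate_lip cf.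
Hypothesis sf_lip : coordinate_lip sf.

Definition pulled (F : R -> R -> R -> R) t A Y e :=
  F t (pf A Y e) (angle_of (cf A Y e) (sf A Y e)).

Lemma regular_pulled (F : R -> R -> R -> R) :
  (forall t y x, a <= t <= b -> Rabs y <= K -> Rabs (F t y x) <= K) ->
  (forall t t' y y' x x', a <= t <= b -> a <= t' <= b -> Rabs y <= K -> Rabs y' <= K ->
    Rabs (F t y x - F t' y' x') <= K * (mu * Rabs (t - t') + Rabs (y - y') +
      Rabs (cos (x / 2) - cos (x' / 2)) + Rabs (sin (x / 2) - sin (x' / 2)))) ->
  regular_observable G mu a b Dom (pulled F).
Proof.
move=> bF lF; have KG' := KG1; split.
  move=> t A Y e ht D; apply: Rle_trans (bF _ _ _ ht (pf_bound D)) _; lra.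
move=> t t' A A' Y Y' e e' ht ht' D D'.
apply: Rle_trans (lF _ _ _ _ _ _ ht ht' (pf_bound D) (pf_bound D')) _.
have [-> ->] := angle_ofP (circle D); have [-> ->] := angle_ofP (circle D').
have h1 := pf_lip D D'; have h2 := cf_lip D D'; have h3 := sf_lip D D'.
set X := mu * _; set Z := _ + _ + _ in h1 h2 h3 *.
have X0 : 0 <= X by apply: Rmult_le_pos => //; exact: Rabs_pos.
have Z0 : 0 <= Z by rewrite /Z; have := Rabs_pos (A - A'); have := Rabs_pos (Y - Y'); have := Rabs_pos (e - e'); lra.
apply: Rle_trans (_ : G * (G ^ 3 * (X + Z)) <= _); last first.
  by right; rewrite /X /Z; ring.
have G3 : 12 * G <= G ^ 3 by have := pow_G_10 G10 2; have := pow_G_10 G10 1; rewrite pow_1; lra.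
apply: Rmult_le_compat; [lra | | lra | nra].
by have := Rabs_pos (pf A Y e - pf A' Y' e'); have := Rabs_pos (cf A Y e - cf A' Y' e');
   have := Rabs_pos (sf A Y e - sf A' Y' e'); lra.
Qed.

Variables (A Y e dA dY de : R -> R) (eta : R) (i : T).
Hypothesis eta01 : 0 < eta <= 1.
Hypothesis Dom_e : forall k e, Dom k e -> / G <= e.
Hypothesis Dom_k : forall k e, Dom k e -> k <= 1.
Hypothesis D : forall t, a <= t <= b -> Dom (A t ^ 2 + Y t ^ 2) (e t).
Hypothesis A' : forall t, a <= t <= b -> is_derive A t (dA t) /\
  Rabs (dA t - Y t * sqrt (e t + A t ^ 2)) <= K * mu.
Hypothesis Y' : forall t, a <= t <= b -> is_derive Y t (dY t) /\
  Rabs (dY t + A t * sqrt (e t + A t ^ 2)) <= K * mu.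
Hypothesis e' : forall t, a <= t <= b -> is_derive e t (de t) /\ Rabs (de t) <= G * mu.
Hypothesis p_pulled : forall t, a <= t <= b -> pf (A t) (Y t) (e t) = p t.
Hypothesis cos_pulled : forall t, a <= t <= b -> cf (A t) (Y t) (e t) = cos (q t / 2).
Hypothesis sin_pulled : forall t, a <= t <= b -> sf (A t) (Y t) (e t) = sin (q t / 2).
Hypothesis nonres : forall t, a <= t <= b ->
  eta <= Rabs (sin (u i t * period (A t) (Y t) (e t) / 2)).

Lemma pulled_drift : Rabs (acc i b - acc i a) <=
  mu * (2 * G ^ 4 / eta) + mu ^ 2 * (G ^ 14 / eta ^ 2) * (b - a).
Proof.
have KG' := KG1.
have pulled_at F t : a <= t <= b ->
  (forall t t' y y' x x', a <= t <= b -> a <= t' <= b -> Rabs y <= K -> Rabs y' <= K ->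
    Rabs (F t y x - F t' y' x') <= K * (mu * Rabs (t - t') + Rabs (y - y') +
      Rabs (cos (x / 2) - cos (x' / 2)) + Rabs (sin (x / 2) - sin (x' / 2)))) ->
  pulled F t (A t) (Y t) (e t) = F t (p t) (q t).
  move=> ht lF; rewrite /pulled p_pulled //; have [hc hs] := angle_ofP (circle (D ht)).
  apply: observable_eq => //; first exact: (p_bound O).
    by rewrite hc cos_pulled.
  by rewrite hs sin_pulled.
have [dth hth] := choose_derivative (fun t ht => o_th O i ht).
have [du hu] := choose_derivative (is_derive_frequency i).
have KGmu : K * mu <= G * mu by apply: Rmult_le_compat_r => //; lra.
apply: (@nonresonant_drift G mu eta a b Dom (pulled (F1 i)) (pulled (F2 i)) G10 mu0 eta01
  _ _ _ _ A Y e (th i) (u i) (acc i) dA dY de dth du ab) => //.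
- by move=> k x hk; have := Dom_k hk; have := pow_G_ge1 G10 2; lra.
- apply: regular_pulled; [exact: (o_F1b O i) | exact: (o_F1l O i)].
- apply: regular_pulled; [exact: (o_F2b O i) | exact: (o_F2l O i)].
- exact: abs_frequency_le_G.
- by move=> t ht; have [h1 h2] := A' ht; split=> //; exact: Rle_trans h2 KGmu.
- by move=> t ht; have [h1 h2] := Y' ht; split=> //; exact: Rle_trans h2 KGmu.
- by move=> t ht; have [h1 h2] := hth t ht; split=> //; exact: Rle_trans h2 KGmu.
- move=> t ht; rewrite !pulled_at //; [|exact: (o_F2l O i)|exact: (o_F1l O i)].
  by rewrite -(o_c O) //; exact: (o_acc O i ht).
Qed.

End Observable.

Variables (eta : R) (i : T).
Hypothesis eta01 : 0 < eta <= 1.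

Let drift := mu * (2 * G ^ 4 / eta) + mu ^ 2 * (G ^ 14 / eta ^ 2) * (b - a).

(** Chart [A = p / 2], [Y = s cos (q / 2)], [B = s sin (q / 2)], where the sign [s] makes the
    rotation speed [B] positive. Here [A ^ 2 + Y ^ 2 = 1 - e] with [e = - E / 2], which is the
    domain and turns the period into [per 1]. *)
Lemma libration_drift s : s ^ 2 = 1 ->
  (forall t, a <= t <= b -> 0 < s * sin (q t / 2)) ->
  (forall t, a <= t <= b -> / G <= - E t / 2) ->
  (forall t, a <= t <= b -> eta <= Rabs (sin (u i t * per 1 (- E t / 2) / 2))) ->
  Rabs (acc i b - acc i a) <= drift.
Proof.
move=> s2 sgn far nonres; have KG' := KG1.
have as1 : Rabs s <= 1 by apply: abs_le_sqr; lra.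
have ss : s * s = 1 by rewrite -s2; ring.
pose Dom k e := k + e = 1 /\ / G <= e.
have gi : 0 < / G by apply: Rinv_0_lt_compat; lra.
have DA A Y e : Dom (A ^ 2 + Y ^ 2) e -> / G <= e + A ^ 2 /\ e + A ^ 2 <= 1 /\ Rabs A <= 1.
  move=> [h1 h2]; have := pow2_ge_0 A; have := pow2_ge_0 Y => *.
  by split; [lra | split; [lra | apply: abs_le_sqr; lra]].
have B2 t : - E t / 2 + (p t / 2) ^ 2 = (s * sin (q t / 2)) ^ 2.
  by rewrite Rpow_mult_distr s2 /E /energy cos_double; field.
have B t : a <= t <= b -> sqrt (- E t / 2 + (p t / 2) ^ 2) = s * sin (q t / 2).
  move=> ht; rewrite B2; have -> : (s * sin (q t / 2)) ^ 2 = Rsqr (s * sin (q t / 2)) by rewrite /Rsqr; ring.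
  by rewrite sqrt_Rsqr //; have := sgn t ht; lra.
have Dt t : a <= t <= b -> Dom ((p t / 2) ^ 2 + (s * cos (q t / 2)) ^ 2) (- E t / 2).
  move=> ht; split; last exact: far.
  rewrite Rplus_comm -Rplus_assoc B2 !Rpow_mult_distr s2.
  by have := sin2_cos2 (q t / 2); rewrite /Rsqr; lra.
pose pf A (Y e : R) := 2 * A.
pose cf (A Y e : R) := s * Y.
pose sf A (Y e : R) := s * sqrt (e + A ^ 2).
have pf_bound A Y e : Dom (A ^ 2 + Y ^ 2) e -> Rabs (pf A Y e) <= K.
  by move=> /DA[_ [_ h]]; rewrite /pf Rabs_mult (Rabs_pos_eq 2); lra.
have circle A Y e : Dom (A ^ 2 + Y ^ 2) e -> cf A Y e ^ 2 + sf A Y e ^ 2 = 1.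
  move=> D; have [h1 _] := DA _ _ _ D; case: D => [D1 _].
  by rewrite /cf /sf !Rpow_mult_distr s2 pow2_sqrt; lra.
have lip0 x y z : 0 <= Rabs x /\ 0 <= Rabs y /\ 0 <= Rabs z.
  by split; [|split]; exact: Rabs_pos.
have pf_lip : coordinate_lip Dom pf.
  move=> A Y e A' Y' e' D D'; rewrite /pf -Rmult_minus_distr_l Rabs_mult (Rabs_pos_eq 2); last lra.
  by have := lip0 (A - A') (Y - Y') (e - e'); nra.
have cf_lip : coordinate_lip Dom cf.
  move=> A Y e A' Y' e' D D'; rewrite /cf -Rmult_minus_distr_l.
  have := mul_bound as1 (Rle_refl (Rabs (Y - Y'))).
  by have := lip0 (A - A') (Y - Y') (e - e'); nra.
have sf_lip : coordinate_lip Dom sf.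
  move=> A Y e A' Y' e' D D'; rewrite /sf -Rmult_minus_distr_l.
  have [h1 [_ h2]] := DA _ _ _ D; have [h1' [_ h2']] := DA _ _ _ D'.
  have h := mul_bound as1 (sqrt_lip G10 h1 h1').
  have : Rabs (e + A ^ 2 - (e' + A' ^ 2)) <= Rabs (e - e') + Rabs (A - A') * 2.
    have -> : e + A ^ 2 - (e' + A' ^ 2) = (e - e') + (A - A') * (A + A') by ring.
    apply: add_bound; first lra.
    by apply: mul_bound; [lra | have := add_bound h2 h2'; lra].
  by have := lip0 (A - A') (Y - Y') (e - e'); nra.
have [dq hq] := choose_derivative (fun t ht => o_q O ht).
have [dp hp] := choose_derivative (fun t ht => o_p O ht).
have [dEn hE] := choose_derivative is_derive_energy.
apply: (@pulled_drift Dom pf cf sf pf_bound circle pf_lip cf_lip sf_lip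
  (fun t => p t / 2) (fun t => s * cos (q t / 2)) (fun t => - E t / 2)
  (fun t => dp t / 2) (fun t => - (s * sin (q t / 2) * dq t / 2)) (fun t => - dEn t / 2)) => //.
- by move=> k e [].
- by move=> k e [h1 h2]; lra.
- move=> t ht; have [h1 h2] := hp t ht.
  split; first exact: is_derive_half.
  rewrite B //.
  have -> : dp t / 2 - s * cos (q t / 2) * (s * sin (q t / 2)) = (dp t - sin (q t)) / 2.
    rewrite (sin_double (q t)).
    have -> : s * cos (q t / 2) * (s * sin (q t / 2)) = s ^ 2 * (cos (q t / 2) * sin (q t / 2)) by ring.
    by rewrite s2; field.
  by rewrite Rabs_div ?(Rabs_pos_eq 2); have := Rabs_pos (dp t - sin (q t)); lra.
- move=> t ht; have [h1 h2] := hq t ht.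
  split; first exact: is_derive_cos_half.
  rewrite B //.
  have -> : - (s * sin (q t / 2) * dq t / 2) + p t / 2 * (s * sin (q t / 2)) =
     - (s * sin (q t / 2) * (dq t - p t) / 2) by field.
  rewrite Rabs_Ropp Rabs_div ?(Rabs_pos_eq 2); try lra.
  have := mul_bound (mul_bound as1 (abs_sin_le (q t / 2))) h2.
  by have := Rabs_pos (s * sin (q t / 2) * (dq t - p t)); lra.
- move=> t ht; have [h1 h2] := hE t ht.
  split; first by apply: (@is_derive_half (fun r => - E r)); exact: (is_derive_opp E).
  by rewrite Rabs_div ?Rabs_Ropp ?(Rabs_pos_eq 2); have := Rabs_pos (dEn t); lra.
- by move=> t ht; rewrite /pf; field.
- by move=> t ht; rewrite /cf -Rmult_assoc ss Rmult_1_l.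
- by move=> t ht; rewrite /sf B // -Rmult_assoc ss Rmult_1_l.
- move=> t ht; rewrite period_polar; last by have := far t ht; lra.
  have [h _] := Dt t ht.
  have -> : (p t / 2) ^ 2 + (s * cos (q t / 2)) ^ 2 = 1 - 1 * (- E t / 2) by lra.
  exact: nonres.
Qed.

(** Chart [A = sin (q / 2)], [Y = s cos (q / 2)], [B = s p / 2], where [s] is the sign of [p]. Here
    [A ^ 2 + Y ^ 2 = 1] and [e = E / 2], so the period is [per 0]; the last condition of the domain
    bounds the momentum. *)
Lemma rotation_drift s : s ^ 2 = 1 ->
  (forall t, a <= t <= b -> 0 < s * p t) ->
  (forall t, a <= t <= b -> / G <= E t / 2) ->
  (forall t, a <= t <= b -> eta <= Rabs (sin (u i t * per 0 (E t / 2) / 2))) ->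
  Rabs (acc i b - acc i a) <= drift.
Proof.
move=> s2 sgn far nonres; have KG' := KG1.
have as1 : Rabs s <= 1 by apply: abs_le_sqr; lra.
have ss : s * s = 1 by rewrite -s2; ring.
pose Dom k e := k = 1 /\ / G <= e /\ 4 + 4 * e <= K ^ 2.
have gi : 0 < / G by apply: Rinv_0_lt_compat; lra.
have DA A Y e : Dom (A ^ 2 + Y ^ 2) e -> / G <= e + A ^ 2 /\ 4 * (e + A ^ 2) <= K ^ 2 /\ Rabs A <= 1.
  move=> [h1 [h2 h3]]; have := pow2_ge_0 A; have := pow2_ge_0 Y => *.
  by split; [lra | split; [lra | apply: abs_le_sqr; lra]].
have B2 t : E t / 2 + sin (q t / 2) ^ 2 = (s * (p t / 2)) ^ 2.
  by rewrite Rpow_mult_distr s2 /E /energy cos_double; field.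
have B t : a <= t <= b -> sqrt (E t / 2 + sin (q t / 2) ^ 2) = s * (p t / 2).
  move=> ht; rewrite B2; have -> : (s * (p t / 2)) ^ 2 = Rsqr (s * (p t / 2)) by rewrite /Rsqr; ring.
  by rewrite sqrt_Rsqr //; have := sgn t ht; lra.
have Dt t : a <= t <= b -> Dom (sin (q t / 2) ^ 2 + (s * cos (q t / 2)) ^ 2) (E t / 2).
  move=> ht; split; last by split; [exact: far | have := o_Eb O ht; rewrite -/(E t); lra].
  by rewrite Rpow_mult_distr s2; have := sin2_cos2 (q t / 2); rewrite /Rsqr; lra.
pose pf A (Y e : R) := 2 * s * sqrt (e + A ^ 2).
pose cf (A Y e : R) := s * Y.
pose sf (A Y e : R) := A.
have pf_bound A Y e : Dom (A ^ 2 + Y ^ 2) e -> Rabs (pf A Y e) <= K.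
  move=> D; have [h1 [h2 _]] := DA _ _ _ D; apply: abs_le_sqr; first lra.
  by rewrite /pf !Rpow_mult_distr s2 pow2_sqrt; lra.
have circle A Y e : Dom (A ^ 2 + Y ^ 2) e -> cf A Y e ^ 2 + sf A Y e ^ 2 = 1.
  by case=> D1 _; rewrite /cf /sf Rpow_mult_distr s2; lra.
have lip0 x y z : 0 <= Rabs x /\ 0 <= Rabs y /\ 0 <= Rabs z.
  by split; [|split]; exact: Rabs_pos.
have pf_lip : coordinate_lip Dom pf.
  move=> A Y e A' Y' e' D D'; rewrite /pf -Rmult_minus_distr_l.
  have [h1 [_ h2]] := DA _ _ _ D; have [h1' [_ h2']] := DA _ _ _ D'.
  have s22 : Rabs (2 * s) <= 2 by rewrite Rabs_mult (Rabs_pos_eq 2); lra.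
  have h := mul_bound s22 (sqrt_lip G10 h1 h1').
  have : Rabs (e + A ^ 2 - (e' + A' ^ 2)) <= Rabs (e - e') + Rabs (A - A') * 2.
    have -> : e + A ^ 2 - (e' + A' ^ 2) = (e - e') + (A - A') * (A + A') by ring.
    apply: add_bound; first lra.
    by apply: mul_bound; [lra | have := add_bound h2 h2'; lra].
  by have := lip0 (A - A') (Y - Y') (e - e'); nra.
have cf_lip : coordinate_lip Dom cf.
  move=> A Y e A' Y' e' D D'; rewrite /cf -Rmult_minus_distr_l.
  have := mul_bound as1 (Rle_refl (Rabs (Y - Y'))).
  by have := lip0 (A - A') (Y - Y') (e - e'); nra.
have sf_lip : coordinate_lip Dom sf.
  by move=> A Y e A' Y' e' D D'; rewrite /sf; have := lip0 (A - A') (Y - Y') (e - e'); nra.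
have [dq hq] := choose_derivative (fun t ht => o_q O ht).
have [dEn hE] := choose_derivative is_derive_energy.
apply: (@pulled_drift Dom pf cf sf pf_bound circle pf_lip cf_lip sf_lip
  (fun t => sin (q t / 2)) (fun t => s * cos (q t / 2)) (fun t => E t / 2)
  (fun t => cos (q t / 2) * dq t / 2) (fun t => - (s * sin (q t / 2) * dq t / 2)) (fun t => dEn t / 2)) => //.
- by move=> k e [_ []].
- by move=> k e [h1 h2]; lra.
- move=> t ht; have [h1 h2] := hq t ht.
  split; first exact: is_derive_sin_half.
  rewrite B //.
  have -> : cos (q t / 2) * dq t / 2 - s * cos (q t / 2) * (s * (p t / 2)) = cos (q t / 2) * (dq t - p t) / 2.
    have -> : s * cos (q t / 2) * (s * (p t / 2)) = s ^ 2 * (cos (q t / 2) * (p t / 2)) by ring.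
    by rewrite s2; field.
  rewrite Rabs_div ?(Rabs_pos_eq 2); try lra.
  have := mul_bound (abs_cos_le (q t / 2)) h2.
  by have := Rabs_pos (cos (q t / 2) * (dq t - p t)); lra.
- move=> t ht; have [h1 h2] := hq t ht.
  split; first exact: is_derive_cos_half.
  rewrite B //.
  have -> : - (s * sin (q t / 2) * dq t / 2) + sin (q t / 2) * (s * (p t / 2)) =
     - (s * sin (q t / 2) * (dq t - p t) / 2) by field.
  rewrite Rabs_Ropp Rabs_div ?(Rabs_pos_eq 2); try lra.
  have := mul_bound (mul_bound as1 (abs_sin_le (q t / 2))) h2.
  by have := Rabs_pos (s * sin (q t / 2) * (dq t - p t)); lra.
- move=> t ht; have [h1 h2] := hE t ht.
  split; first exact: is_derive_half.
  by rewrite Rabs_div ?(Rabs_pos_eq 2); have := Rabs_pos (dEn t); lra.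
- move=> t ht; rewrite /pf B //.
  have -> : 2 * s * (s * (p t / 2)) = s ^ 2 * p t by field.
  by rewrite s2 Rmult_1_l.
- by move=> t ht; rewrite /cf -Rmult_assoc ss Rmult_1_l.
- move=> t ht; rewrite period_polar; last by have := far t ht; lra.
  have [-> _] := Dt t ht.
  have := nonres t ht; rewrite /per /well.
  by have -> : 1 - 0 * (E t / 2) = 1 by ring.
Qed.

End FarDrift.

(** * Distance to the multiples of PI *)

Lemma abs_le_3_abs_sin y : Rabs y <= 2 -> Rabs y <= 3 * Rabs (sin y).
Proof.
have P2 := PI2_1.
have key z : 0 <= z <= 2 -> z <= 3 * sin z.
  move=> hz; have [h _] := sin_bound z 0 ltac:(lra) ltac:(lra).
  move: h; rewrite /sin_approx /sin_term /= => h; nra.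
move=> h; case: (Rle_lt_dec 0 y) => y0.
  rewrite Rabs_pos_eq // in h *; have := key y (conj y0 h); have := Rle_abs (sin y); lra.
rewrite Rabs_left // in h *; have := key (- y) ltac:(lra); rewrite sin_neg.
have := Rle_abs (- sin y); rewrite Rabs_Ropp; lra.
Qed.

Lemma sin_sub_mult_PI x (m : Z) : Rabs (sin (x - IZR m * PI)) = Rabs (sin x).
Proof.
have s0 : sin (IZR m * PI) = 0 by apply: sin_eq_0_1; exists m.
have c1 : Rabs (cos (IZR m * PI)) = 1.
  have := sin2_cos2 (IZR m * PI); rewrite s0 /Rsqr => h.
  have [->|->] : cos (IZR m * PI) = 1 \/ cos (IZR m * PI) = -1.
  - have : (cos (IZR m * PI) - 1) * (cos (IZR m * PI) + 1) = 0 by lra.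
    by case/Rmult_integral => ?; [left | right]; lra.
  - exact: Rabs_R1.
  - by rewrite Rabs_left; lra.
by rewrite sin_minus s0 Rmult_0_r Rminus_0_r Rabs_mult c1 Rmult_1_r.
Qed.

Lemma nearest_mult_PI x : exists m : Z, Rabs (x - IZR m * PI) <= 2.
Proof.
have P0 := PI_RGT_0; have P4 := PI_4.
exists (Int_part (x / PI + / 2)); have [h1 h2] := base_Int_part (x / PI + / 2).
set m := IZR _ in h1 h2 *.
have -> : x - m * PI = (x / PI - m) * PI by field; lra.
by rewrite Rabs_mult (Rabs_pos_eq PI); [have : Rabs (x / PI - m) <= / 2 by [apply/Rabs_le_between; lra]; have := Rabs_pos (x / PI - m); nra | lra].
Qed.

Lemma pow5_le x y : 0 <= y -> x ^ 5 <= y ^ 5 -> x <= y.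
Proof.
move=> y0 h; apply: Rnot_lt_le => yx.
have : y ^ 5 < x ^ 5; last lra.
have h4 : y ^ 4 <= x ^ 4 by apply: pow_incr; lra.
have x4 : 0 < x ^ 4 by apply: pow_lt; lra.
rewrite -!(tech_pow_Rmult _ 4); nra.
Qed.

(** Exponents of the chain of radii: [Rad k * G ^ 125 = Rad k.+1 ^ 10]. The power 10 is the price of
    one step of steepness: the energy has to be confined within the square of the radius, and its
    fifth power is what the precision of the resonances controls. *)
Fixpoint rho (k : nat) : nat := if k is k'.+1 then (10 * rho k' + 125)%N else 12.

Lemma rho_step k : (rho k <= rho k.+1)%N.
Proof. by apply: leq_trans (leq_addr _ _); rewrite leq_pmull. Qed.

Lemma rho_ge k : (12 <= rho k)%coq_nat.
Proof. by apply/leP; elim: k => // k IH; exact: leq_trans IH (rho_step k). Qed.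

Lemma rho_mono j k : (j <= k)%N -> (rho j <= rho k)%coq_nat.
Proof.
move=> jk; apply/leP; rewrite -(subnK jk); elim: (k - j)%N => [|m IH]; first by rewrite add0n.
by rewrite addSn; exact: leq_trans IH (rho_step _).
Qed.

(** * Confinement away from the separatrix *)

Section FarConfinement.
Variables (d : nat) (T : finType) (nn : T -> 'I_d -> R) (ll : T -> R) (K mu a b G : R).
Variables (I : R -> 'I_d -> R) (p q : R -> R) (th c acc : T -> R -> R) (f : R -> R).
Variables (F1 F2 : T -> R -> R -> R -> R) (ch sg : R).
Hypothesis O : orbit nn ll K mu a b I p q th c acc f F1 F2.
Hypothesis KG : 10 * K ^ 6 <= G.
Hypothesis ab : a <= b.
Hypothesis muG : mu * G ^ (12 * rho #|T| + 140) <= 1.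
Hypothesis len : mu * (b - a) <= G.
Hypothesis case_sg : (ch = 1 /\ sg = -1) \/ (ch = 0 /\ sg = 1).

Let E t := energy (p t) (q t).
Let u i t := frequency nn ll (I t) i.
Let e t := sg * E t / 2.

Hypothesis far : forall t, a <= t <= b -> / G <= e t.

Let G10 : 10 <= G.
Proof. have := KG1 O KG; have := o_K O; lra. Qed.

Let mu0 : 0 <= mu.
Proof. exact: o_mu O. Qed.

Let KG' : 10 * K <= G.
Proof. exact: KG1 O KG. Qed.

Let gi : 0 < / G.
Proof. apply: Rinv_0_lt_compat; lra. Qed.

Lemma ch01 : ch = 0 \/ ch = 1.
Proof. by case: case_sg => [[-> _]|[-> _]]; [right | left]. Qed.

Lemma E_e t : E t = 2 * sg * e t.
Proof. by rewrite /e; case: case_sg => [[_ ->]|[_ ->]]; field. Qed.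

Lemma far_energy_range t : a <= t <= b -> energy_range G ch (e t).
Proof.
move=> ht; have := far ht; have := energy_ge (p t) (q t); have := o_Eb O ht; rewrite -/(E t).
have := @pow_K_le _ _ _ _ _ _ _ _ _ _ _ _ _ _ _ _ _ O 2 ltac:(lia).
by rewrite /energy_range /e; case: case_sg => [[-> ->]|[-> ->]] => *; split; lra.
Qed.

Let D i t := Rabs (sin (u i t * per ch (e t) / 2)).
Let dist s t := rsum (fun j => Rabs (I s j - I t j)) + Rabs (E s - E t).

Lemma continuous_I t j : a <= t <= b -> continuous (fun s => I s j) t.
Proof. by move=> ht; exact: continuous_is_derive (o_I O j ht). Qed.

Lemma continuous_p t : a <= t <= b -> continuous p t.
Proof. by move=> ht; have [v [hv _]] := o_p O ht; exact: continuous_is_derive hv. Qed.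

Lemma continuous_q t : a <= t <= b -> continuous q t.
Proof. by move=> ht; have [v [hv _]] := o_q O ht; exact: continuous_is_derive hv. Qed.

Lemma continuous_E t : a <= t <= b -> continuous E t.
Proof. by move=> ht; have [v [hv _]] := is_derive_energy O KG ht; exact: continuous_is_derive hv. Qed.

(** The charts need a constant sign. It holds because the energy keeps away from 0: a zero of
    [sin (q / 2)] would force [E >= 0], a zero of [p] would force [E <= 0]. *)
Lemma far_drift i t1 t2 eta : a <= t1 -> t1 <= t2 -> t2 <= b -> 0 < eta <= 1 ->
  (forall t, t1 <= t <= t2 -> eta <= D i t) ->
  Rabs (acc i t2 - acc i t1) <= mu * (2 * G ^ 4 / eta) + mu ^ 2 * (G ^ 14 / eta ^ 2) * (t2 - t1).
Proof.
move=> h1 h12 h2 he nonres; have O' := orbit_sub O h1 h2.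
have sub t : t1 <= t <= t2 -> a <= t <= b by lra.
case: case_sg => [[ec es]|[ec es]].
- have eE t : e t = - E t / 2 by rewrite /e es; field.
  have cz t : t1 <= t <= t2 -> continuous (fun s => sin (q s / 2)) t.
    move=> ht; have [v [hv _]] := o_q O (sub t ht).
    exact: continuous_is_derive (is_derive_sin_half hv).
  have nz t : t1 <= t <= t2 -> sin (q t / 2) <> 0.
    move=> ht s0; have := far (sub t ht); rewrite eE /E /energy cos_double s0.
    by have := pow2_ge_0 (p t); lra.
  case: (constant_sign cz nz) => sgn.
    apply: (libration_drift O' KG h12 he (s := 1)); first ring.
    + by move=> t ht; rewrite Rmult_1_l; exact: sgn.
    + by move=> t ht; have := far (sub t ht); rewrite eE.
    + by move=> t ht; have := nonres t ht; rewrite /D eE ec.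
  apply: (libration_drift O' KG h12 he (s := -1)); first ring.
  + by move=> t ht; have := sgn t ht; lra.
  + by move=> t ht; have := far (sub t ht); rewrite eE.
  + by move=> t ht; have := nonres t ht; rewrite /D eE ec.
- have eE t : e t = E t / 2 by rewrite /e es; field.
  have nz t : t1 <= t <= t2 -> p t <> 0.
    move=> ht s0; have := far (sub t ht); rewrite eE /E /energy s0.
    by have := COS_bound (q t); lra.
  case: (constant_sign (fun t ht => continuous_p (sub t ht)) nz) => sgn.
    apply: (rotation_drift O' KG h12 he (s := 1)); first ring.
    + by move=> t ht; rewrite Rmult_1_l; exact: sgn.
    + by move=> t ht; have := far (sub t ht); rewrite eE.
    + by move=> t ht; have := nonres t ht; rewrite /D eE ec.
  apply: (rotation_drift O' KG h12 he (s := -1)); first ring.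
  + by move=> t ht; have := sgn t ht; lra.
  + by move=> t ht; have := far (sub t ht); rewrite eE.
  + by move=> t ht; have := nonres t ht; rewrite /D eE ec.
Qed.

Lemma dist_ge0 s t : 0 <= dist s t.
Proof.
rewrite /dist; have := rsum_ge0 (fun j => Rabs_pos (I s j - I t j)).
by have := Rabs_pos (E s - E t); lra.
Qed.

Lemma frequency_lip i s t : Rabs (u i s - u i t) <= K * dist t s.
Proof.
rewrite /u (freq_sub nn ll) /dot; apply: Rle_trans (rsum_abs _) _.
apply: Rle_trans (_ : K * rsum (fun j => Rabs (I t j - I s j)) <= _).
  rewrite -rsum_scal; apply: rsum_le => j.
  by apply: mul_bound; [exact: (o_nn O) | rewrite Rabs_minus_sym; lra].
apply: Rmult_le_compat_l; first by have := o_K O; lra.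
by rewrite /dist; have := Rabs_pos (E t - E s); lra.
Qed.

Lemma e_lip s t : Rabs (e s - e t) <= dist t s.
Proof.
have -> : e s - e t = sg * (E s - E t) * / 2 by rewrite /e; field.
rewrite !Rabs_mult (Rabs_pos_eq (/ 2)); last lra.
have -> : Rabs sg = 1 by case: case_sg => [[_ ->]|[_ ->]]; [rewrite Rabs_left; lra | exact: Rabs_R1].
have := rsum_ge0 (fun j => Rabs_pos (I t j - I s j)); rewrite /dist (Rabs_minus_sym (E s)).
by have := Rabs_pos (E t - E s); lra.
Qed.

Lemma arg_lip i s t : a <= s <= b -> a <= t <= b ->
  Rabs (u i s * per ch (e s) / 2 - u i t * per ch (e t) / 2) <= G ^ 8 * dist t s.
Proof.
move=> hs ht; have d0 := dist_ge0 t s.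
have ps : Rabs (per ch (e t)) <= G ^ 2.
  by have := per_gt0 G10 ch01 (far_energy_range ht);
     have := per_bounds G10 ch01 (far_energy_range ht) => *; rewrite Rabs_pos_eq; lra.
have pl : Rabs (per ch (e s) - per ch (e t)) <= G ^ 4 * dist t s.
  apply: Rle_trans (per_lip G10 ch01 (far_energy_range hs) (far_energy_range ht)) _.
  by apply: Rmult_le_compat_l; [apply: Rlt_le; exact: pow_G_gt0 | exact: e_lip].
have h : Rabs (u i s * per ch (e s) - u i t * per ch (e t)) <=
    G * (G ^ 4 * dist t s) + K * dist t s * G ^ 2.
  exact: mul_diff_bound (abs_frequency_le_G O KG i hs) ps (frequency_lip i s t) pl.
have -> : u i s * per ch (e s) / 2 - u i t * per ch (e t) / 2 =
  (u i s * per ch (e s) - u i t * per ch (e t)) * / 2 by field.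
rewrite Rabs_mult (Rabs_pos_eq (/ 2)); last lra.
have : G * (G ^ 4 * dist t s) + K * dist t s * G ^ 2 <= G ^ 8 * dist t s.
  have -> : G * (G ^ 4 * dist t s) + K * dist t s * G ^ 2 = (G ^ 5 + K * G ^ 2) * dist t s by ring.
  apply: Rmult_le_compat_r => //.
  have k1 : K * G ^ 2 <= G ^ 3.
    have -> : G ^ 3 = G * G ^ 2 by ring.
    by apply: Rmult_le_compat_r; [apply: Rlt_le; exact: pow_G_gt0 | have := o_K O; lra].
  have := pow_G_le G10 (m := 3) (n := 7) ltac:(lia); have := pow_G_le G10 (m := 5) (n := 7) ltac:(lia).
  by have := pow_G_10 G10 7; have := pow_G_gt0 G10 7; lra.
by have := Rabs_pos (u i s * per ch (e s) - u i t * per ch (e t)); lra.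
Qed.

Lemma D_lip i s t : a <= s <= b -> a <= t <= b -> Rabs (D i s - D i t) <= G ^ 8 * dist t s.
Proof.
move=> hs ht; apply: Rle_trans (Rabs_triang_inv2 _ _) _.
by apply: Rle_trans (sin_lip _ _) _; exact: arg_lip.
Qed.

Lemma dist_continuous t0 t : a <= t <= b -> continuous (dist t0) t.
Proof.
move=> ht; apply: cont_plus.
  apply: (continuous_rsum (F := fun j s => Rabs (I t0 j - I s j))) => j.
  apply: (continuous_comp (fun s => I t0 j - I s j) Rabs); last exact: continuous_Rabs.
  by apply: cont_minus; [exact: cont_cst | exact: continuous_I].
apply: (continuous_comp (fun s => E t0 - E s) Rabs); last exact: continuous_Rabs.
by apply: cont_minus; [exact: cont_cst | exact: continuous_E].
Qed.

Let Rad k := / G ^ rho (#|T| - k).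
(** Twice the variation of [D] that [D_lip] allows over the distance [Rad k]: what starts beyond
    [eta k] stays beyond half of it. *)
Let eta k := 2 * (G ^ 8 * Rad k).

Lemma Rad_gt0 k : 0 < Rad k.
Proof. by apply: Rinv_0_lt_compat; exact: pow_G_gt0. Qed.

Lemma Rad_le12 k : Rad k * G ^ 12 <= 1.
Proof.
have R0 := Rad_gt0 k; have h := pow_G_le G10 (rho_ge (#|T| - k)).
have <- : Rad k * G ^ rho (#|T| - k) = 1.
  by rewrite /Rad; field; apply: Rgt_not_eq; exact: pow_G_gt0.
by apply: Rmult_le_compat_l; lra.
Qed.

Lemma Rad_pred k : (k < #|T|)%N -> Rad k * G ^ 125 = Rad k.+1 ^ 10.
Proof.
move=> kn; have -> : Rad k = / (G ^ (rho (#|T| - k.+1) * 10 + 125)).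
  by rewrite /Rad -(subnSK kn) [rho _.+1]/= mulnC.
rewrite /Rad -plusE -multE pow_add pow_mult -pow_inv.
have h := pow_G_gt0 G10 125; have h2 := pow_G_gt0 G10 (rho (#|T| - k.+1)).
have h3 := pow_lt _ 10 h2.
by rewrite pow_inv; field; lra.
Qed.

Lemma Rad_step k : (k < #|T|)%N -> 8 * Rad k <= Rad k.+1.
Proof.
move=> kn; have R0 := Rad_gt0 k; have R1 := Rad_gt0 k.+1.
have h := Rad_pred kn; have h12 := Rad_le12 k.+1.
have g := pow_G_le G10 (m := 1) (n := 125) ltac:(lia); rewrite pow_1 in g.
have R1' : Rad k.+1 <= 1.
  by have := pow_G_ge1 G10 12; nra.
have : Rad k.+1 ^ 10 <= Rad k.+1.
  rewrite -tech_pow_Rmult -[X in _ <= X]Rmult_1_r; apply: Rmult_le_compat_l; first lra.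
  by rewrite -(pow1 9); apply: pow_incr; lra.
nra.
Qed.

(** The only place where [mu] is compared with the chain of radii. Of the power 12, ten go into the
    precision [del] and two pay for the squared divisor of the drift estimate. *)
Lemma mu_Rad k : mu * G ^ 140 <= Rad k ^ 12.
Proof.
have G140 := pow_G_gt0 G10 140.
rewrite /Rad pow_inv -pow_mult.
apply: (Rmult_le_reg_r (G ^ (rho (#|T| - k) * 12)%coq_nat)); first exact: pow_G_gt0.
rewrite Rinv_l; last by apply: Rgt_not_eq; exact: pow_G_gt0.
apply: Rle_trans muG.
rewrite -plusE -multE pow_add Rmult_assoc; apply: Rmult_le_compat_l => //.
rewrite Rmult_comm; apply: Rmult_le_compat_r; first lra.
apply: pow_G_le => //; have := @rho_mono (#|T| - k) #|T| (leq_subr _ _); lia.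
Qed.

Section OneResonance.
Variables (S : {set T}) (t1 t2 : R).
Hypotheses (at1 : a <= t1) (t12 : t1 <= t2) (t2b : t2 <= b).
Hypothesis close : forall s, t1 <= s <= t2 -> dist t1 s <= 2 * Rad #|S|.
Hypothesis nonresonant : forall s i, t1 <= s <= t2 -> i \notin S -> eta #|S| / 2 <= D i s.
Hypothesis resonant : forall s i, t1 <= s <= t2 -> i \in S -> D i s < eta #|S|.-1.

Let r := Rad #|S|.
(** Common precision of the resonances, of the energy balance and of the inactive harmonics. It is
    tuned so that [G ^ 60 * del] is the fifth power of [r ^ 2 / G ^ 10], the bound wanted for half
    the variation of [e]. *)
Let del := r ^ 10 / G ^ 110.

Let r_gt0 : 0 < r.
Proof. exact: Rad_gt0. Qed.

Let rG12 : r * G ^ 12 <= 1.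
Proof. exact: Rad_le12. Qed.

Let r_le1 : r <= 1.
Proof. have := pow_G_ge1 G10 12; nra. Qed.

Let del_gt0 : 0 < del.
Proof. by apply: Rdiv_lt_0_compat; [exact: pow_lt | exact: pow_G_gt0]. Qed.

Lemma mu_del : mu * G ^ 30 <= del * r ^ 2.
Proof.
have h := mu_Rad #|S|; rewrite -/r in h; have g := pow_G_gt0 G10 110.
have -> : del * r ^ 2 = r ^ 12 / G ^ 110 by rewrite /del; field; lra.
apply: (Rmult_le_reg_r (G ^ 110)) => //.
have -> : r ^ 12 / G ^ 110 * G ^ 110 = r ^ 12 by field; lra.
by rewrite Rmult_assoc -pow_add.
Qed.

Lemma mu_le_del k : (k <= 30)%coq_nat -> mu * G ^ k <= del.
Proof.
move=> k30; apply: Rle_trans (_ : mu * G ^ 30 <= _).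
  by apply: Rmult_le_compat_l => //; exact: pow_G_le.
apply: Rle_trans mu_del _; rewrite -[X in _ <= X]Rmult_1_r; apply: Rmult_le_compat_l; first lra.
by rewrite -(pow1 2); apply: pow_incr; lra.
Qed.

Lemma nonresonant_acc i s t : i \notin S -> t1 <= s -> s <= t -> t <= t2 ->
  Rabs (acc i t - acc i s) <= del.
Proof.
move=> iS ts st tt.
have G8 := pow_G_gt0 G10 8.
have eta_r : r <= G ^ 8 * r by have := pow_G_ge1 G10 8; nra.
have eta1 : 0 < G ^ 8 * r <= 1.
  split; first lra; have := pow_G_le G10 (m := 8) (n := 12) ltac:(lia); nra.
apply: Rle_trans (far_drift (i := i) (eta := G ^ 8 * r) _ st _ eta1 _) _; try lra.
  by move=> x hx; have := nonresonant (s := x) (i := i) ltac:(lra) iS; rewrite /eta -/r; lra.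
have ie : / (G ^ 8 * r) <= / r by apply: Rinv_le_contravar.
have ie2 : / (G ^ 8 * r) ^ 2 <= / r ^ 2.
  by apply: Rinv_le_contravar; [exact: pow_lt | apply: pow_incr; lra].
have lenst : mu * (t - s) <= G by apply: Rle_trans len; apply: Rmult_le_compat_l => //; lra.
have m2 := mu_del; have r2 : 0 < r ^ 2 by exact: pow_lt.
have ir1 : / r <= / r ^ 2 by apply: Rinv_le_contravar => //; nra.
have key : mu * G ^ 16 * / r ^ 2 <= del.
  apply: (Rmult_le_reg_r (r ^ 2)) => //; rewrite Rmult_assoc Rinv_l ?Rmult_1_r; last lra.
  apply: Rle_trans m2; apply: Rmult_le_compat_l => //; apply: pow_G_le => //; lia.
have p1 : mu * (2 * G ^ 4 / (G ^ 8 * r)) <= mu * (2 * G ^ 4) * / r ^ 2.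
  rewrite Rmult_assoc; apply: Rmult_le_compat_l => //; rewrite /Rdiv.
  by apply: Rmult_le_compat_l; [have := pow_G_gt0 G10 4; lra | lra].
have p2 : mu ^ 2 * (G ^ 14 / (G ^ 8 * r) ^ 2) * (t - s) <= mu * G ^ 15 * / r ^ 2.
  have -> : mu ^ 2 * (G ^ 14 / (G ^ 8 * r) ^ 2) * (t - s) =
     (mu * G ^ 14) * ((mu * (t - s)) * / (G ^ 8 * r) ^ 2) by rewrite /Rdiv; ring.
  have -> : mu * G ^ 15 * / r ^ 2 = (mu * G ^ 14) * (G * / r ^ 2) by ring.
  apply: Rmult_le_compat_l; first by apply: Rmult_le_pos => //; apply: Rlt_le; exact: pow_G_gt0.
  apply: Rmult_le_compat => //; first by apply: Rmult_le_pos => //; lra.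
  by apply: Rlt_le; apply: Rinv_0_lt_compat; apply: pow_lt; lra.
apply: Rle_trans (Rplus_le_compat _ _ _ _ p1 p2) _; apply: Rle_trans key.
rewrite -Rmult_plus_distr_r; apply: Rmult_le_compat_r; first by apply: Rlt_le; exact: Rinv_0_lt_compat.
rewrite -Rmult_plus_distr_l; apply: Rmult_le_compat_l => //.
have := pow_G_10 G10 15; have := pow_G_le G10 (m := 4) (n := 15) ltac:(lia); have := pow_G_gt0 G10 15; lra.
Qed.

(** The multiple of PI is fixed at time [t1]. It serves at all times, because within the radius
    [2 * r] the argument of the sine moves by less than 1 and cannot come near another multiple; the
    smallness of the sine then improves distance 2 to distance [3 * eta]. *)
Lemma resonant_frequencies : exists M : T -> R, forall s i, t1 <= s <= t2 -> i \in S ->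
  Rabs (u i s - M i * / per ch (e s)) <= del.
Proof.
have [m hm] := fin_all_exists (fun i => nearest_mult_PI (u i t1 * per ch (e t1) / 2)).
exists (fun i => 2 * IZR (m i) * PI) => s i hs iS.
have hs' : a <= s <= b by lra.
set x := fun s => u i s * per ch (e s) / 2.
have kS : #|S| = #|S|.-1.+1 by rewrite prednK // card_gt0; apply/set0Pn; exists i.
have kT : (#|S|.-1 < #|T|)%N by rewrite -kS max_card.
have small : eta #|S|.-1 * G ^ 117 = 2 * r ^ 10.
  have := Rad_pred kT; rewrite -kS -/r /eta => <-; ring.
have r10 : r ^ 10 <= 1 by rewrite -(pow1 10); apply: pow_incr; lra.
have small1 : eta #|S|.-1 <= / 10.
  have g := pow_G_le G10 (m := 2) (n := 117) ltac:(lia); have g2 : 100 <= G ^ 2 by nra.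
  have : 0 < eta #|S|.-1 by apply: Rmult_lt_0_compat; [lra | apply: Rmult_lt_0_compat; [exact: pow_G_gt0 | exact: Rad_gt0]].
  nra.
have at_t1 : Rabs (x t1 - IZR (m i) * PI) <= 3 * eta #|S|.-1.
  apply: Rle_trans (abs_le_3_abs_sin (hm i)) _; rewrite sin_sub_mult_PI.
  by have := resonant (s := t1) (i := i) ltac:(lra) iS; rewrite /D; lra.
have near : Rabs (x s - IZR (m i) * PI) <= 2.
  have -> : x s - IZR (m i) * PI = (x s - x t1) + (x t1 - IZR (m i) * PI) by ring.
  apply: Rle_trans (add_bound (arg_lip i hs' (t := t1) ltac:(lra)) at_t1) _.
  have h := close hs; rewrite -/r in h.
  have := Rmult_le_compat_l _ _ _ (Rlt_le _ _ (pow_G_gt0 G10 8)) h.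
  have : G ^ 8 * (2 * r) <= 1.
    have := pow_G_10 G10 8; have := pow_G_le G10 (m := 9) (n := 12) ltac:(lia) => g1 g2.
    have : (2 * G ^ 8) * r <= G ^ 12 * r by apply: Rmult_le_compat_r; [lra | have := pow_G_gt0 G10 8; lra].
    lra.
  lra.
have at_s : Rabs (x s - IZR (m i) * PI) <= 3 * eta #|S|.-1.
  apply: Rle_trans (abs_le_3_abs_sin near) _; rewrite sin_sub_mult_PI.
  by have := resonant hs iS; rewrite /D -/(x s); lra.
have per0 := per_gt0 G10 ch01 (far_energy_range hs').
have [per1 _] := per_bounds G10 ch01 (far_energy_range hs').
have -> : u i s - 2 * IZR (m i) * PI * / per ch (e s) = 2 * (x s - IZR (m i) * PI) * / per ch (e s).
  by rewrite /x; field; lra.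
rewrite !Rabs_mult (Rabs_pos_eq 2) ?(Rabs_pos_eq (/ _)); try lra;
  last by apply: Rlt_le; exact: Rinv_0_lt_compat.
have pG := inv_le_G G10 per1.
apply: Rle_trans (_ : (2 * (3 * eta #|S|.-1)) * G <= _).
  apply: Rmult_le_compat => //; try lra; first by have := Rabs_pos (x s - IZR (m i) * PI); lra.
  by apply: Rlt_le; exact: Rinv_0_lt_compat.
have g110 := pow_G_gt0 G10 110.
apply: (Rmult_le_reg_r (G ^ 110)) => //.
have -> : del * G ^ 110 = r ^ 10 by rewrite /del; field; lra.
have -> : 2 * (3 * eta #|S|.-1) * G * G ^ 110 = 6 * (eta #|S|.-1 * G ^ 117) / G ^ 6 by field; lra.
rewrite small; apply/Rle_div_l; first exact: pow_G_gt0.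
have g : 12 <= G ^ 6 by have := pow_G_10 G10 1; have := pow_G_le G10 (m := 2) (n := 6) ltac:(lia); rewrite pow_1; lra.
have : 0 < r ^ 10 by exact: pow_lt.
nra.
Qed.

Let w t := / per ch (e t).

Lemma w_bounds t : a <= t <= b -> 0 < w t <= G /\ / G ^ 2 <= w t.
Proof.
move=> ht; have per0 := per_gt0 G10 ch01 (far_energy_range ht).
have [per1 per2] := per_bounds G10 ch01 (far_energy_range ht).
split; last by apply: Rinv_le_contravar.
by split; [exact: Rinv_0_lt_compat | exact: inv_le_G].
Qed.

(** Bounds from below the increments of [w] that multiply the conclusion of [steep_three]. *)
Lemma w_twist s t : a <= s <= b -> a <= t <= b -> Rabs (e s - e t) / G ^ 7 <= Rabs (w s - w t).
Proof.
have key x y : a <= x <= b -> a <= y <= b -> e x <= e y -> (e y - e x) / G ^ 7 <= w y - w x.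
  move=> hx hy exy.
  have px := per_gt0 G10 ch01 (far_energy_range hx); have py := per_gt0 G10 ch01 (far_energy_range hy).
  have [_ bx] := per_bounds G10 ch01 (far_energy_range hx).
  have [_ by_] := per_bounds G10 ch01 (far_energy_range hy).
  have h := per_decr G10 ch01 (far_energy_range hx) (far_energy_range hy) exy.
  have -> : w y - w x = (per ch (e x) - per ch (e y)) * / (per ch (e x) * per ch (e y)).
    by rewrite /w; field; lra.
  have -> : (e y - e x) / G ^ 7 = (e y - e x) / G ^ 3 * / G ^ 4 by field; lra.
  apply: Rmult_le_compat => //.
  - by apply: Rdiv_le_0_compat; [lra | exact: pow_G_gt0].
  - by apply: Rlt_le; apply: Rinv_0_lt_compat; exact: pow_G_gt0.
  apply: Rinv_le_contravar; first exact: Rmult_lt_0_compat.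
  have -> : G ^ 4 = G ^ 2 * G ^ 2 by ring.
  by apply: Rmult_le_compat; lra.
move=> hs ht; case: (Rle_lt_dec (e s) (e t)) => est.
  rewrite Rabs_minus_sym (Rabs_minus_sym (w s)) (Rabs_pos_eq (e t - e s)); last lra.
  by apply: Rle_trans (Rle_abs _); exact: key.
rewrite (Rabs_pos_eq (e s - e t)); last lra.
by apply: Rle_trans (Rle_abs _); apply: key => //; lra.
Qed.

Lemma acc_G2 i s t : t1 <= s -> s <= t -> t <= t2 -> Rabs (acc i t - acc i s) <= G ^ 2.
Proof.
move=> h1 h2 h3; apply: Rle_trans (acc_bound O i _ h2 _) _; try lra.
have -> : mu * (2 * K) * (t - s) = 2 * K * (mu * (t - s)) by ring.
have -> : G ^ 2 = G * G by ring.
have K2 := o_K O; apply: Rmult_le_compat; try lra; first by apply: Rmult_le_pos; lra.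
by apply: Rle_trans len; apply: Rmult_le_compat_l => //; lra.
Qed.

Lemma dE_del s t : t1 <= s -> s <= t -> t <= t2 ->
  Rabs (E t - E s + rsum (fun i => (acc i t - acc i s) * ((u i s + u i t) / 2))) <= del.
Proof.
move=> h1 h2 h3; apply: Rle_trans (dE_acc O _ h2 _) _; try lra.
apply: Rle_trans (@mu_le_del 3 ltac:(lia)).
have -> : mu * (2 * K) + K * mu ^ 2 * (t - s) = mu * (2 * K + K * (mu * (t - s))) by ring.
apply: Rmult_le_compat_l => //.
have K2 := o_K O.
have h : mu * (t - s) <= G by apply: Rle_trans len; apply: Rmult_le_compat_l => //; lra.
have h' : K * (mu * (t - s)) <= G * G by apply: Rmult_le_compat; try lra; apply: Rmult_le_pos; lra.
by have := pow_G_10 G10 2; have := pow_G_10 G10 1; rewrite /= !Rmult_1_r; nra.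
Qed.

Lemma freq_G3 i t : a <= t <= b -> Rabs (u i t) <= G ^ 3.
Proof.
move=> ht; apply: Rle_trans (abs_frequency_le_G O KG i ht) _.
by have := pow_G_le G10 (m := 1) (n := 3) ltac:(lia); rewrite pow_1.
Qed.

Let cardT : INR #|T| <= G.
Proof. by have := o_T O; have := o_K O; lra. Qed.

(** With [h] half the increment of [e], the factors in [steep_three] are at least of order |h|, |h|
    / G^7 twice (twist) and h^2 / G^34 (concavity). Their product is bounded by [G ^ 11 * del],
    hence a bound for |h|^5. *)
Lemma energy_confined : Rabs (e t2 - e t1) <= 2 * (r ^ 2 / G ^ 10).
Proof.
have h1 : a <= t1 <= b by lra.
have h2 : a <= t2 <= b by lra.
have ce t : t1 <= t <= t2 -> continuous e t.
  have eE s : sg / 2 * E s = e s :> R by rewrite /e; field.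
  move=> ht; apply: (continuous_ext _ _ _ eE).
  by apply: cont_mult; [exact: cont_cst | apply: continuous_E; lra].
(* A time at which the energy is halfway, so that the two increments are equal. *)
have [tm [htm etm]] := ivt t12 ce (y := (e t1 + e t2) / 2)
  ltac:(split; [have := Rmin_l (e t1) (e t2); have := Rmin_r (e t1) (e t2); lra
               |have := Rmax_l (e t1) (e t2); have := Rmax_r (e t1) (e t2); lra]).
have hm : a <= tm <= b by lra.
set h := e tm - e t1.
have hh : e t2 - e tm = h by rewrite /h; lra.
have [M hM] := resonant_frequencies.
have := @steep_three G d T nn ll S G10 cardT (I t1) (I tm) (I t2) (E t1) (E tm) (E t2) (w t1) (w tm) (w t2)
  (fun i => acc i tm - acc i t1) (fun i => acc i t2 - acc i tm) M del
  (fun j => dI_acc O j h1 hm) (fun j => dI_acc O j hm h2)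
  (dE_del (Rle_refl _) (proj1 htm) (proj2 htm)) (dE_del (proj1 htm) (proj2 htm) (Rle_refl _))
  (proj1 (w_bounds h1)) (proj1 (w_bounds hm)) (proj1 (w_bounds h2))
  (fun i => acc_G2 i (Rle_refl _) (proj1 htm) (proj2 htm)) (fun i => acc_G2 i (proj1 htm) (proj2 htm) (Rle_refl _))
  (fun i => freq_G3 i h1) (fun i => freq_G3 i hm) (fun i => freq_G3 i h2)
  (fun i iS => hM t1 i (conj (Rle_refl _) t12) iS) (fun i iS => hM tm i htm iS)
  (fun i iS => hM t2 i (conj t12 (Rle_refl _)) iS)
  (fun i iS => nonresonant_acc iS (Rle_refl _) (proj1 htm) (proj2 htm))
  (fun i iS => nonresonant_acc iS (proj1 htm) (proj2 htm) (Rle_refl _)).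
have EE : E tm - E t1 = 2 * sg * h by rewrite !E_e /h; ring.
have -> : E tm - E t1 = E t2 - E tm by rewrite EE !E_e -hh; ring.
move=> /(_ erefl); have -> : E t2 - E tm = 2 * sg * h by rewrite !E_e -hh; ring.
have x1 := w_twist hm h1; have x2 := w_twist h2 hm; rewrite hh in x2; rewrite -/h in x1.
set x := w tm - w t1 in x1 *; set y := w t2 - w tm in x2 *.
have [kap hk] := per_concave G10 ch01 (far_energy_range hm).
have c0 := hk _ (far_energy_range h1); have c2 := hk _ (far_energy_range h2).
set gap := 2 * w tm ^ 2 - w t1 ^ 2 - w t2 ^ 2.
(* The concavity inequalities based at [tm] are added for the two end points, and their linear terms
   cancel. *)
have hgap : 2 * (h ^ 2 / G ^ 34) <= gap.
  move: c0 c2; rewrite -!pow_inv -/(w t1) -/(w t2) -/(w tm) hh.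
  have -> : e t1 - e tm = - h by rewrite /h; ring.
  have -> : (- h) ^ 2 = h ^ 2 by ring.
  by rewrite /gap; lra.
have h0 : 0 <= h ^ 2 / G ^ 34 by apply: Rdiv_le_0_compat; [exact: pow2_ge_0 | exact: pow_G_gt0].
have s1 : Rabs sg = 1 by case: case_sg => [[_ ->]|[_ ->]]; [rewrite Rabs_left; lra | exact: Rabs_R1].
have ag : Rabs (gap / 2) = gap / 2 by rewrite Rabs_pos_eq; lra.
have gapE : gap = 2 * (gap / 2) by field.
move: ag gapE; move: (gap / 2) => hg ag gapE.
rewrite !Rabs_mult s1 ag (Rabs_pos_eq 2); last lra.
move=> up.
have g7 := pow_G_gt0 G10 7.
have low : 2 * 1 * Rabs h * (Rabs h / G ^ 7) * (Rabs h / G ^ 7) * (h ^ 2 / G ^ 34) <=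
    2 * 1 * Rabs h * Rabs x * Rabs y * hg.
  have a0 := Rabs_pos h.
  have a7 : 0 <= Rabs h / G ^ 7 by exact: Rdiv_le_0_compat.
  apply: Rmult_le_compat => //; last lra.
    by repeat apply: Rmult_le_pos => //; lra.
  apply: Rmult_le_compat => //; first by repeat apply: Rmult_le_pos => //; lra.
  by apply: Rmult_le_compat_l => //; lra.
have : Rabs h ^ 5 <= (r ^ 2 / G ^ 10) ^ 5.
  have -> : (r ^ 2 / G ^ 10) ^ 5 = G ^ 60 * del.
    by rewrite /del; field; lra.
  have -> : Rabs h ^ 5 = 2 * 1 * Rabs h * (Rabs h / G ^ 7) * (Rabs h / G ^ 7) * (h ^ 2 / G ^ 34) * (G ^ 48 / 2).
    by rewrite -(pow2_abs h); field; lra.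
  have -> : G ^ 60 * del = G ^ 11 * del * (G ^ 49) by ring.
  apply: Rmult_le_compat; [| |lra|].
  - by repeat apply: Rmult_le_pos => //; try lra; try exact: Rabs_pos; apply: Rlt_le; apply: Rinv_0_lt_compat.
  - by have := pow_G_gt0 G10 48; lra.
  - by have := pow_G_10 G10 48; have := pow_G_gt0 G10 48; lra.
move=> /pow5_le; have q0 : 0 <= r ^ 2 / G ^ 10.
  by apply: Rdiv_le_0_compat; [exact: pow2_ge_0 | exact: pow_G_gt0].
move=> /(_ q0) hR; have -> : e t2 - e t1 = 2 * h by lra.
by rewrite Rabs_mult (Rabs_pos_eq 2); lra.
Qed.

(** Now [steep_two] bounds the square of the increment of I by the increment of the energy, which is
    why the latter had to be O(r^2) and not merely O(r). Dividing by the mean of [w] costs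
    [G ^ 2]. *)
Lemma one_resonance_confined : dist t1 t2 <= r / 4.
Proof.
have h1 : a <= t1 <= b by lra.
have h2 : a <= t2 <= b by lra.
have [M hM] := resonant_frequencies.
have := @steep_two G d T nn ll S G10 cardT (I t1) (I t2) (E t1) (E t2) (w t1) (w t2)
  (fun i => acc i t2 - acc i t1) M del
  (fun j => dI_acc O j h1 h2) (dE_del (Rle_refl _) t12 (Rle_refl _)).
have ab_ x : 0 < x <= G -> Rabs x <= G by move=> ?; rewrite Rabs_pos_eq; lra.
move=> /(_ (ab_ _ (proj1 (w_bounds h1))) (ab_ _ (proj1 (w_bounds h2)))
  (fun i => acc_G2 i (Rle_refl _) t12 (Rle_refl _)) (fun i => freq_G3 i h1) (fun i => freq_G3 i h2)
  (fun i iS => hM t1 i (conj (Rle_refl _) t12) iS) (fun i iS => hM t2 i (conj t12 (Rle_refl _)) iS)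
  (fun i iS => nonresonant_acc iS (Rle_refl _) t12 (Rle_refl _))).
set P := dot _ _; set dE := E t2 - E t1; move=> st.
have ec := energy_confined.
have s1 : Rabs sg = 1 by case: case_sg => [[_ ->]|[_ ->]]; [rewrite Rabs_left; lra | exact: Rabs_R1].
have r2 : 0 < r ^ 2 by exact: pow_lt.
have G10' := pow_G_gt0 G10 10.
have dEb : Rabs dE <= 4 * (r ^ 2 / G ^ 10).
  have -> : dE = 2 * sg * (e t2 - e t1) by rewrite /dE !E_e; ring.
  by rewrite !Rabs_mult s1 (Rabs_pos_eq 2); lra.
have [[w1 w1'] w1''] := w_bounds h1; have [[w2 w2'] w2''] := w_bounds h2.
have dw : Rabs (w t2 - w t1) <= G by apply/Rabs_le_between; lra.
have P0 : 0 <= P by apply: rsum_ge0 => j; exact: Rle_0_sqr.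
have PB : P <= G ^ 2 * (4 * (r ^ 2 / G ^ 10) * G + G ^ 6 * del).
  have wP : (w t1 + w t2) / 2 * P <= 4 * (r ^ 2 / G ^ 10) * G + G ^ 6 * del.
    have -> : (w t1 + w t2) / 2 * P = - (dE * (w t2 - w t1)) + ((w t1 + w t2) / 2 * P + dE * (w t2 - w t1)) by ring.
    apply: Rle_trans (Rle_abs _) _; apply: add_bound => //; rewrite Rabs_Ropp.
    exact: mul_bound.
  apply: Rle_trans (Rmult_le_compat_l _ _ _ (Rlt_le _ _ (pow_G_gt0 G10 2)) wP).
  rewrite -Rmult_assoc -{1}(Rmult_1_l P); apply: Rmult_le_compat_r => //.
  have <- : G ^ 2 * / G ^ 2 = 1 by field; lra.
  by apply: Rmult_le_compat_l; [apply: Rlt_le; exact: pow_G_gt0 | lra].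
have PB' : P <= (r / G ^ 3) ^ 2.
  apply: Rle_trans PB _.
  have -> : (r / G ^ 3) ^ 2 = r ^ 2 / G ^ 7 * G by field; lra.
  have -> : G ^ 2 * (4 * (r ^ 2 / G ^ 10) * G + G ^ 6 * del) = r ^ 2 / G ^ 7 * (4 + r ^ 8 / G ^ 95).
    by rewrite /del; field; lra.
  apply: Rmult_le_compat_l; first by apply: Rdiv_le_0_compat; [lra | exact: pow_G_gt0].
  have : r ^ 8 / G ^ 95 <= 1; last lra.
  apply/Rle_div_l; first exact: pow_G_gt0.
  by rewrite Rmult_1_l; apply: (Rle_trans _ 1); [rewrite -(pow1 8); apply: pow_incr; lra | exact: pow_G_ge1].
have g3 := pow_G_gt0 G10 3.
have rg : 0 <= r / G ^ 3 by apply: Rdiv_le_0_compat; lra.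
have dI j : Rabs (Rabs (I t1 j - I t2 j)) <= r / G ^ 3.
  rewrite Rabs_Rabsolu; apply: abs_le_sqr => //; apply: Rle_trans PB'.
  have := @rsum_term _ (fun j => (I t2 j - I t1 j) * (I t2 j - I t1 j)) j (fun j => Rle_0_sqr _).
  rewrite -/(dot _ _) -/P; have -> : (I t1 j - I t2 j) ^ 2 = (I t2 j - I t1 j) * (I t2 j - I t1 j) by ring.
  by [].
have sI := rsum_bound dI; rewrite card_ord in sI.
have dK := o_d O; have K2 := o_K O.
have b1 : INR d * (r / G ^ 3) <= r / 10.
  apply: Rle_trans (_ : G * (r / G ^ 3) <= _); first by apply: Rmult_le_compat_r => //; lra.
  have -> : G * (r / G ^ 3) = r / G ^ 2 by field; lra.
  apply: Rmult_le_compat_l; first lra.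
  by apply: Rinv_le_contravar; [lra | have := pow_G_10 G10 1; rewrite pow_1; lra].
have b2 : 4 * (r ^ 2 / G ^ 10) <= r / 10.
  have : r ^ 2 / G ^ 10 <= r / 100; last lra.
  have -> : r ^ 2 / G ^ 10 = r * (r / G ^ 10) by field; lra.
  apply: Rmult_le_compat_l; first lra.
  apply/Rle_div_l => //.
  have := pow_G_le G10 (m := 2) (n := 10) ltac:(lia); have : 100 <= G ^ 2 by have := pow_G_10 G10 1; rewrite pow_1; lra.
  lra.
rewrite /dist (Rabs_minus_sym (E t1)) -/dE.
by apply: Rle_trans (Rplus_le_compat _ _ _ _ (Rle_trans _ _ _ (Rle_abs _) sI) dEb) _; lra.
Qed.

End OneResonance.

Lemma far_confined s t : a <= s <= b -> a <= t <= b ->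
  rsum (fun j => Rabs (I s j - I t j)) + Rabs (E s - E t) <= / G ^ 12.
Proof.
move=> hs ht.
have := @confinement_all T a b (G ^ 8) dist D Rad eta.
have -> : Rad #|T| = / G ^ 12 by rewrite /Rad subnn.
move=> /(_ _ _ _ _ _ _ _ _ _ _ _ s t hs ht) main.
apply: Rle_trans (main _ _ _ _ _ _ _ _ _ _ _) _.
- by move=> x; rewrite /dist (@rsum_ext _ _ (fun=> 0)) ?rsum_const ?Rminus_diag ?Rabs_R0; [ring | move=> j; rewrite Rminus_diag Rabs_R0].
- move=> x y; rewrite /dist (Rabs_minus_sym (E x)); congr (_ + _).
  by apply: rsum_ext => j; exact: Rabs_minus_sym.
- move=> x y z; rewrite /dist.
  have h1 : rsum (fun j => Rabs (I x j - I z j)) <=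
      rsum (fun j => Rabs (I x j - I y j)) + rsum (fun j => Rabs (I y j - I z j)).
    rewrite -rsum_add; apply: rsum_le => j.
    have -> : I x j - I z j = (I x j - I y j) + (I y j - I z j) by ring.
    exact: Rabs_triang.
  have h2 : Rabs (E x - E z) <= Rabs (E x - E y) + Rabs (E y - E z).
    have -> : E x - E z = (E x - E y) + (E y - E z) by ring.
    exact: Rabs_triang.
  lra.
- by move=> x y _ hy; exact: dist_continuous.
- by move=> i x y hx hy; exact: D_lip.
- by apply: Rlt_le; exact: pow_G_gt0.
- exact: Rad_gt0.
- exact: Rad_step.
- move=> k kn; rewrite /eta; have := Rad_step kn; have := Rad_gt0 k; have := pow_G_gt0 G10 8; nra.
- by move=> k; rewrite /eta; lra.
- by move=> S t1 t2 h1 h12 h2 k1 k2 k3; exact: one_resonance_confined k1 k2 k3.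
by have : 0 < / G ^ 12 by [apply: Rinv_0_lt_compat; exact: pow_G_gt0]; lra.
Qed.

End FarConfinement.

Section FarStable.
Variables (d : nat) (T : finType) (nn : T -> 'I_d -> R) (ll : T -> R) (K mu a b G : R).
Variables (I : R -> 'I_d -> R) (p q : R -> R) (th c acc : T -> R -> R) (f : R -> R).
Variables (F1 F2 : T -> R -> R -> R -> R).
Hypothesis O : orbit nn ll K mu a b I p q th c acc f F1 F2.
Hypothesis KG : 10 * K ^ 6 <= G.
Hypothesis muG : mu * G ^ (12 * rho #|T| + 140) <= 1.
Hypothesis len : mu * (b - a) <= G.

Let E t := energy (p t) (q t).
Let dist s t := rsum (fun j => Rabs (I s j - I t j)) + Rabs (E s - E t).

(** [far_confined] presupposes that the orbit stays away from the separatrix, and this is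
    bootstrapped: as long as the drift is at most [/ G], an energy that starts beyond [4 / G] keeps
    its sign and stays beyond [3 / G], half of which exceeds [/ G]. *)
Lemma far_stable t1 t : a <= t1 <= b -> 4 / G <= Rabs (E t1) -> a <= t <= b ->
  dist t1 t <= / G / 2.
Proof.
move=> h1 far1.
have G10 : 10 <= G by have := KG1 O KG; have := o_K O; lra.
have gi : 0 < / G by apply: Rinv_0_lt_compat; lra.
have mu0 := o_mu O.
apply: (@bootstrap (dist t1) a b t1 (/ G)) => //.
- rewrite /dist (@rsum_ext _ _ (fun=> 0)); last by move=> j; rewrite Rminus_diag Rabs_R0.
  by rewrite rsum_const Rminus_diag Rabs_R0; lra.
- move=> s hs; exact: (dist_continuous O KG hs).
move=> s hs close.
set m := Rmin t1 s in close; set M := Rmax t1 s in close.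
have am : a <= m by apply: Rmin_glb; lra.
have Mb : M <= b by apply: Rmax_lub; lra.
have mM : m <= M by apply: Rle_trans (Rmin_l _ _) (Rmax_l _ _).
have O' := orbit_sub O am Mb.
have len' : mu * (M - m) <= G by apply: Rle_trans len; apply: Rmult_le_compat_l => //; lra.
have near x : m <= x <= M -> Rabs (E t1 - E x) <= / G.
  move=> hx; have := close x hx; rewrite /dist.
  by have := rsum_ge0 (fun j => Rabs_pos (I t1 j - I x j)); lra.
have i1 : m <= t1 <= M by split; [exact: Rmin_l | exact: Rmax_l].
have i2 : m <= s <= M by split; [exact: Rmin_r | exact: Rmax_r].
have fin : / G ^ 12 <= / G / 2.
  have -> : / G / 2 = / (2 * G) by field; lra.
  apply: Rinv_le_contravar; first lra.
  have := pow_G_10 G10 1; have := pow_G_le G10 (m := 2) (n := 12) ltac:(lia); rewrite pow_1; lra.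
apply: Rle_trans fin.
case: (Rle_lt_dec 0 (E t1)) => sE.
  rewrite Rabs_pos_eq // in far1.
  apply: (@far_confined d T nn ll K mu m M G I p q th c acc f F1 F2 0 (1) O' KG muG len' (or_intror (conj erefl erefl)) _ t1 s i1 i2) => x hx.
  by have /Rabs_le_between := near x hx; rewrite -/(E x); lra.
rewrite Rabs_left // in far1.
apply: (@far_confined d T nn ll K mu m M G I p q th c acc f F1 F2 1 (-1) O' KG muG len' (or_introl (conj erefl erefl)) _ t1 s i1 i2) => x hx.
by have /Rabs_le_between := near x hx; rewrite -/(E x); lra.
Qed.

End FarStable.

(** * Vectors in the span of a finite family *)

(** The coefficients are peeled off one by one along the list, so that proofs go by induction on it;
    the family may be linearly dependent. *)
Fixpoint in_span (d : nat) (l : seq ('I_d -> R)) (w : 'I_d -> R) : Prop :=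
  if l is n :: l' then exists x, in_span l' (fun j => w j - x * n j) else forall j, w j = 0.

Section Span.
Variable d : nat.
Implicit Types (l : seq ('I_d -> R)) (v w n : 'I_d -> R).

Definition norm1 v := rsum (fun j => Rabs (v j)).
Definition ortho l v := foldr (fun n P => dot n v = 0 /\ P) True l.
Definition pairing l v := foldr (fun n x => Rabs (dot n v) + x) 0 l.

Lemma dot_comb n v w x : dot n (fun j => v j + x * w j) = dot n v + x * dot n w.
Proof.
rewrite /dot -rsum_scal -rsum_add; apply: rsum_ext => j; ring.
Qed.

Lemma dot_sym v w : dot v w = dot w v.
Proof. by apply: rsum_ext => j; ring. Qed.

Lemma dot_ext n v w : (forall j, v j = w j) -> dot n v = dot n w.
Proof. by move=> h; apply: rsum_ext => j; rewrite h. Qed.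

Lemma in_span_ext l v w : (forall j, v j = w j) -> in_span l v -> in_span l w.
Proof.
elim: l v w => [|n l IH] v w vw /=; first by move=> h j; rewrite -vw.
by case=> x h; exists x; apply: IH h => j; rewrite vw.
Qed.

Lemma in_span_comb l v w x : in_span l v -> in_span l w -> in_span l (fun j => v j + x * w j).
Proof.
elim: l v w => [|n l IH] v w /=; first by move=> h1 h2 j; rewrite h1 h2; ring.
move=> [y hy] [z hz]; exists (y + x * z); apply: in_span_ext (IH _ _ hy hz) => j; ring.
Qed.

Lemma ortho_span l v w : ortho l v -> in_span l w -> dot w v = 0.
Proof.
elim: l w => [|n l IH] w /=.
  by move=> _ h; rewrite /dot (@rsum_ext _ _ (fun=> 0)) ?rsum_const => [|j]; [ring | rewrite h; ring].
move=> [h1 h2] [x hx]; have := IH _ h2 hx.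
rewrite dot_sym (@dot_ext v _ (fun j => w j + (- x) * n j)); last by move=> j; ring.
rewrite dot_comb (dot_sym v n) h1 (dot_sym v w); lra.
Qed.

Lemma ortho_comb l v w x : ortho l v -> ortho l w -> ortho l (fun j => v j + x * w j).
Proof.
elim: l => [//|n l IH] /= [h1 h2] [h3 h4]; split; last exact: IH.
by rewrite dot_comb h1 h3; ring.
Qed.

Lemma ortho_ext l v w : (forall j, v j = w j) -> ortho l v -> ortho l w.
Proof.
move=> h; elim: l => [//|n l IH] /= [h1 h2]; split; last exact: IH.
by rewrite -(dot_ext n h).
Qed.

Lemma pairing_ge0 l v : 0 <= pairing l v.
Proof. by elim: l => [|n l IH] /=; [lra | have := Rabs_pos (dot n v); lra]. Qed.

Lemma span_pairing l w : in_span l w ->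
  exists C, 0 <= C /\ forall v, Rabs (dot w v) <= C * pairing l v.
Proof.
elim: l w => [|n l IH] w /=.
  move=> h; exists 0; split; [lra | move=> v].
  rewrite /dot (@rsum_ext _ _ (fun=> 0)) ?rsum_const => [|j]; last by rewrite h; ring.
  by rewrite Rmult_0_r Rabs_R0; lra.
move=> [x hx]; have [C [C0 hC]] := IH _ hx.
exists (C + Rabs x); split; first by have := Rabs_pos x; lra.
move=> v; have h := hC v.
rewrite dot_sym (@dot_ext v w (fun j => (w j - x * n j) + x * n j)); last by move=> j; ring.
rewrite dot_comb (dot_sym v n) (dot_sym v).
apply: Rle_trans (Rabs_triang _ _) _; rewrite Rabs_mult.
have := Rabs_pos x; have := Rabs_pos (dot n v); have := pairing_ge0 l v; nra.
Qed.

Lemma dot_self_eq0 v : dot v v = 0 -> forall j, v j = 0.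
Proof.
move=> h j.
have := @rsum_term _ (fun j => v j * v j) j (fun j => Rle_0_sqr _).
by rewrite -/(dot v v) h => k; have := Rle_0_sqr (v j); rewrite /Rsqr; nra.
Qed.

Lemma norm1_comb v w x : norm1 (fun j => v j + x * w j) <= norm1 v + Rabs x * norm1 w.
Proof.
rewrite /norm1 -rsum_scal -rsum_add; apply: rsum_le => j.
by apply: Rle_trans (Rabs_triang _ _) _; rewrite Rabs_mult; lra.
Qed.

Lemma norm1_ge0 v : 0 <= norm1 v.
Proof. by apply: rsum_ge0 => j; exact: Rabs_pos. Qed.

(* Gram-Schmidt, one vector of [l] at a time. *)
Lemma projection l : exists C, 0 <= C /\ forall v, exists w,
  in_span l w /\ ortho l (fun j => v j - w j) /\ norm1 w <= C * pairing l v.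
Proof.
elim: l => [|m l [C [C0 IH]]].
  exists 0; split; [lra | move=> v; exists (fun=> 0); split=> //; split=> //=].
  by rewrite /norm1 (@rsum_ext _ _ (fun=> 0)) ?rsum_const => [|j]; [lra | rewrite Rabs_R0].
have [m' [m'l [m''o _]]] := IH m.
pose m'' j := m j - m' j.
have N0 : 0 <= dot m'' m'' by apply: rsum_ge0 => j; exact: Rle_0_sqr.
have dm v : dot m v = dot m' v + dot m'' v.
  by rewrite /dot -rsum_add; apply: rsum_ext => j; rewrite /m''; ring.
(* If [m] already lies in the span of [l], it receives the coefficient 0 and the constant does not
   change. *)
case: (Req_dec (dot m'' m'') 0) => [N|N].
  have z := dot_self_eq0 N.
  exists C; split=> // v; have [w [h1 [h2 h3]]] := IH v.
  exists w; split; first by exists 0; apply: in_span_ext h1 => j; ring.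
  split; last first.
    apply: Rle_trans h3 _; apply: Rmult_le_compat_l => //=.
    by have := Rabs_pos (dot m v); lra.
  split=> //; rewrite dm (ortho_span h2 m'l) /dot (@rsum_ext _ _ (fun=> 0)) ?rsum_const => [|j].
    by ring.
  by rewrite z; ring.
have Npos : 0 < dot m'' m'' by lra.
have [C2 [C20 hC2]] := span_pairing m'l.
exists (C + (1 + C2) * norm1 m'' / dot m'' m''); split.
  have : 0 <= (1 + C2) * norm1 m'' / dot m'' m''; last lra.
  by apply: Rdiv_le_0_compat => //; apply: Rmult_le_pos; [lra | exact: norm1_ge0].
move=> v; have [w [h1 [h2 h3]]] := IH v.
pose x := dot m'' v / dot m'' m''.
exists (fun j => w j + x * m'' j).
have o2 : ortho l (fun j => v j - (w j + x * m'' j)).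
  by apply: ortho_ext (ortho_comb (- x) h2 m''o) => j; rewrite /m''; ring.
split; last split.
- exists x; apply: in_span_ext (in_span_comb (- x) h1 m'l) => j; rewrite /m''; ring.
- split=> //; rewrite dm (ortho_span o2 m'l).
  rewrite (@dot_ext m'' _ (fun j => (v j + (-1) * w j) + (- x) * m'' j)); last by move=> j; ring.
  by rewrite !dot_comb (dot_sym m'' w) (ortho_span m''o h1) /x; field.
apply: Rle_trans (norm1_comb _ _ _) _.
have hx : Rabs x * norm1 m'' <= (1 + C2) * norm1 m'' / dot m'' m'' * pairing (m :: l) v.
  rewrite /x Rabs_div // (Rabs_pos_eq (dot m'' m'')) //.
  have -> : (1 + C2) * norm1 m'' / dot m'' m'' * pairing (m :: l) v =
    ((1 + C2) * pairing (m :: l) v) / dot m'' m'' * norm1 m'' by field.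
  apply: Rmult_le_compat_r; first exact: norm1_ge0.
  apply: Rmult_le_compat_r; first by apply: Rlt_le; exact: Rinv_0_lt_compat.
  have -> : dot m'' v = dot m v - dot m' v by rewrite dm; ring.
  apply: Rle_trans (sub_bound (Rle_refl _) (hC2 v)) _ => /=.
  by have := Rabs_pos (dot m v); have := pairing_ge0 l v; nra.
have hw : norm1 w <= C * pairing (m :: l) v.
  by apply: Rle_trans h3 _; apply: Rmult_le_compat_l => //=; have := Rabs_pos (dot m v); lra.
by rewrite Rmult_plus_distr_r; lra.
Qed.

(** A vector of the span equals its own projection, since their difference is both in the span and
    orthogonal to it. *)
Lemma span_norm_bound l : exists C, 0 <= C /\ forall v, in_span l v -> norm1 v <= C * pairing l v.
Proof.
have [C [C0 hC]] := projection l; exists C; split=> // v vl.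
have [w [wl [wo wb]]] := hC v.
suff vw j : v j = w j by rewrite /norm1 (rsum_ext (H := fun j => Rabs (w j))) // => j; rewrite vw.
have z : in_span l (fun j => v j - w j).
  by apply: in_span_ext (in_span_comb (-1) vl wl) => k; ring.
have := dot_self_eq0 (ortho_span wo z) j; lra.
Qed.

End Span.

(** The form in which convexity is used: an increment of I in the span of the active [nn i] that
    hardly changes their frequencies is itself small. The constant depends on the finitely many
    vectors only, and summing over all subsets makes it independent of [S]. *)
Lemma set_span_bound (d : nat) (T : finType) (nn : T -> 'I_d -> R) :
  exists C, 0 <= C /\ forall (S : {set T}) (x : T -> R) (v : 'I_d -> R) (e : R),
    (forall i, i \notin S -> x i = 0) -> (forall j, v j = rsum (fun i => nn i j * x i)) ->
    0 <= e -> (forall i, i \in S -> Rabs (dot (nn i) v) <= e) -> norm1 v <= C * e.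
Proof.
have all_S (S : {set T}) : exists C, 0 <= C /\ forall (x : T -> R) (v : 'I_d -> R) (e : R),
    (forall i, i \notin S -> x i = 0) -> (forall j, v j = rsum (fun i => nn i j * x i)) ->
    0 <= e -> (forall i, i \in S -> Rabs (dot (nn i) v) <= e) -> norm1 v <= C * e.
  have [C [C0 hC]] := span_norm_bound [seq nn i | i <- enum S].
  exists (C * INR (size (enum S))); split; first by apply: Rmult_le_pos => //; exact: pos_INR.
  move=> x v e x0 vE e0 ve.
  have vS : in_span [seq nn i | i <- enum S] v.
    have vE' j : v j = \big[Rplus/0]_(i <- enum S) (nn i j * x i).
      rewrite vE /rsum (bigID (mem S)) /= [X in _ + X]big1 => [|i iS]; last by rewrite x0 // Rmult_0_r.
      by rewrite Rplus_0_r big_enum.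
    elim: (enum S) v {vE ve} vE' => [|i s IH] v vE' /=; first by move=> j; rewrite vE' big_nil.
    by exists (x i); apply: IH => j; rewrite vE' big_cons; ring.
  apply: Rle_trans (hC v vS) _; rewrite Rmult_assoc; apply: Rmult_le_compat_l => //.
  have {ve} ve i : i \in enum S -> Rabs (dot (nn i) v) <= e by rewrite mem_enum; exact: ve.
  elim: (enum S) ve => [|i s IH] ve; first by rewrite /= Rmult_0_l; lra.
  rewrite [size _]/= S_INR /=.
  have := ve i (mem_head _ _); have := IH (fun k ks => ve k (mem_behead (s := i :: s) ks)); lra.
have [C hC] := fin_all_exists all_S.
exists (rsum C); split; first by apply: rsum_ge0 => S; exact: (proj1 (hC S)).
move=> S x v e x0 vE e0 ve; apply: Rle_trans (proj2 (hC S) x v e x0 vE e0 ve) _.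
by apply: Rmult_le_compat_r => //; apply: rsum_term => S'; exact: (proj1 (hC S')).
Qed.

(** * Motion near the separatrix *)

Lemma derive_le0 (f df : R -> R) a b : a <= b ->
  (forall t, a <= t <= b -> is_derive f t (df t)) ->
  (forall t, a <= t <= b -> df t <= 0) -> f b <= f a.
Proof.
move=> ab hf hdf.
have [c [hc e]] : exists c, Rmin a b <= c <= Rmax a b /\ f b - f a = df c * (b - a).
  apply: MVT_gen => x; rewrite Rmin_left ?Rmax_right // => hx; first by apply: hf; lra.
  by apply/continuity_pt_filterlim; apply: continuous_is_derive (hf x _); lra.
rewrite Rmin_left // Rmax_right // in hc.
by have := hdf c hc; nra.
Qed.

Lemma derive_compare (f df h dh : R -> R) a b : a <= b ->
  (forall t, a <= t <= b -> is_derive f t (df t)) ->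
  (forall t, a <= t <= b -> is_derive h t (dh t)) ->
  (forall t, a <= t <= b -> Rabs (df t) <= dh t) -> Rabs (f b - f a) <= h b - h a.
Proof.
move=> ab hf hh le.
have k1 : f b - h b <= f a - h a.
  apply: (@derive_le0 (fun t => f t - h t) (fun t => df t - dh t)) => // t ht.
    exact: is_derive_minus (hf t ht) (hh t ht).
  by have /Rabs_le_between := le t ht; lra.
have k2 : - f b - h b <= - f a - h a.
  apply: (@derive_le0 (fun t => - f t - h t) (fun t => - df t - dh t)) => // t ht.
    exact: is_derive_minus (is_derive_opp _ _ _ (hf t ht)) (hh t ht).
  by have /Rabs_le_between := le t ht; lra.
by apply/Rabs_le_between; lra.
Qed.

(** Stated in both directions of time, as the passage near the saddle may occur anywhere in a
    window. *)
Lemma gronwall (N dN : R -> R) a b c : a <= b ->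
  (forall t, a <= t <= b -> is_derive N t (dN t)) ->
  (forall t, a <= t <= b -> Rabs (dN t) <= c * N t) ->
  N b <= N a * exp (c * (b - a)) /\ N a <= N b * exp (c * (b - a)).
Proof.
move=> ab hN le.
have dexp (s t : R) : is_derive (fun x => exp (s * x)) t (s * exp (s * t)).
  by auto_derive => //; ring.
have dprod (s t : R) : a <= t <= b ->
    is_derive (fun x => N x * exp (s * x)) t (dN t * exp (s * t) + N t * (s * exp (s * t))).
  move=> ht; apply: (is_derive_mult N _ t _ _ (hN t ht) (dexp s t)); exact: Rmult_comm.
have k1 : N b * exp (- c * b) <= N a * exp (- c * a).
  apply: derive_le0 ab (dprod (- c)) _ => t ht.
  have := exp_pos (- c * t); have /Rabs_le_between := le t ht; nra.
have k2 : - (N b * exp (c * b)) <= - (N a * exp (c * a)).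
  apply: (@derive_le0 (fun x => - (N x * exp (c * x))) (fun t => - (dN t * exp (c * t) + N t * (c * exp (c * t))))) => // t ht.
    exact: is_derive_opp (dprod c t ht).
  have := exp_pos (c * t); have /Rabs_le_between := le t ht; nra.
have eb := exp_pos (c * b); have ea := exp_pos (c * a).
split.
  apply: (Rmult_le_reg_r (exp (- c * b))); first exact: exp_pos.
  rewrite Rmult_assoc -exp_plus.
  by have -> : c * (b - a) + - c * b = - c * a by ring.
apply: (Rmult_le_reg_r (exp (c * a))) => //.
rewrite Rmult_assoc -exp_plus.
have -> : c * (b - a) + c * a = c * b by ring.
lra.
Qed.

(** A larger variation of [q] would contain a multiple of 2 PI, at which the sine of the half angle
    vanishes. *)
Lemma no_turn (q : R -> R) a b : a <= b -> (forall t, a <= t <= b -> continuous q t) ->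
  (forall t, a <= t <= b -> sin (q t / 2) <> 0) -> Rabs (q b - q a) <= 2 * PI.
Proof.
move=> ab cq nz; have P0 := PI_RGT_0; apply: Rnot_lt_le => big.
have [h1 h2] := archimed (Rmin (q a) (q b) / (2 * PI)).
set m := up _ in h1 h2.
have e : Rmin (q a) (q b) = Rmin (q a) (q b) / (2 * PI) * (2 * PI) by field; lra.
have mM : Rmax (q a) (q b) - Rmin (q a) (q b) = Rabs (q b - q a).
  case: (Rle_lt_dec (q a) (q b)) => h.
    by rewrite Rmax_right // Rmin_left // Rabs_pos_eq; lra.
  by rewrite Rmax_left ?Rmin_right ?Rabs_left; lra.
have [t [ht qt]] := ivt ab cq (y := IZR m * (2 * PI)) ltac:(nra).
apply: (nz t ht); rewrite qt; apply: sin_eq_0_1; exists m; field.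
Qed.

Lemma window_sum (f : R -> R) a b tau C : 0 < tau -> 0 <= C ->
  (forall s t, a <= s -> s <= t -> t <= b -> t - s <= tau -> Rabs (f t - f s) <= C) ->
  forall s t, a <= s -> s <= t -> t <= b -> Rabs (f t - f s) <= C * ((t - s) / tau + 1).
Proof.
move=> tau0 C0 h.
have key n s t : a <= s -> s <= t -> t <= b -> t - s <= INR n * tau -> Rabs (f t - f s) <= C * INR n.
  elim: n s => [|n IH] s as_ st tb.
    rewrite Rmult_0_l => ts; have -> : t = s by lra.
    by rewrite Rminus_diag Rabs_R0 Rmult_0_r; lra.
  rewrite S_INR => ts.
  have n0 := pos_INR n.
  case: (Rle_lt_dec (t - s) tau) => tt.
    by apply: Rle_trans (h s t as_ st tb tt) _; nra.
  have -> : f t - f s = (f t - f (s + tau)) + (f (s + tau) - f s) by ring.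
  have -> : C * (INR n + 1) = C * INR n + C by ring.
  by apply: add_bound; [apply: IH; lra | apply: h; lra].
move=> s t as_ st tb.
have x0 : 0 <= (t - s) / tau by apply: Rdiv_le_0_compat; lra.
have [n [n1 n2]] := nfloor_ex _ x0.
apply: Rle_trans (key n.+1 s t as_ st tb _) _.
  rewrite S_INR; have -> : t - s = (t - s) / tau * tau by field; lra.
  by apply: Rmult_le_compat_r; lra.
by apply: Rmult_le_compat_l => //; rewrite S_INR; lra.
Qed.

Lemma ln_le_id x : 0 < x -> ln x <= x.
Proof. by move=> x0; have := exp_ineq1_le (ln x); rewrite exp_ln //; lra. Qed.

(** * Drift of a harmonic close to the separatrix *)

Section NearOrbit.
Variables (d : nat) (T : finType) (nn : T -> 'I_d -> R) (ll : T -> R) (K mu a b g : R).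
Variables (I : R -> 'I_d -> R) (p q : R -> R) (th c acc : T -> R -> R) (f : R -> R).
Variables (F1 F2 : T -> R -> R -> R -> R).
Hypothesis O : orbit nn ll K mu a b I p q th c acc f F1 F2.
Hypothesis g10 : 10 <= g.
Hypothesis KG : 10 * K ^ 6 <= g ^ 4.
Hypothesis mug : mu * g ^ 40 <= 1.
Hypothesis near : forall t, a <= t <= b -> Rabs (energy (p t) (q t)) <= 4 / g ^ 4.

Let u i t := frequency nn ll (I t) i.
Let z t := 2 * sin (q t / 2).
(** Chosen so that [exp (3 * tau) = g ^ 2]: what is of order [g ^ (-4)] at one time of a window is
    of order [g ^ (-2)] throughout it. *)
Let tau := ln g * (2 / 3).

Let mu0 : 0 <= mu.
Proof. exact: o_mu O. Qed.

Let K2 : 2 <= K.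
Proof. exact: o_K O. Qed.

Let Kg : 10 * K <= g ^ 4.
Proof. exact: KG1 O KG. Qed.

Lemma mu_g_small k : (k <= 39)%coq_nat -> mu * g ^ k <= / g.
Proof.
move=> hk; apply: (Rmult_le_reg_r g); first lra.
rewrite Rinv_l; last lra.
have -> : mu * g ^ k * g = mu * g ^ k.+1 by rewrite -tech_pow_Rmult; ring.
by apply: Rle_trans mug; apply: Rmult_le_compat_l => //; apply: (pow_G_le g10); lia.
Qed.

Lemma inv_g : 0 < / g <= / 10.
Proof. by split; [apply: Rinv_0_lt_compat; lra | apply: Rinv_le_contravar; lra]. Qed.

Lemma tau_bounds : 0 < tau <= g.
Proof.
rewrite /tau; have h1 := ln_le_id (x := g) ltac:(lra).
have : 0 < ln g by rewrite -ln_1; apply: ln_increasing; lra.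
by lra.
Qed.

Lemma energy_z t : energy (p t) (q t) = (p t ^ 2 - z t ^ 2) / 2.
Proof. by rewrite /energy cos_double /z; field. Qed.

Lemma z_bound t : Rabs (z t) <= 2.
Proof. by rewrite /z Rabs_mult (Rabs_pos_eq 2); have := abs_sin_le (q t / 2); lra. Qed.

Section Window.
Variables (t1 t2 : R).
Hypotheses (at1 : a <= t1) (t12 : t1 <= t2) (t2b : t2 <= b) (short : t2 - t1 <= tau).

Let sub t : t1 <= t <= t2 -> a <= t <= b.
Proof. lra. Qed.

(** As the energy is [(p ^ 2 - z ^ 2) / 2] and small, the vanishing of one of [p], [z] makes the
    other one small too: the orbit is at the saddle, and the window is too short to leave it. The
    constant [/ g ^ 4] added to [N] absorbs the perturbation; it raises the growth rate from 2 to
    3. *)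
Lemma saddle_window ts : t1 <= ts <= t2 -> p ts = 0 \/ z ts = 0 ->
  forall t, t1 <= t <= t2 -> Rabs (p t) + Rabs (z t) <= 5 / g.
Proof.
move=> hts pz t ht.
have gi := inv_g; have g4 := pow_G_gt0 g10 4.
have gi4 : 0 < / g ^ 4 by exact: Rinv_0_lt_compat.
have [dq hq] := choose_derivative (fun t ht => o_q O ht).
have [dp hp] := choose_derivative (fun t ht => o_p O ht).
pose N t := p t ^ 2 + z t ^ 2 + / g ^ 4.
pose dN t := 2 * p t * dp t + 2 * z t * (cos (q t / 2) * dq t).
have hN s : a <= s <= b -> is_derive N s (dN s) /\ Rabs (dN s) <= 3 * N s.
  move=> hs; have [q1 q2] := hq s hs; have [p1 p2] := hp s hs; split.
    have dsq (h : R -> R) (l : R) : is_derive h s l -> is_derive (fun x => h x ^ 2) s (2 * h s * l).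
      by move=> hh; auto_derive; [exists l | rewrite (is_derive_unique _ _ _ hh); ring].
    have dz : is_derive z s (cos (q s / 2) * dq s).
      have -> : cos (q s / 2) * dq s = 2 * (cos (q s / 2) * dq s / 2) by field.
      exact: is_derive_scal (is_derive_sin_half q1).
    have -> : dN s = dN s + 0 by ring.
    apply: (is_derive_plus (fun x => p x ^ 2 + z x ^ 2) (fun=> / g ^ 4)); last exact: is_derive_const.
    exact: is_derive_plus (dsq _ _ p1) (dsq _ _ dz).
  have -> : dN s = 4 * (cos (q s / 2) * (p s * z s)) + 2 * (p s * (dp s - sin (q s))) +
      2 * (z s * (cos (q s / 2) * (dq s - p s))).
    by rewrite /dN (sin_double (q s)) /z; ring.
  have b1 : Rabs (4 * (cos (q s / 2) * (p s * z s))) <= 2 * (p s ^ 2 + z s ^ 2).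
    rewrite Rabs_mult (Rabs_pos_eq 4); last lra.
    have := mul_bound (abs_cos_le (q s / 2)) (Rle_refl (Rabs (p s * z s))).
    rewrite (Rabs_mult (p s)) -(pow2_abs (p s)) -(pow2_abs (z s)).
    by have := pow2_ge_0 (Rabs (p s) - Rabs (z s)); lra.
  have b2 := mul_bound (p_bound O hs) p2.
  have b3 := mul_bound (z_bound s) (mul_bound (abs_cos_le (q s / 2)) q2).
  have two x C : Rabs x <= C -> Rabs (2 * x) <= 2 * C by move=> ?; rewrite Rabs_mult (Rabs_pos_eq 2); lra.
  apply: Rle_trans (add_bound (add_bound b1 (two _ _ b2)) (two _ _ b3)) _.
  have small : 2 * (K * (K * mu)) + 2 * (2 * (1 * (K * mu))) <= 3 * / g ^ 4.
    have m12 : mu * g ^ 12 <= / 10 by have := @mu_g_small 12 ltac:(lia); lra.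
    have m12' : mu * g ^ 8 <= / 10 * / g ^ 4.
      apply: (Rmult_le_reg_r (g ^ 4)) => //; rewrite Rmult_assoc (Rmult_assoc (/ 10)) Rinv_l ?Rmult_1_r; last lra.
      by rewrite -pow_add.
    have kk : K * K <= g ^ 8.
      have -> : g ^ 8 = g ^ 4 * g ^ 4 by ring.
      by apply: Rmult_le_compat; lra.
    have kk2 : 2 * K <= K * K by nra.
    have k1 := Rmult_le_compat_l _ _ _ mu0 kk; have k2 := Rmult_le_compat_l _ _ _ mu0 kk2.
    lra.
  have := pow2_ge_0 (p s); have := pow2_ge_0 (z s); rewrite /N; lra.
have etau : exp (3 * tau) = g ^ 2.
  rewrite /tau; have -> : 3 * (ln g * (2 / 3)) = ln g + ln g by field.
  by rewrite exp_plus exp_ln; [ring | lra].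
have Nts : N ts <= 9 / g ^ 4.
  have := near (sub hts); rewrite energy_z /N => /Rabs_le_between.
  by case: pz => ->; lra.
have Nt : N t <= N ts * g ^ 2.
  have N0 : 0 <= N ts by rewrite /N; have := pow2_ge_0 (p ts); have := pow2_ge_0 (z ts); lra.
  have ex r : r <= tau -> N ts * exp (3 * r) <= N ts * g ^ 2.
    move=> hr; apply: Rmult_le_compat_l => //; rewrite -etau.
    case: (Rle_lt_or_eq_dec _ _ hr) => [hr'|->]; last lra.
    by apply: Rlt_le; apply: exp_increasing; lra.
  case: (Rle_lt_dec ts t) => tts.
    have [k _] := @gronwall N dN ts t 3 tts (fun s hs => proj1 (hN s ltac:(lra))) (fun s hs => proj2 (hN s ltac:(lra))).
    by apply: Rle_trans k _; apply: ex; lra.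
  have [_ k] := @gronwall N dN t ts 3 ltac:(lra) (fun s hs => proj1 (hN s ltac:(lra))) (fun s hs => proj2 (hN s ltac:(lra))).
  by apply: Rle_trans k _; apply: ex; lra.
have Nb : N t <= 9 / g ^ 2.
  apply: Rle_trans Nt _.
  have -> : 9 / g ^ 2 = 9 / g ^ 4 * g ^ 2 by field; lra.
  by apply: Rmult_le_compat_r => //; exact: pow2_ge_0.
rewrite -(Rabs_pos_eq (Rabs (p t) + Rabs (z t))); last by have := Rabs_pos (p t); have := Rabs_pos (z t); lra.
apply: abs_le_sqr; first by apply: Rdiv_le_0_compat; lra.
have -> : (5 / g) ^ 2 = 25 / g ^ 2 by field; lra.
have := pow2_ge_0 (Rabs (p t) - Rabs (z t)); have := pow2_abs (p t); have := pow2_abs (z t).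
have : 0 <= / g ^ 2 by apply: Rlt_le; apply: Rinv_0_lt_compat; apply: pow_lt; lra.
by rewrite /N in Nb; lra.
Qed.

(* Over a window shorter than a fraction of ln g the orbit makes at most one
   excursion, so that the integral of |p| + |z| stays bounded. *)
Lemma window_integral (X dX : R -> R) :
  (forall t, t1 <= t <= t2 -> is_derive X t (dX t)) ->
  (forall t, t1 <= t <= t2 -> Rabs (dX t) <= mu * (2 * K * (Rabs (p t) + Rabs (z t)) + / g)) ->
  Rabs (X t2 - X t1) <= mu * (40 * K + 1).
Proof.
move=> hX bX; have gi := inv_g; have [tau0 taug] := tau_bounds.
have g4 := pow_G_gt0 g10 4.
(* If [p] or [z] vanishes in the window, then [|p| + |z|] is at most [5 / g] on it, while its length
   is at most [g]. *)
case: (classic (exists ts, t1 <= ts <= t2 /\ (p ts = 0 \/ z ts = 0))) => [[ts [hts pz]]|no].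
  have sm := saddle_window hts pz.
  have : Rabs (X t2 - X t1) <= (mu * (2 * K * (5 / g) + / g)) * (t2 - t1).
    apply: derive_bound t12 hX _ => t ht; apply: Rle_trans (bX t ht) _.
    apply: Rmult_le_compat_l => //; apply: Rplus_le_compat_r.
    by apply: Rmult_le_compat_l; [lra | exact: sm].
  move=> h; apply: Rle_trans h _; rewrite Rmult_assoc; apply: Rmult_le_compat_l => //.
  apply: Rle_trans (_ : (10 * K + 1) * / g * g <= _).
    have -> : 2 * K * (5 / g) + / g = (10 * K + 1) * / g by field; lra.
    by apply: Rmult_le_compat_l; [apply: Rmult_le_pos; lra | lra].
  by rewrite Rmult_assoc Rinv_l; lra.
(* Otherwise [p] has a constant sign and [q] crosses no multiple of 2 PI: the integral of |p| is the
   variation of [q], up to a term O(mu). *)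
have pn0 t : t1 <= t <= t2 -> p t <> 0 by move=> ht e; apply: no; exists t; split=> //; left.
have zn0 t : t1 <= t <= t2 -> sin (q t / 2) <> 0.
  by move=> ht e; apply: no; exists t; split=> //; right; rewrite /z e; ring.
have turn := no_turn t12 (fun t ht => continuous_q O (sub ht)) zn0.
have [dq hq] := choose_derivative (fun t ht => o_q O ht).
have [s [s1 sp]] : exists s, Rabs s <= 1 /\ forall t, t1 <= t <= t2 -> Rabs (p t) = s * p t.
  case: (constant_sign (fun t ht => continuous_p O (sub ht)) pn0) => sg.
    by exists 1; split=> [|t ht]; [rewrite Rabs_R1; lra | have := sg t ht => ?; rewrite Rabs_pos_eq; lra].
  by exists (-1); split=> [|t ht]; [rewrite Rabs_left; lra | have := sg t ht => ?; rewrite Rabs_left; lra].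
(* The three errors: [dq] against [p], [|z|] against [|p|] (which differ by [3 / g ^ 2] at most, as
   the energy is small), and the term [/ g] of the hypothesis. Over a length at most [g] they stay
   bounded. *)
pose r := 4 * K * (K * mu) + 6 * K / g ^ 2 + / g.
have := @derive_compare X dX (fun t => mu * (4 * K * s * q t + r * t)) (fun t => mu * (4 * K * s * dq t + r))
  t1 t2 t12 hX.
have dh t : t1 <= t <= t2 -> is_derive (fun t => mu * (4 * K * s * q t + r * t)) t (mu * (4 * K * s * dq t + r)).
  move=> ht; have [q1 _] := hq t (sub ht).
  by auto_derive; [exists (dq t) | rewrite (is_derive_unique _ _ _ q1); ring].
have g2 := pow_G_gt0 g10 2; have gi2 : 0 < / g ^ 2 by exact: Rinv_0_lt_compat.
have le t : t1 <= t <= t2 -> Rabs (dX t) <= mu * (4 * K * s * dq t + r).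
  move=> ht; apply: Rle_trans (bX t ht) _; apply: Rmult_le_compat_l => //.
  have [_ q2] := hq t (sub ht).
  have zp : Rabs (z t) <= Rabs (p t) + 3 / g ^ 2.
    apply: abs_le_sqr; first by have := Rabs_pos (p t); rewrite /Rdiv; lra.
    have := near (sub ht); rewrite energy_z => /Rabs_le_between.
    have -> : (Rabs (p t) + 3 / g ^ 2) ^ 2 = Rabs (p t) ^ 2 + 6 * (Rabs (p t) * / g ^ 2) + 9 / g ^ 4 by field; lra.
    rewrite pow2_abs; have := Rmult_le_pos _ _ (Rabs_pos (p t)) (Rlt_le _ _ gi2).
    by have : 0 < / g ^ 4 by [exact: Rinv_0_lt_compat]; lra.
  have sq : s * p t <= s * dq t + K * mu.
    have h := mul_bound s1 q2; have := Rle_abs (- (s * (dq t - p t))); rewrite Rabs_Ropp; lra.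
  have e1 : 2 * K * (Rabs (p t) + Rabs (z t)) <= 2 * K * (2 * (s * p t) + 3 / g ^ 2).
    by apply: Rmult_le_compat_l; [lra | rewrite -sp //; lra].
  have e2 := Rmult_le_compat_l (4 * K) _ _ ltac:(lra) sq.
  rewrite /r; have -> : 6 * K / g ^ 2 = 2 * K * (3 / g ^ 2) by field; lra.
  lra.
move=> /(_ dh le) h; apply: Rle_trans h _.
have -> : mu * (4 * K * s * q t2 + r * t2) - mu * (4 * K * s * q t1 + r * t1) =
  mu * (4 * K * (s * (q t2 - q t1)) + r * (t2 - t1)) by ring.
apply: Rmult_le_compat_l => //.
have P4 := PI_4.
have h1 : s * (q t2 - q t1) <= 8.
  by apply: Rle_trans (Rle_abs _) _; have := mul_bound s1 turn; lra.
have r0 : 0 <= r.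
  rewrite /r; have : 0 <= 4 * K * (K * mu) by apply: Rmult_le_pos; [lra | apply: Rmult_le_pos; lra].
  have : 0 <= 6 * K / g ^ 2 by apply: Rdiv_le_0_compat; lra.
  lra.
have h2 : r * (t2 - t1) <= 2 + K.
  apply: Rle_trans (_ : r * g <= _); first by apply: Rmult_le_compat_l => //; lra.
  have -> : r * g = 4 * (K * K * (mu * g)) + 6 * K * / g + 1 by rewrite /r; field; lra.
  have k1 : K * K * (mu * g) <= / 10.
    have m9 := @mu_g_small 9 ltac:(lia).
    apply: Rle_trans (_ : g ^ 8 * (mu * g) <= _).
      apply: Rmult_le_compat_r; first by apply: Rmult_le_pos; lra.
      have -> : g ^ 8 = g ^ 4 * g ^ 4 by ring.
      by apply: Rmult_le_compat; lra.
    by have -> : g ^ 8 * (mu * g) = mu * g ^ 9 by [ring]; lra.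
  have k2 : 6 * K * / g <= 6 * K * / 10 by apply: Rmult_le_compat_l; lra.
  lra.
have := Rmult_le_compat_l (4 * K) _ _ ltac:(lra) h1.
lra.
Qed.

(** The harmonic is compared with its value at the saddle [p = q = 0], its frequency being frozen at
    [t1]. This comparison term has the explicit primitive [Psi], bounded by [2 * K / eta]; the
    remainder is O(|p| + |z|) and [window_integral] applies. No corrector with a period in it is
    needed. *)
Lemma window_drift i eta : 0 < eta <= 1 -> (forall t, t1 <= t <= t2 -> eta <= Rabs (u i t)) ->
  Rabs (acc i t2 - acc i t1) <= mu * (50 * K / eta).
Proof.
move=> [eta0 eta1] nonres; have gi := inv_g; have [tau0 taug] := tau_bounds.
have g4 := pow_G_gt0 g10 4.
have h1 : a <= t1 <= b by lra.
have u1 : eta <= Rabs (u i t1) by apply: nonres; lra.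
have u1n0 : u i t1 <> 0 by move=> e; move: u1; rewrite e Rabs_R0; lra.
pose A1 := F1 i t1 0 0; pose A2 := F2 i t1 0 0.
have z0 : Rabs 0 <= K by rewrite Rabs_R0; lra.
have A1b : Rabs A1 <= K by exact: (o_F1b O).
have A2b : Rabs A2 <= K by exact: (o_F2b O).
pose ph t := th i t1 + u i t1 * (t - t1).
pose Psi t := (- A1 * cos (ph t) + A2 * sin (ph t)) / u i t1.
have dPsi t : is_derive Psi t (A1 * sin (ph t) + A2 * cos (ph t)).
  by rewrite /Psi /ph; auto_derive => //; rewrite /Rminus; field.
have [du hu] := choose_derivative (is_derive_frequency O KG i).
have [dth hth] := choose_derivative (fun t ht => o_th O i ht).
have ud t : t1 <= t <= t2 -> Rabs (u i t - u i t1) <= mu * g ^ 5.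
  move=> ht; have : Rabs (u i t - u i t1) <= g ^ 4 * mu * (t - t1).
    by apply: (@derive_bound _ du) => [|s hs|s hs]; [lra | |]; have [] := hu s ltac:(lra).
  move=> h; apply: Rle_trans h _.
  have -> : mu * g ^ 5 = g ^ 4 * mu * g by ring.
  by apply: Rmult_le_compat_l; [apply: Rmult_le_pos; lra | lra].
have phd t : t1 <= t <= t2 -> Rabs (th i t - ph t) <= mu * g ^ 7.
  move=> ht.
  have : Rabs ((th i t - ph t) - (th i t1 - ph t1)) <= (mu * g ^ 6) * (t - t1).
    apply: (@derive_bound (fun t => th i t - ph t) (fun t => dth t - u i t1)); first lra.
      move=> s hs; have [k _] := hth s ltac:(lra).
      apply: is_derive_minus k _; rewrite /ph; auto_derive => //; ring.
    move=> s hs; have [_ k] := hth s ltac:(lra).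
    have -> : dth s - u i t1 = (dth s - u i s) + (u i s - u i t1) by ring.
    apply: Rle_trans (add_bound k (ud s ltac:(lra))) _.
    have -> : K * mu + mu * g ^ 5 = mu * (K + g ^ 5) by ring.
    apply: Rmult_le_compat_l => //; have := pow_G_10 g10 5; have := pow_G_10 g10 4; lra.
  have -> : th i t - ph t - (th i t1 - ph t1) = th i t - ph t by rewrite /ph; ring.
  move=> h; apply: Rle_trans h _.
  have -> : mu * g ^ 7 = mu * g ^ 6 * g by ring.
  by apply: Rmult_le_compat_l; [apply: Rmult_le_pos; [lra | apply: Rlt_le; exact: pow_G_gt0] | lra].
have K4 : K <= g ^ 4 by lra.
have one (F : R -> R -> R -> R) (h : R -> R) t :
    (forall t t' y y' x x', a <= t <= b -> a <= t' <= b -> Rabs y <= K -> Rabs y' <= K ->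
    Rabs (F t y x - F t' y' x') <= K * (mu * Rabs (t - t') + Rabs (y - y') +
      Rabs (cos (x / 2) - cos (x' / 2)) + Rabs (sin (x / 2) - sin (x' / 2)))) ->
    (forall t y x, a <= t <= b -> Rabs y <= K -> Rabs (F t y x - F t y 0) <= K * Rabs (sin (x / 2))) ->
    (forall t y x, a <= t <= b -> Rabs y <= K -> Rabs (F t y x) <= K) ->
    (forall x, Rabs (h x) <= 1) -> (forall x y, Rabs (h x - h y) <= Rabs (x - y)) -> t1 <= t <= t2 ->
    Rabs (F t (p t) (q t) * h (th i t) - F t1 0 0 * h (ph t)) <= K * (Rabs (p t) + Rabs (z t)) + mu * g ^ 12.
  move=> lF sF bF h1' hl ht; have pb := p_bound O (sub ht).
  have F01 : Rabs (F t (p t) (q t) - F t1 0 0) <= K * (Rabs (p t) + Rabs (z t)) + mu * g ^ 5.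
    have -> : F t (p t) (q t) - F t1 0 0 = (F t (p t) (q t) - F t (p t) 0) + (F t (p t) 0 - F t1 0 0) by ring.
    apply: Rle_trans (add_bound (sF _ _ _ (sub ht) pb) (lF _ _ _ _ _ _ (sub ht) h1 pb z0)) _.
    rewrite !Rminus_diag Rabs_R0 Rminus_0_r !Rplus_0_r (Rabs_pos_eq (t - t1)); last lra.
    have zz : Rabs (sin (q t / 2)) <= Rabs (z t).
      by rewrite /z Rabs_mult (Rabs_pos_eq 2); have := Rabs_pos (sin (q t / 2)); lra.
    have e1 := Rmult_le_compat_l K _ _ ltac:(lra) zz.
    have e2 : K * (mu * (t - t1)) <= mu * g ^ 5.
      have -> : mu * g ^ 5 = g ^ 4 * (mu * g) by ring.
      by apply: Rmult_le_compat; try lra; [apply: Rmult_le_pos; lra | apply: Rmult_le_compat_l; lra].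
    lra.
  apply: Rle_trans (mul_diff_bound (bF _ _ _ (sub ht) pb) (h1' (ph t)) F01 (Rle_trans _ _ _ (hl _ _) (phd t ht))) _.
  have e3 : K * (mu * g ^ 7) <= mu * g ^ 11.
    have -> : mu * g ^ 11 = g ^ 4 * (mu * g ^ 7) by ring.
    by apply: Rmult_le_compat_r => //; apply: Rmult_le_pos; [lra | apply: Rlt_le; exact: pow_G_gt0].
  have e4 : mu * g ^ 5 + mu * g ^ 11 <= mu * g ^ 12.
    rewrite -Rmult_plus_distr_l; apply: Rmult_le_compat_l => //.
    have := pow_G_10 g10 11; have := pow_G_le g10 (m := 5) (n := 11) ltac:(lia); have := pow_G_gt0 g10 11; lra.
  lra.
have win := @window_integral (fun t => acc i t - mu * Psi t)
  (fun t => mu * c i t - mu * (A1 * sin (ph t) + A2 * cos (ph t))).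
have dd t : t1 <= t <= t2 -> is_derive (fun t => acc i t - mu * Psi t) t
    (mu * c i t - mu * (A1 * sin (ph t) + A2 * cos (ph t))).
  by move=> ht; apply: is_derive_minus (o_acc O i (sub ht)) (is_derive_scal _ _ _ _ (dPsi t)).
have muR : Rabs mu <= mu by rewrite Rabs_pos_eq; lra.
have bb t : t1 <= t <= t2 -> Rabs (mu * c i t - mu * (A1 * sin (ph t) + A2 * cos (ph t))) <=
    mu * (2 * K * (Rabs (p t) + Rabs (z t)) + / g).
  move=> ht; rewrite -Rmult_minus_distr_l; apply: mul_bound => //.
  rewrite (o_c O); last exact: sub.
  have k1 := one (F1 i) sin t (o_F1l O i) (o_F1s O i) (o_F1b O i) abs_sin_le sin_lip ht.
  have k2 := one (F2 i) cos t (o_F2l O i) (o_F2s O i) (o_F2b O i) abs_cos_le cos_lip ht.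
  apply: Rle_trans (add_diff_bound k1 k2) _.
  have m12 : 2 * (mu * g ^ 12) <= / g.
    apply: Rle_trans (@mu_g_small 13 ltac:(lia)).
    have -> : mu * g ^ 13 = g * (mu * g ^ 12) by ring.
    by apply: Rmult_le_compat_r; [apply: Rmult_le_pos; [lra | apply: Rlt_le; exact: pow_G_gt0] | lra].
  lra.
have := win dd bb; rewrite /= => w.
have Pb t : Rabs (Psi t) <= 2 * K / eta.
  rewrite /Psi Rabs_div //; apply: Rmult_le_compat; first exact: Rabs_pos.
  - by apply: Rlt_le; apply: Rinv_0_lt_compat; lra.
  - have -> : 2 * K = K * 1 + K * 1 by ring.
    by apply: add_bound; apply: mul_bound; rewrite ?Rabs_Ropp //; [exact: abs_cos_le | exact: abs_sin_le].
  - exact: Rinv_le_contravar.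
have -> : acc i t2 - acc i t1 = (acc i t2 - mu * Psi t2 - (acc i t1 - mu * Psi t1)) +
   mu * (Psi t2 - Psi t1) by ring.
apply: Rle_trans (add_bound w (mul_bound muR (sub_bound (Pb t2) (Pb t1)))) _.
rewrite -Rmult_plus_distr_l; apply: Rmult_le_compat_l => //.
have ie : 1 <= / eta by rewrite -Rinv_1; exact: Rinv_le_contravar.
rewrite /Rdiv; nra.
Qed.

End Window.

Lemma near_drift i t1 t2 eta : a <= t1 -> t1 <= t2 -> t2 <= b -> 0 < eta <= 1 ->
  (forall t, t1 <= t <= t2 -> eta <= Rabs (u i t)) ->
  Rabs (acc i t2 - acc i t1) <= mu * (50 * K / eta) * ((b - a) / tau + 1).
Proof.
move=> h1 h12 h2 he nonres; have [tau0 _] := tau_bounds.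
have C0 : 0 <= mu * (50 * K / eta).
  by apply: Rmult_le_pos => //; apply: Rdiv_le_0_compat; lra.
apply: Rle_trans (window_sum (a := t1) (b := t2) tau0 C0 _ _ h12 _) _; try lra.
  move=> s t hs st tt short; apply: window_drift => //; try lra.
  by move=> x hx; apply: nonres; lra.
apply: Rmult_le_compat_l => //; apply: Rplus_le_compat_r.
by apply: Rmult_le_compat_r; [apply: Rlt_le; exact: Rinv_0_lt_compat | lra].
Qed.

End NearOrbit.

(** * Confinement close to the separatrix *)

Section NearConfinement.
Variables (d : nat) (T : finType) (nn : T -> 'I_d -> R) (K kappa : R).
Hypothesis K2 : 2 <= K.
Hypothesis kappa0 : 0 < kappa.

(* Near the separatrix the only relevant resonances are n . I + l = 0, and the
   drift along one of them is stopped by the convexity of |I|^2 / 2. *)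
Lemma near_stable : exists e2, 0 < e2 /\
  forall ll mu a b g I p q th c acc f F1 F2,
    orbit nn ll K mu a b I p q th c acc f F1 F2 -> a <= b -> 10 <= g -> 10 * K ^ 6 <= g ^ 4 ->
    mu * g ^ 40 <= 1 -> (forall t, a <= t <= b -> Rabs (energy (p t) (q t)) <= 4 / g ^ 4) ->
    mu * ((b - a) / (ln g * (2 / 3)) + 1) <= e2 ->
    forall s t, a <= s <= b -> a <= t <= b -> norm1 (fun j => I s j - I t j) <= kappa.
Proof.
have [C [C0 hC]] := set_span_bound nn.
have Ki : 0 < / K by apply: Rinv_0_lt_compat; lra.
(* The cap [/ K] keeps the thresholds [K * Rad k] below 1, as [near_drift] requires. *)
pose kap := Rmin kappa (/ K).
have kap0 : 0 < kap by exact: Rmin_glb_lt.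
(* Ratio of consecutive radii. It makes the contribution of the active resonances,
   [C * (4 * K * (th0 * r))], at most [r / 16]. The ratio does not depend on [mu]: near the
   separatrix the scales are fixed. *)
pose th0 := / (64 * ((C + 1) * K)).
have CK : 2 <= (C + 1) * K by nra.
have th00 : 0 < th0 by apply: Rinv_0_lt_compat; lra.
have th08 : th0 <= / 128 by apply: Rinv_le_contravar; lra.
pose n := #|T|.
pose Rad k := kap * th0 ^ (n - k).
pose r0 := kap * th0 ^ n.
have Rad0 k : 0 < Rad k by apply: Rmult_lt_0_compat => //; exact: pow_lt.
have r00 : 0 < r0 by apply: Rmult_lt_0_compat => //; exact: pow_lt.
have Rad_r0 k : r0 <= Rad k.
  apply: Rmult_le_compat_l; first lra.
  rewrite /n -{1}(subnK (leq_subr k #|T|)) -plusE pow_add -[X in _ <= X]Rmult_1_l.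
  apply: Rmult_le_compat_r; first by apply: Rlt_le; exact: pow_lt.
  by rewrite -(pow1 (#|T| - (#|T| - k))); apply: pow_incr; lra.
have Rad_kap k : Rad k <= kap.
  rewrite -[X in _ <= X]Rmult_1_r; apply: Rmult_le_compat_l; first lra.
  by rewrite -(pow1 (n - k)); apply: pow_incr; lra.
have Rad_pred k : (k < n)%N -> Rad k = th0 * Rad k.+1.
  by move=> kn; rewrite /Rad -(subnSK kn) -tech_pow_Rmult; ring.
have Rad_small k : (k < n)%N -> Rad k <= / 128 * Rad k.+1.
  by move=> kn; rewrite (Rad_pred k kn); apply: Rmult_le_compat_r => //; apply: Rlt_le.
have K40 : 0 < K ^ 4 by apply: pow_lt; lra.
(* The drift of an inactive harmonic is then at most [eps = 50 / r0 * e2], and the inactive part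
   contributes [(C + 1) * K ^ 4 * eps = r0 / 8], with [r0] a lower bound for all the radii. *)
pose e2 := r0 ^ 2 / (400 * ((C + 1) * K ^ 4)).
have e20 : 0 < e2.
  apply: Rdiv_lt_0_compat; first exact: pow_lt.
  by apply: Rmult_lt_0_compat; [lra | apply: Rmult_lt_0_compat; lra].
exists e2; split=> // ll mu a b g I p q th c acc f F1 F2 O ab g10 KG mug near small s t hs ht.
pose u i t := frequency nn ll (I t) i.
pose dist s t := norm1 (fun j => I s j - I t j).
have mu0 := o_mu O.
have ulip i x y : Rabs (u i x - u i y) <= K * dist y x.
  rewrite /u (freq_sub nn ll) /dot; apply: Rle_trans (rsum_abs _) _.
  rewrite /dist /norm1 -rsum_scal; apply: rsum_le => j.
  by apply: mul_bound; [exact: (o_nn O) | rewrite Rabs_minus_sym; lra].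
suff : dist s t <= Rad #|T| / 2.
  by have := Rad_kap #|T|; have := Rmin_l kappa (/ K); have := Rad0 #|T|; rewrite -/kap /dist; lra.
apply: (@confinement_all T a b K dist (fun i t => Rabs (u i t)) Rad (fun k => 2 * (K * Rad k))) => //.
- move=> x; rewrite /dist /norm1 (@rsum_ext _ _ (fun=> 0)) ?rsum_const; first by ring.
  by move=> j; rewrite Rminus_diag Rabs_R0.
- by move=> x y; apply: rsum_ext => j; exact: Rabs_minus_sym.
- move=> x y z; rewrite /dist /norm1 -rsum_add; apply: rsum_le => j.
  have -> : I x j - I z j = (I x j - I y j) + (I y j - I z j) by ring.
  exact: Rabs_triang.
- move=> x y _ hy; apply: (continuous_rsum (F := fun j s => Rabs (I x j - I s j))) => j.
  apply: (continuous_comp (fun s => I x j - I s j) Rabs); last exact: continuous_Rabs.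
  by apply: cont_minus; [exact: cont_cst | exact: (continuous_I O hy)].
- by move=> i x y hx hy; apply: Rle_trans (Rabs_triang_inv2 _ _) _.
- lra.
- by move=> k kn; have := Rad_small k kn; have := Rad0 k.+1; lra.
- move=> k kn; have := Rmult_le_compat_l K _ _ ltac:(lra) (Rad_small k kn).
  have := Rmult_lt_0_compat K _ ltac:(lra) (Rad0 k.+1); lra.
- by move=> k; lra.
move=> S t1 t2 h1 h12 h2 close nonres res.
set r := Rad #|S|.
have r_r0 : r0 <= r by exact: Rad_r0.
have rK : r <= / K by apply: Rle_trans (Rad_kap _) (Rmin_r _ _).
have eta01 : 0 < K * r <= 1.
  split; first by apply: Rmult_lt_0_compat; lra.
  by rewrite -(Rinv_r K); [apply: Rmult_le_compat_l; lra | lra].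
pose eps := 50 / r0 * e2.
have eps0 : 0 <= eps by apply: Rmult_le_pos; [apply: Rdiv_le_0_compat; lra | lra].
have dacc i : i \notin S -> Rabs (acc i t2 - acc i t1) <= eps.
  move=> iS; apply: Rle_trans (near_drift O g10 KG mug near (eta := K * r) h1 h12 h2 eta01 _) _.
    move=> x hx; have h : 2 * (K * r) / 2 <= Rabs (u i x) := nonres x i hx iS.
    by change (K * r <= Rabs (u i x)); lra.
  have -> : mu * (50 * K / (K * r)) * ((b - a) / (ln g * (2 / 3)) + 1) =
    50 / r * (mu * ((b - a) / (ln g * (2 / 3)) + 1)) by field; split; [have := tau_bounds g10; lra | lra].
  have lng : 0 < ln g by have := tau_bounds g10; lra.
  have pos : 0 <= mu * ((b - a) / (ln g * (2 / 3)) + 1).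
    apply: Rmult_le_pos => //; have : 0 <= (b - a) / (ln g * (2 / 3)); last lra.
    by apply: Rdiv_le_0_compat; lra.
  apply: Rmult_le_compat => //; first by apply: Rdiv_le_0_compat; lra.
  by apply: Rmult_le_compat_l; [lra | apply: Rinv_le_contravar].
have [ht1 ht2] : a <= t1 <= b /\ a <= t2 <= b by lra.
(* The increment of I is split into a vector [v] of the span of the active resonances and an error
   due to the inactive ones. *)
pose x i := if i \in S then acc i t2 - acc i t1 else 0.
pose y i := if i \in S then 0 else acc i t2 - acc i t1.
pose v j := rsum (fun i => nn i j * x i).
pose err j := rsum (fun i => nn i j * y i).
have split_I j : I t2 j - I t1 j = v j + err j.
  rewrite (dI_acc O j ht1 ht2) /v /err -rsum_add; apply: rsum_ext => i.
  by rewrite /x /y; case: (i \in S); ring.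
have dK := o_d O; have TK := o_T O.
have errb j : Rabs (err j) <= K ^ 2 * eps.
  apply: Rle_trans (rsum_bound (C := K * eps) _) _.
    move=> i; apply: mul_bound; first exact: (o_nn O).
    by rewrite /y; case: (boolP (i \in S)) => [_|iS]; [rewrite Rabs_R0 | exact: dacc].
  have -> : K ^ 2 * eps = K * (K * eps) by ring.
  by apply: Rmult_le_compat_r => //; apply: Rmult_le_pos; lra.
pose e := 4 * K * (th0 * r) + K ^ 4 * eps.
have e0 : 0 <= e.
  have : 0 <= K * (th0 * r) by apply: Rmult_le_pos; [lra | apply: Rmult_le_pos; lra].
  by have := Rmult_le_pos _ _ (Rlt_le _ _ K40) eps0; rewrite /e; lra.
have vb : norm1 v <= C * e.
  apply: (hC S x v e) => //; first by move=> i iS; rewrite /x (negbTE iS).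
  move=> i iS.
  have kS : #|S| = #|S|.-1.+1 by rewrite prednK // card_gt0; apply/set0Pn; exists i.
  have kT : (#|S|.-1 < n)%N by rewrite -kS max_card.
  (* The scalar product with [nn i] is the increment of a frequency that is close to 0 at both ends:
     the position of the resonance does not depend on the energy, so no steepness argument is needed
     here. *)
  have -> : dot (nn i) v = (u i t2 - u i t1) - dot (nn i) err.
    rewrite /u (freq_sub nn ll) /dot -rsum_sub; apply: rsum_ext => j; rewrite split_I; ring.
  have small_u z : t1 <= z <= t2 -> Rabs (u i z) <= 2 * K * (th0 * r).
    by move=> hz; have := res z i hz iS; rewrite (Rad_pred _ kT) -kS -/r; lra.
  have de : Rabs (dot (nn i) err) <= K ^ 4 * eps.
    apply: Rle_trans (rsum_bound (C := K * (K ^ 2 * eps)) _) _.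
      by move=> j; apply: mul_bound; [exact: (o_nn O) | exact: errb].
    rewrite card_ord; have -> : K ^ 4 * eps = K * (K * (K ^ 2 * eps)) by ring.
    apply: Rmult_le_compat_r => //; apply: Rmult_le_pos; [lra | apply: Rmult_le_pos => //; exact: pow2_ge_0].
  apply: Rle_trans (sub_bound (sub_bound (small_u t2 _) (small_u t1 _)) de) _; try lra.
  by rewrite /e; lra.
have tot : dist t1 t2 <= C * e + K ^ 3 * eps.
  have -> : K ^ 3 * eps = K * (K ^ 2 * eps) by ring.
  apply: Rle_trans (_ : norm1 v + norm1 err <= _).
    rewrite /dist /norm1 -rsum_add; apply: rsum_le => j.
    by rewrite Rabs_minus_sym split_I; exact: Rabs_triang.
  apply: Rplus_le_compat => //.
  have := rsum_bound (fun j => (fun h => h) (errb j : Rabs (err j) <= K ^ 2 * eps)).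
  have b2 : INR d * (K ^ 2 * eps) <= K * (K ^ 2 * eps).
    by apply: Rmult_le_compat_r => //; apply: Rmult_le_pos => //; exact: pow2_ge_0.
  move=> _; apply: Rle_trans b2.
  have -> : INR d * (K ^ 2 * eps) = rsum (fun _ : 'I_d => K ^ 2 * eps) by rewrite rsum_const card_ord.
  by apply: rsum_le.
apply: Rle_trans tot _.
have p1 : C * (4 * K * (th0 * r)) <= r / 16.
  have -> : C * (4 * K * (th0 * r)) = (C * K * th0) * (4 * r) by ring.
  have : C * K * th0 <= / 64.
    have -> : / 64 = ((C + 1) * K) * th0 by rewrite /th0; field; lra.
    by apply: Rmult_le_compat_r; [lra | nra].
  by have : 0 < r by [exact: Rad0]; nra.
have p2 : (C + 1) * K ^ 4 * eps = r0 / 8.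
  by rewrite /eps /e2; field; split; [|split]; lra.
have p3 : K ^ 3 * eps <= K ^ 4 * eps.
  apply: Rmult_le_compat_r => //; have -> : K ^ 4 = K * K ^ 3 by ring.
  by have : 0 < K ^ 3 by [apply: pow_lt; lra]; nra.
by rewrite /e; lra.
Qed.

End NearConfinement.

(** One alternative is enough: if the orbit is far from the separatrix at some time, [far_stable]
    started from that time covers the whole interval in both directions; otherwise it is near all
    the time. Regimes are never glued together. *)
Lemma orbit_stable (d : nat) (T : finType) (nn : T -> 'I_d -> R) (K kappa : R) :
  2 <= K -> 0 < kappa -> exists mu1 kappa0, 0 < mu1 /\ 0 < kappa0 /\
  forall ll mu a b I p q th c acc f F1 F2, 0 < mu <= mu1 ->
    orbit nn ll K mu a b I p q th c acc f F1 F2 -> a <= 0 <= b ->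
    b - a <= 2 * (kappa0 / mu * ln (1 / mu)) ->
    forall t, a <= t <= b ->
      norm1 (fun j => I 0 j - I t j) + Rabs (energy (p 0) (q 0) - energy (p t) (q t)) <= kappa.
Proof.
move=> K2 kap0.
have [e2 [e20 near]] := near_stable nn K2 (kappa := kappa / 2) ltac:(lra).
(* With [g = mu ^ (-1 / P)] and [G = g ^ 4], the requirement [mu * G ^ m <= 1] of the far regime
   becomes an equality, and [mu * g ^ 40 <= 1] follows. *)
pose m := (12 * rho #|T| + 140)%N; pose P := (4 * m)%N.
have m40 : (40 <= m)%coq_nat by apply/leP; apply: leq_trans (leq_addl _ _).
have Pm : P = (4 * m)%coq_nat by [].
pose g0 := Rmax 10 (Rmax (10 * K ^ 6) (16 / kappa)).
have g010 : 10 <= g0 by exact: Rmax_l.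
have g0K : 10 * K ^ 6 <= g0 by apply: Rle_trans (Rmax_l _ _) (Rmax_r _ _).
have g0k : 16 / kappa <= g0 by apply: Rle_trans (Rmax_r _ _) (Rmax_r _ _).
have P0 : 0 < INR P by apply: lt_0_INR; lia.
have P1 : 1 <= INR P by rewrite -INR_1; apply: le_INR; lia.
have g0P : 0 < / g0 ^ P by apply: Rinv_0_lt_compat; apply: pow_lt; lra.
(* The bound [/ g0 ^ P] gives [g >= g0]. As [ln (1 / mu) = INR P * ln g], the quotient of the total
   time by the length of a window is a multiple of [kappa0 * INR P / mu]: the value
   [e2 / (6 * INR P)] makes its cost at most [e2 / 2], and [e2 / 2] is left for the extra window.
   The value [/ (2 * INR P)] yields [mu * (b - a) <= ln g]. *)
exists (Rmin (/ g0 ^ P) (e2 / 2)), (Rmin (e2 / (6 * INR P)) (/ (2 * INR P))).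
split; first by apply: Rmin_glb_lt; lra.
split.
  apply: Rmin_glb_lt; first by apply: Rdiv_lt_0_compat; lra.
  by apply: Rinv_0_lt_compat; lra.
set k0 := Rmin _ (/ (2 * INR P)).
have k01 : k0 <= e2 / (6 * INR P) by exact: Rmin_l.
have k02 : k0 <= / (2 * INR P) by exact: Rmin_r.
move=> ll mu a b I p q th c acc f F1 F2 [mu0 mu1] O h0 len t ht.
have mu2 : mu <= / g0 ^ P by apply: Rle_trans mu1 (Rmin_l _ _).
have mu3 : mu <= e2 / 2 by apply: Rle_trans mu1 (Rmin_r _ _).
have mui : 0 < 1 / mu by apply: Rdiv_lt_0_compat; lra.
pose g := exp (ln (1 / mu) / INR P).
have lng : ln g = ln (1 / mu) / INR P by rewrite /g ln_exp.
have L : ln (1 / mu) = INR P * ln g by rewrite lng; field; lra.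
have gP : mu * g ^ P = 1.
  have -> : g ^ P = 1 / mu by rewrite -Rpower_pow /Rpower; [rewrite -L exp_ln // | exact: exp_pos].
  by field; lra.
have g_pos : 0 < g by exact: exp_pos.
have gg0 : g0 <= g.
  apply: Rnot_lt_le => lt.
  have : g ^ P < g0 ^ P.
    have [k kE] : exists k, P = k.+1 by exists P.-1; rewrite prednK //; apply/ltP; lia.
    rewrite kE -!tech_pow_Rmult.
    have h1 : g ^ k <= g0 ^ k by apply: pow_incr; lra.
    have h2 : 0 < g ^ k by exact: pow_lt.
    nra.
  have : g0 ^ P <= g ^ P; last lra.
  apply: (Rmult_le_reg_l mu) => //; rewrite gP.
  have := Rmult_le_compat_r (g0 ^ P) _ _ (Rlt_le _ _ (pow_lt g0 P ltac:(lra))) mu2.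
  by rewrite Rinv_l //; apply: Rgt_not_eq; apply: pow_lt; lra.
have g10 : 10 <= g by lra.
have g4 : g <= g ^ 4 by have := pow_G_le g10 (m := 1) (n := 4) ltac:(lia); rewrite pow_1.
have KG : 10 * K ^ 6 <= g ^ 4 by lra.
have muG : mu * (g ^ 4) ^ (12 * rho #|T| + 140) <= 1.
  by rewrite -pow_mult -/m -Pm gP; lra.
have mug : mu * g ^ 40 <= 1.
  rewrite -gP; apply: Rmult_le_compat_l; first lra.
  by apply: (pow_G_le g10); lia.
have lng0 : 0 < ln g by have := tau_bounds g10; lra.
have lnP : 0 < INR P * ln g by exact: Rmult_lt_0_compat.
have mulen : mu * (b - a) <= 2 * k0 * (INR P * ln g).
  have := Rmult_le_compat_l mu _ _ ltac:(lra) len; rewrite L.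
  by have -> : mu * (2 * (k0 / mu * (INR P * ln g))) = 2 * k0 * (INR P * ln g) by field; lra.
have len' : mu * (b - a) <= g ^ 4.
  apply: Rle_trans mulen _; apply: Rle_trans g4; apply: Rle_trans (ln_le_id g_pos).
  have -> : 2 * k0 * (INR P * ln g) = k0 * (2 * INR P) * ln g by ring.
  rewrite -[X in _ <= X]Rmult_1_l; apply: Rmult_le_compat_r; first lra.
  by rewrite -(Rinv_l (2 * INR P)); [apply: Rmult_le_compat_r; lra | lra].
have gi : 0 < / g ^ 4 by apply: Rinv_0_lt_compat; exact: pow_G_gt0.
have gk : 16 / g ^ 4 <= kappa.
  apply: (Rmult_le_reg_r (g ^ 4)); first exact: pow_G_gt0.
  have -> : 16 / g ^ 4 * g ^ 4 = 16 by field; lra.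
  have -> : 16 = kappa * (16 / kappa) by field; lra.
  by apply: Rmult_le_compat_l; lra.
case: (classic (exists t1, a <= t1 <= b /\ 4 / g ^ 4 <= Rabs (energy (p t1) (q t1)))) => [[t1 [ht1 far]]|no].
  have f0 := far_stable O KG muG len' ht1 far h0.
  have ft := far_stable O KG muG len' ht1 far ht.
  have tr1 : norm1 (fun j => I 0 j - I t j) <=
     rsum (fun j => Rabs (I t1 j - I 0 j)) + rsum (fun j => Rabs (I t1 j - I t j)).
    rewrite /norm1 -rsum_add; apply: rsum_le => j; rewrite (Rabs_minus_sym (I t1 j)).
    have -> : I 0 j - I t j = (I 0 j - I t1 j) + (I t1 j - I t j) by ring.
    exact: Rabs_triang.
  have tr2 : Rabs (energy (p 0) (q 0) - energy (p t) (q t)) <=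
     Rabs (energy (p t1) (q t1) - energy (p 0) (q 0)) + Rabs (energy (p t1) (q t1) - energy (p t) (q t)).
    rewrite (Rabs_minus_sym (energy (p t1) _)).
    have -> : energy (p 0) (q 0) - energy (p t) (q t) = (energy (p 0) (q 0) - energy (p t1) (q t1)) +
      (energy (p t1) (q t1) - energy (p t) (q t)) by ring.
    exact: Rabs_triang.
  rewrite /Rdiv in gk; apply: Rle_trans (Rplus_le_compat _ _ _ _ tr1 tr2) _.
  by move: f0 ft; rewrite /Rdiv; lra.
have nearE x : a <= x <= b -> Rabs (energy (p x) (q x)) <= 4 / g ^ 4.
  by move=> hx; apply: Rnot_lt_le => lt; apply: no; exists x; split=> //; lra.
have tau_small : mu * ((b - a) / (ln g * (2 / 3)) + 1) <= e2.
  have -> : mu * ((b - a) / (ln g * (2 / 3)) + 1) = mu * (b - a) * (3 / 2 / ln g) + mu by field; lra.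
  have h1 : mu * (b - a) * (3 / 2 / ln g) <= 3 * (k0 * INR P).
    have -> : 3 * (k0 * INR P) = 2 * k0 * (INR P * ln g) * (3 / 2 / ln g) by field; lra.
    by apply: Rmult_le_compat_r => //; apply: Rdiv_le_0_compat; lra.
  have h2 : k0 * INR P <= e2 / 6.
    have -> : e2 / 6 = e2 / (6 * INR P) * INR P by field; lra.
    by apply: Rmult_le_compat_r; lra.
  lra.
have nI := near ll mu a b g I p q th c acc f F1 F2 O ltac:(lra) g10 KG mug nearE tau_small 0 t h0 ht.
have := nearE 0 h0; have := nearE t ht.
have := sub_bound (Rle_refl (Rabs (energy (p 0) (q 0)))) (Rle_refl (Rabs (energy (p t) (q t)))).
by rewrite /Rdiv in gk *; rewrite /Rdiv; move: nI; rewrite /Rdiv; lra.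
Qed.

(** * Analytic functions have locally Lipschitz derivatives *)

Definition close (m : nat) (s : R) (z z' : 'I_m -> R) := forall i, Rabs (z' i - z i) < s.

Definition shift (m : nat) (z z' : 'I_m -> R) := fun i => z' i - z i.

(** Bounded, Lipschitz and with a quadratic Taylor remainder, the gradient being existential. This
    form passes to sums, products and pointwise limits with explicit constants, so that power series
    need not be differentiated term by term. *)
Definition smooth_on (m : nat) (z0 : 'I_m -> R) (s : R) (h : ('I_m -> R) -> R) (V L Q : R) :=
  forall z, close s z0 z -> Rabs (h z) <= V /\
    exists D, forall z', close s z0 z' ->
      Rabs (h z' - h z) <= L * norm1 (shift z z') /\
      Rabs (h z' - h z - dot D (shift z z')) <= Q * norm1 (shift z z') ^ 2.

Section SmoothClass.
Variables (m : nat) (z0 : 'I_m -> R) (s : R).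
Hypothesis s_gt0 : 0 < s.

Lemma close_refl : close s z0 z0.
Proof. by move=> i; rewrite Rminus_diag Rabs_R0. Qed.

Lemma dot_lin (D E x : 'I_m -> R) a b :
  dot (fun i => a * D i + b * E i) x = a * dot D x + b * dot E x.
Proof. by rewrite /dot -!rsum_scal -rsum_add; apply: rsum_ext => i; ring. Qed.

Lemma dot_0 (x : 'I_m -> R) : dot (fun=> 0) x = 0.
Proof. by rewrite /dot (@rsum_ext _ _ (fun=> 0)) ?rsum_const => [|j]; ring. Qed.

Lemma smooth_le h V L Q V' L' Q' : V <= V' -> L <= L' -> Q <= Q' ->
  smooth_on z0 s h V L Q -> smooth_on z0 s h V' L' Q'.
Proof.
move=> VV LL QQ sm z hz; have [h1 [D hD]] := sm z hz; split; first lra.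
exists D => z' hz'; have [h2 h3] := hD z' hz'; have n0 := norm1_ge0 (shift z z').
split; [apply: Rle_trans h2 _ | apply: Rle_trans h3 _]; apply: Rmult_le_compat_r => //.
exact: pow2_ge_0.
Qed.

Lemma smooth_ext h h' V L Q : (forall z, h z = h' z) ->
  smooth_on z0 s h V L Q -> smooth_on z0 s h' V L Q.
Proof.
move=> hh sm z hz; have [h1 [D hD]] := sm z hz; rewrite -hh; split=> //.
by exists D => z' hz'; rewrite -!hh; exact: hD.
Qed.

Lemma smooth_const c : smooth_on z0 s (fun=> c) (Rabs c) 0 0.
Proof.
move=> z hz; split; first lra.
by exists (fun=> 0) => z' hz'; rewrite dot_0 Rminus_diag Rminus_0_r Rabs_R0; lra.
Qed.

Lemma smooth_coord i : smooth_on z0 s (fun z => z i - z0 i) s 1 0.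
Proof.
move=> z hz; split; first by have := hz i; lra.
exists (fun k => if k == i then 1 else 0) => z' hz'.
have -> : z' i - z0 i - (z i - z0 i) = shift z z' i by rewrite /shift; ring.
have dE : dot (fun k => if k == i then 1 else 0) (shift z z') = shift z z' i.
  rewrite /dot /rsum (bigD1 i) //= eqxx big1 => [|k /negbTE ->]; ring.
split; first by rewrite Rmult_1_l; apply: (@rsum_term _ (fun k => Rabs (shift z z' k))) => k; exact: Rabs_pos.
by rewrite dE Rminus_diag Rabs_R0; lra.
Qed.

Lemma smooth_mul h1 h2 V1 L1 Q1 V2 L2 Q2 : 0 <= L1 -> 0 <= L2 -> 0 <= Q1 -> 0 <= Q2 ->
  smooth_on z0 s h1 V1 L1 Q1 -> smooth_on z0 s h2 V2 L2 Q2 ->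
  smooth_on z0 s (fun z => h1 z * h2 z) (V1 * V2) (V1 * L2 + L1 * V2) (V1 * Q2 + V2 * Q1 + L1 * L2).
Proof.
move=> L10 L20 Q10 Q20 s1 s2 z hz; have [v1 [D1 d1]] := s1 z hz; have [v2 [D2 d2]] := s2 z hz.
split; first exact: mul_bound.
exists (fun i => h1 z * D2 i + h2 z * D1 i) => z' hz'.
have [l1 q1] := d1 z' hz'; have [l2 q2] := d2 z' hz'; have [v2' _] := s2 z' hz'.
have n0 := norm1_ge0 (shift z z'); set n := norm1 _ in l1 q1 l2 q2 n0 *.
split.
  have -> : h1 z' * h2 z' - h1 z * h2 z = h1 z * (h2 z' - h2 z) + (h1 z' - h1 z) * h2 z' by ring.
  apply: Rle_trans (add_bound (mul_bound v1 l2) (mul_bound l1 v2')) _; right; ring.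
rewrite dot_lin.
have -> : h1 z' * h2 z' - h1 z * h2 z - (h1 z * dot D2 (shift z z') + h2 z * dot D1 (shift z z')) =
  h1 z * (h2 z' - h2 z - dot D2 (shift z z')) + h2 z * (h1 z' - h1 z - dot D1 (shift z z')) +
  (h1 z' - h1 z) * (h2 z' - h2 z) by ring.
apply: Rle_trans (add_bound (add_bound (mul_bound v1 q2) (mul_bound v2 q1)) (mul_bound l1 l2)) _.
right; ring.
Qed.

Lemma smooth_sum (T : finType) (h : T -> ('I_m -> R) -> R) (V L Q : T -> R) :
  (forall t, smooth_on z0 s (h t) (V t) (L t) (Q t)) ->
  smooth_on z0 s (fun z => rsum (fun t => h t z)) (rsum V) (rsum L) (rsum Q).
Proof.
move=> sm z hz; split.
  by apply: Rle_trans (rsum_abs _) _; apply: rsum_le => t; exact: (proj1 (sm t z hz)).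
have [D hD] := fin_all_exists (fun t => proj2 (sm t z hz)).
exists (fun i => rsum (fun t => D t i)) => z' hz'.
have n0 := norm1_ge0 (shift z z').
have dE : dot (fun i => rsum (fun t => D t i)) (shift z z') = rsum (fun t => dot (D t) (shift z z')).
  rewrite /dot rsum_exchange; apply: rsum_ext => i.
  by rewrite Rmult_comm -rsum_scal; apply: rsum_ext => t; ring.
rewrite dE -!rsum_sub; split; apply: Rle_trans (rsum_abs _) _; rewrite Rmult_comm -rsum_scal; apply: rsum_le => t.
  by rewrite Rmult_comm; exact: (proj1 (hD t z' hz')).
by rewrite Rmult_comm; exact: (proj2 (hD t z' hz')).
Qed.

(** The bounds of a monomial of degree [k] and of its derivatives on a cube of radius [s], with
    negative powers of [s] avoided by division. The coefficient [k ^ 2] instead of [k (k - 1)] makes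
    the class stable under products. *)
Definition monomial_like k h :=
  smooth_on z0 s h (s ^ k) (INR k * (s ^ k / s)) (INR k ^ 2 * (s ^ k / s ^ 2)).

Lemma monomial_one : monomial_like 0 (fun=> 1).
Proof.
apply: smooth_le (smooth_const 1); rewrite /= ?Rabs_R1; try lra.
Qed.

Lemma monomial_mul k l h1 h2 : monomial_like k h1 -> monomial_like l h2 ->
  monomial_like (k + l) (fun z => h1 z * h2 z).
Proof.
move=> m1 m2; have k0 := pos_INR k; have l0 := pos_INR l.
have sk := pow_lt s k s_gt0; have sl := pow_lt s l s_gt0.
have s2 := pow_lt s 2 s_gt0.
have a0 x : 0 < x -> 0 <= x / s by move=> ?; apply: Rdiv_le_0_compat; lra.
have b0 x : 0 < x -> 0 <= x / s ^ 2 by move=> ?; apply: Rdiv_le_0_compat; lra.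
apply: smooth_le (smooth_mul _ _ _ _ m1 m2); rewrite -?plusE ?pow_add ?plus_INR; try lra;
  try by apply: Rmult_le_pos => //; try exact: pow2_ge_0; auto.
have -> : s ^ k * (INR l ^ 2 * (s ^ l / s ^ 2)) + s ^ l * (INR k ^ 2 * (s ^ k / s ^ 2)) +
  INR k * (s ^ k / s) * (INR l * (s ^ l / s)) = (INR l ^ 2 + INR k ^ 2 + INR k * INR l) * (s ^ k * s ^ l / s ^ 2) by field; lra.
apply: Rmult_le_compat_r; first by apply: b0; exact: Rmult_lt_0_compat.
by have := Rmult_le_pos _ _ k0 l0; nra.
Qed.

Lemma monomial_coord i : monomial_like 1 (fun z => z i - z0 i).
Proof.
apply: smooth_le (smooth_coord i); rewrite /= ?Rmult_1_r; try lra.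
- by right; field; lra.
by apply: Rmult_le_pos; [lra | apply: Rdiv_le_0_compat; nra].
Qed.

Lemma monomial_ext k h h' : (forall z, h z = h' z) -> monomial_like k h -> monomial_like k h'.
Proof. exact: smooth_ext. Qed.

Lemma monomial_pow i k : monomial_like k (fun z => (z i - z0 i) ^ k).
Proof.
elim: k => [|k IH]; first exact: monomial_one.
by rewrite -add1n; exact: monomial_mul (monomial_coord i) IH.
Qed.

Lemma monomial_prod (T : finType) (k : T -> nat) (h : T -> ('I_m -> R) -> R) :
  (forall t, monomial_like (k t) (h t)) ->
  monomial_like (\sum_(t : T) k t) (fun z => \big[Rmult/1]_(t : T) h t z).
Proof.
move=> hm; elim: (index_enum T) => [|t l IH].
  rewrite big_nil; apply: monomial_ext monomial_one => z; by rewrite big_nil.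
rewrite big_cons; apply: monomial_ext (monomial_mul (hm t) IH) => z; by rewrite big_cons.
Qed.

(** The uniform quadratic remainder forces the gradients to converge: a finite difference of step
    [r] determines a partial derivative up to [Q * r], and finite differences converge with the
    values. *)
Lemma smooth_limit (h : nat -> ('I_m -> R) -> R) (g : ('I_m -> R) -> R) V L Q : 0 <= Q ->
  (forall K, smooth_on z0 s (h K) V L Q) ->
  (forall z, close s z0 z -> is_lim_seq (fun K => h K z) (g z)) ->
  smooth_on z0 s g V L Q.
Proof.
move=> Q0 sm lim z hz.
have bound_lim (X : nat -> R) (x C : R) : is_lim_seq X x -> (forall K, Rabs (X K) <= C) -> Rabs x <= C.
  move=> hx hC; have h1 := is_lim_seq_abs _ _ hx.
  exact: (is_lim_seq_le _ _ _ _ hC h1 (is_lim_seq_const C)).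
split; first (refine (bound_lim _ _ _ (lim z hz) _) => K; exact: (proj1 (sm K z hz))).
pose PD K D := forall z', close s z0 z' ->
      Rabs (h K z' - h K z) <= L * norm1 (shift z z') /\
      Rabs (h K z' - h K z - dot D (shift z z')) <= Q * norm1 (shift z z') ^ 2.
pose DK K := epsilon (inhabits (fun=> 0)) (PD K).
have hDK K : PD K (DK K) by apply: epsilon_spec; exact: (proj2 (sm K z hz)).
have cauchy i : ex_finite_lim_seq (fun K => DK K i).
  apply/ex_lim_seq_cauchy_corr => eps.
  (* The first bound keeps the displaced point in the cube, the second makes each Taylor remainder
     at most [eps / 4 * r]; the values are then taken within [eps / 16 * r] of their limits. *)
  pose r := Rmin ((s - Rabs (z i - z0 i)) / 2) (eps / (4 * (Q + 1))).
  have r0 : 0 < r.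
    apply: Rmin_glb_lt; first by have := hz i; lra.
    by apply: Rdiv_lt_0_compat; [exact: cond_pos | lra].
  have r1 : r <= (s - Rabs (z i - z0 i)) / 2 by exact: Rmin_l.
  have r2 : r <= eps / (4 * (Q + 1)) by exact: Rmin_r.
  pose z' k := if k == i then z i + r else z k.
  have cz' : close s z0 z'.
    move=> k; rewrite /z'; case: eqP => [->|_]; last exact: hz.
    have -> : z i + r - z0 i = (z i - z0 i) + r by ring.
    by apply: Rle_lt_trans (Rabs_triang _ _) _; rewrite (Rabs_pos_eq r); [have := hz i; lra | lra].
  have sh k : shift z z' k = if k == i then r else 0.
    by rewrite /shift /z'; case: eqP => [->|_]; ring.
  have n1 : norm1 (shift z z') = r.
    rewrite /norm1 /rsum (bigD1 i) //= sh eqxx big1 => [|k /negbTE ki]; last by rewrite sh ki Rabs_R0.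
    by rewrite Rplus_0_r Rabs_pos_eq; lra.
  have dt D : dot D (shift z z') = D i * r.
    rewrite /dot /rsum (bigD1 i) //= sh eqxx big1 => [|k /negbTE ki]; last by rewrite sh ki; ring.
    by ring.
  have er0 : 0 < eps / 16 * r by apply: Rmult_lt_0_compat => //; have := cond_pos eps; lra.
  have lim_eps w : close s z0 w -> exists N, forall K, (N <= K)%coq_nat -> Rabs (h K w - g w) < eps / 16 * r.
    move=> hw; have [N hN] := proj2 (is_lim_seq_spec _ _) (lim w hw) (mkposreal _ er0).
    by exists N => K NK; exact: hN.
  have [N1 hN1] := lim_eps z hz; have [N2 hN2] := lim_eps z' cz'.
  exists (N1 + N2)%coq_nat => K K' hK hK'.
  have a1 := hN1 K ltac:(lia); have a2 := hN2 K ltac:(lia).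
  have a3 := hN1 K' ltac:(lia); have a4 := hN2 K' ltac:(lia).
  have [_ q1] := hDK K z' cz'; have [_ q2] := hDK K' z' cz'.
  rewrite dt n1 in q1; rewrite dt n1 in q2.
  apply: (Rmult_lt_reg_r r) => //.
  rewrite -{1}(Rabs_pos_eq r); last lra.
  rewrite -Rabs_mult.
  have -> : (DK K i - DK K' i) * r = - (h K z' - h K z - DK K i * r) + (h K' z' - h K' z - DK K' i * r) +
    ((h K z' - g z') - (h K' z' - g z')) - ((h K z - g z) - (h K' z - g z)) by ring.
  have Qr : Q * r ^ 2 <= eps / 4 * r.
    have -> : Q * r ^ 2 = Q * r * r by ring.
    apply: Rmult_le_compat_r; first lra.
    have h1 : (Q + 1) * r <= eps / 4.
      have -> : eps / 4 = (Q + 1) * (eps / (4 * (Q + 1))) by field; lra.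
      by apply: Rmult_le_compat_l; lra.
    nra.
  rewrite -Rabs_Ropp in q1.
  have t2 := sub_bound (Rlt_le _ _ a2) (Rlt_le _ _ a4).
  have t3 := sub_bound (Rlt_le _ _ a1) (Rlt_le _ _ a3).
  apply: Rle_lt_trans (sub_bound (add_bound (add_bound q1 q2) t2) t3) _.
  lra.
pose D i := real (Lim_seq (fun K => DK K i)).
have limD i : is_lim_seq (fun K => DK K i) (D i) by exact: Lim_seq_correct' (cauchy i).
have limdot x : is_lim_seq (fun K => dot (DK K) x) (dot D x).
  rewrite /dot /rsum; elim: (index_enum _) => [|i l IH].
    by rewrite big_nil; apply: (is_lim_seq_ext (fun=> 0)) (is_lim_seq_const 0) => K; rewrite big_nil.
  rewrite big_cons; apply: (is_lim_seq_ext (fun K => DK K i * x i + \big[Rplus/0]_(j <- l) (DK K j * x j))).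
    by move=> K; rewrite big_cons.
  exact: is_lim_seq_plus' (is_lim_seq_mult' _ _ _ _ (limD i) (is_lim_seq_const (x i))) IH.
exists D => z' hz'.
have ld := is_lim_seq_minus' _ _ _ _ (lim z' hz') (lim z hz).
split; first by apply: bound_lim _ _ _ ld _ => K; exact: (proj1 (hDK K z' hz')).
apply: bound_lim _ _ _ (is_lim_seq_minus' _ _ _ _ ld (limdot _)) _ => K.
exact: (proj2 (hDK K z' hz')).
Qed.

End SmoothClass.

(** Halving the radius of a series gains [2 ^ k] in degree [k], which pays for the factors [k] and
    [k ^ 2] of the derivatives. *)
Lemma sqr_le_pow2 k : INR k ^ 2 <= 2 * 2 ^ k /\ INR k <= 2 * 2 ^ k.
Proof.
have p2 n : 1 <= 2 ^ n by apply: pow_R1_Rle; lra.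
have lin n : INR n <= 2 ^ n.
  elim: n => [|n IH]; first by rewrite /=; lra.
  by rewrite S_INR /=; have := p2 n; lra.
split; last by have := lin k; have := p2 k; lra.
elim: k => [|[|[|k]] IH]; try by rewrite /=; lra.
rewrite S_INR.
have k2 : 2 <= INR k.+2 by rewrite !S_INR; have := pos_INR k; lra.
case: k IH k2 => [|k] IH k2; first by rewrite /=; lra.
have k3 : 3 <= INR k.+3 by rewrite !S_INR; have := pos_INR k; lra.
have e : 2 ^ k.+4 = 2 * 2 ^ k.+3 by [].
move: IH k3; rewrite e; move: (INR k.+3) (2 ^ k.+3) => n w IH k3.
nra.
Qed.

(** * Power series in the joint variable [(p, q, y)] *)

Section Packing.
Variable d : nat.

Definition ip : 'I_d.+2 := ord0.
Definition iq : 'I_d.+2 := lift ord0 ord0.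
Definition iy (j : 'I_d) : 'I_d.+2 := lift ord0 (lift ord0 j).

Definition packed (g : vec d -> R -> R -> R) (z : 'I_d.+2 -> R) := g (fun j => z (iy j)) (z ip) (z iq).

Definition pack (y : vec d) (p q : R) (i : 'I_d.+2) : R :=
  if unlift ord0 i is Some i' then (if unlift ord0 i' is Some j then y j else q) else p.

Lemma pack_ip y p q : pack y p q ip = p.
Proof. by rewrite /pack unlift_none. Qed.

Lemma pack_iq y p q : pack y p q iq = q.
Proof. by rewrite /pack liftK unlift_none. Qed.

Lemma pack_iy y p q j : pack y p q (iy j) = y j.
Proof. by rewrite /pack !liftK. Qed.

Lemma index_cases (P : 'I_d.+2 -> Prop) : P ip -> P iq -> (forall j, P (iy j)) -> forall i, P i.
Proof.
move=> hp hq hy i; case: (unliftP ord0 i) => [i' ->|->] //.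
by case: (unliftP ord0 i') => [j ->|->]; [exact: hy | exact: hq].
Qed.

Lemma rsum_packed (F : 'I_d.+2 -> R) : rsum F = F ip + (F iq + rsum (fun j => F (iy j))).
Proof. by rewrite /rsum !big_ord_recl. Qed.

(** Absolute convergence at the corner of the cube of radius [rh = 2 * s] bounds the sums of
    [|a| * rh ^ deg] by [M], and these dominate the terms together with their first and second
    derivatives on the cube of radius [s]. The partial sums are thus uniformly smooth and
    [smooth_limit] applies. *)
Lemma analytic_smooth (g : vec d -> R -> R -> R) : real_analytic g ->
  forall z0, exists s C, 0 < s /\ 0 <= C /\ smooth_on z0 s (packed g) C C C.
Proof.
move=> an z0; have [r [a [r0 ha]]] := an (fun j => z0 (iy j)) (z0 ip) (z0 iq).
pose x := fun j => z0 (iy j).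
pose rh := r / 2; pose s := r / 4; have s0 : 0 < s by rewrite /s; lra.
have rh0 : 0 < rh by rewrite /rh; lra.
have rhs : rh = 2 * s by rewrite /rh /s; field.
pose deg (al : 'I_d -> nat) (be ga : nat) := (\sum_(j < d) al j + be + ga)%N.
have [[M hM] _] : (exists M, forall K, box_sum (fun al be ga =>
      Rabs (a al be ga * monom x (fun j => x j + rh) (z0 ip) (z0 ip + rh) (z0 iq) (z0 iq + rh) al be ga)) K <= M) /\ True.
  split=> //; apply: (proj1 (ha _ _ _ _ _ _)) => [j||].
  - by rewrite /x; have -> : z0 (iy j) + rh - z0 (iy j) = rh by [ring]; rewrite Rabs_pos_eq /rh; lra.
  - by have -> : z0 ip + rh - z0 ip = rh by [ring]; rewrite Rabs_pos_eq /rh; lra.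
  - by have -> : z0 iq + rh - z0 iq = rh by [ring]; rewrite Rabs_pos_eq /rh; lra.
have prodE (al : 'I_d -> nat) : \big[Rmult/1]_(j < d) (rh ^ al j) = rh ^ (\sum_(j < d) al j)%N.
  elim: (index_enum _) => [|j l IH]; first by rewrite !big_nil.
  by rewrite !big_cons IH -plusE pow_add.
have monE al be ga : Rabs (a al be ga * monom x (fun j => x j + rh) (z0 ip) (z0 ip + rh) (z0 iq) (z0 iq + rh) al be ga) =
    Rabs (a al be ga) * rh ^ deg al be ga.
  rewrite Rabs_mult; congr (_ * _); rewrite /monom.
  have -> : z0 ip + rh - z0 ip = rh by ring.
  have -> : z0 iq + rh - z0 iq = rh by ring.
  rewrite (eq_bigr (fun j => rh ^ al j)) => [|j _]; last by congr (_ ^ _); ring.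
  rewrite prodE /deg -!plusE !pow_add Rabs_pos_eq //.
  by apply: Rlt_le; repeat apply: Rmult_lt_0_compat; exact: pow_lt.
(* The 2 is that of [sqr_le_pow2], and the three summands serve the value, the first and the second
   derivatives. *)
pose B := 2 * (1 + / s + / s ^ 2).
have si : 0 < / s by exact: Rinv_0_lt_compat.
have si2 : 0 < / s ^ 2 by apply: Rinv_0_lt_compat; exact: pow_lt.
pose h K z := box_sum (fun al be ga => a al be ga *
  monom x (fun j => z (iy j)) (z0 ip) (z ip) (z0 iq) (z iq) al be ga) K.
have term al be ga : smooth_on z0 s (fun z => a al be ga *
    monom x (fun j => z (iy j)) (z0 ip) (z ip) (z0 iq) (z iq) al be ga)
    (Rabs (a al be ga) * rh ^ deg al be ga * B) (Rabs (a al be ga) * rh ^ deg al be ga * B)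
    (Rabs (a al be ga) * rh ^ deg al be ga * B).
  have ml : monomial_like z0 s (deg al be ga)
      (fun z => monom x (fun j => z (iy j)) (z0 ip) (z ip) (z0 iq) (z iq) al be ga).
    apply: monomial_mul => //; last exact: monomial_pow.
    apply: monomial_mul => //; last exact: monomial_pow.
    by apply: (monomial_prod s0 (h := fun j z => (z (iy j) - x j) ^ al j)) => j; exact: monomial_pow.
  set k := deg al be ga in ml *; set A := a al be ga.
  have sk := pow_lt s k s0; have k0 := pos_INR k.
  have l0 : 0 <= INR k * (s ^ k / s) by apply: Rmult_le_pos => //; apply: Rdiv_le_0_compat; lra.
  have q0 : 0 <= INR k ^ 2 * (s ^ k / s ^ 2).
    by apply: Rmult_le_pos; [exact: pow2_ge_0 | apply: Rdiv_le_0_compat; [lra | exact: pow_lt]].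
  have [k1 k2] := sqr_le_pow2 k.
  have rk : rh ^ k = 2 ^ k * s ^ k by rewrite rhs Rpow_mult_distr.
  have p2 : 1 <= 2 ^ k by apply: pow_R1_Rle; lra.
  have A0 := Rabs_pos A.
  have b1 : s ^ k <= rh ^ k * B.
    rewrite rk /B; have h1 : s ^ k * 1 <= s ^ k * (2 ^ k * (2 * (1 + / s + / s ^ 2))) by apply: Rmult_le_compat_l; nra.
    lra.
  have b2 : INR k * (s ^ k / s) <= rh ^ k * B.
    rewrite rk /B /Rdiv.
    have h1 : INR k * (s ^ k * / s) <= 2 * 2 ^ k * (s ^ k * / s) by apply: Rmult_le_compat_r => //; nra.
    have h2 : 0 <= 2 ^ k * s ^ k by nra.
    nra.
  have b3 : INR k ^ 2 * (s ^ k / s ^ 2) <= rh ^ k * B.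
    rewrite rk /B /Rdiv.
    have h1 : INR k ^ 2 * (s ^ k * / s ^ 2) <= 2 * 2 ^ k * (s ^ k * / s ^ 2) by apply: Rmult_le_compat_r => //; nra.
    have h2 : 0 <= 2 ^ k * s ^ k by nra.
    nra.
  have := smooth_mul (Rle_refl 0) l0 (Rle_refl 0) q0 (@smooth_const d.+2 z0 s A) ml.
  apply: smooth_le.
  - by rewrite Rmult_assoc; exact: Rmult_le_compat_l.
  - by rewrite Rmult_0_l Rplus_0_r Rmult_assoc; exact: Rmult_le_compat_l.
  - by rewrite Rmult_0_l Rmult_0_r !Rplus_0_r Rmult_assoc; exact: Rmult_le_compat_l.
have hK K : smooth_on z0 s (h K) (M * B) (M * B) (M * B).
  pose S := rsum (fun al : {ffun 'I_d -> 'I_K.+1} => rsum (fun be : 'I_K.+1 => rsum (fun ga : 'I_K.+1 =>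
    Rabs (a (fun j => nat_of_ord (al j)) be ga) * rh ^ deg (fun j => nat_of_ord (al j)) be ga * B))).
  have SB : S <= M * B.
    apply: Rle_trans (_ : B * box_sum (fun al be ga => Rabs (a al be ga * monom x (fun j => x j + rh)
       (z0 ip) (z0 ip + rh) (z0 iq) (z0 iq + rh) al be ga)) K <= _); last first.
      rewrite Rmult_comm; apply: Rmult_le_compat_r; first by rewrite /B; lra.
      exact: hM.
    right; rewrite /S /box_sum -!/(rsum _) -rsum_scal; apply: rsum_ext => al.
    rewrite -!/(rsum _) -rsum_scal; apply: rsum_ext => be.
    rewrite -!/(rsum _) -rsum_scal; apply: rsum_ext => ga.
    by rewrite monE; ring.
  apply: (smooth_le SB SB SB).
  apply: (smooth_sum (h := fun (al : {ffun 'I_d -> 'I_K.+1}) z => _)) => al.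
  apply: (smooth_sum (h := fun (be : 'I_K.+1) z => _)) => be.
  by apply: (smooth_sum (h := fun (ga : 'I_K.+1) z => _)) => ga; exact: term.
have MB : 0 <= M * B.
  have [h1 _] := hK 0%N z0 (close_refl z0 s0); exact: Rle_trans (Rabs_pos _) h1.
exists s, (M * B); split=> //; split=> //.
have lim z : close s z0 z -> is_lim_seq (fun K => h K z) (packed g z).
  move=> hz.
  have sr : s < r by rewrite /s; lra.
  by apply: (proj2 (ha _ _ _ _ _ _)) => [j||]; apply: Rlt_trans sr; exact: hz.
exact: (smooth_limit MB hK lim).
Qed.

End Packing.

Arguments ip {d}.
Arguments iq {d}.

(** Translation to the iterated products [Tn], for which [compactness_value] is stated. *)
Fixpoint of_tuple (m : nat) : Tn m R -> 'I_m -> R :=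
  if m is m'.+1 then fun x i => if unlift ord0 i is Some j then of_tuple x.2 j else x.1
  else fun _ _ => 0.

Fixpoint to_tuple (m : nat) : ('I_m -> R) -> Tn m R :=
  if m is m'.+1 then fun z => (z ord0, to_tuple (fun j => z (lift ord0 j))) else fun=> tt.

Lemma bounded_tuple m M (z : 'I_m -> R) : (forall i, Rabs (z i) <= M) ->
  bounded_n m (to_tuple (fun=> - M)) (to_tuple (fun=> M)) (to_tuple z).
Proof.
elim: m z => [|m IH] z hz //=; split; last exact: IH.
by apply/Rabs_le_between; exact: hz.
Qed.

Lemma close_tuple m dl (z : 'I_m -> R) (x : Tn m R) : close_n m dl (to_tuple z) x ->
  close dl (of_tuple x) z.
Proof.
elim: m z x => [|m IH] z /= => [x _ [] //|[x1 x2] [h1 h2] i].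
by case: (unliftP ord0 i) => [j ->|->] /=; [exact: (IH (fun j => z (lift ord0 j))) | ].
Qed.

(** Compactness of the box, applied to a gauge that bounds the local radius and the inverse of the
    local constant at the same time: a lower bound [dl] for the gauge makes [/ dl] a uniform
    constant. *)
Lemma local_to_uniform m (P : ('I_m -> R) -> R -> Prop) M :
  (forall z C C', C <= C' -> P z C -> P z C') ->
  (forall z0, exists s C, 0 < s /\ forall z, close s z0 z -> P z C) ->
  exists C, forall z, (forall i, Rabs (z i) <= M) -> P z C.
Proof.
move=> mono loc.
have {loc} loc z0 : exists sC : R * R, 0 < sC.1 /\ forall z, close sC.1 z0 z -> P z sC.2.
  by have [s [C h]] := loc z0; exists (s, C).
pose sC z0 := proj1_sig (constructive_indefinite_description _ (loc z0)).
pose s z := (sC z).1; pose C z := (sC z).2.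
have hC z0 : 0 < s z0 /\ forall z, close (s z0) z0 z -> P z (C z0).
  exact: (proj2_sig (constructive_indefinite_description _ (loc z0))).
have dl0 (x : Tn m R) : 0 < Rmin (s (of_tuple x)) (/ (1 + Rabs (C (of_tuple x)))).
  apply: Rmin_glb_lt; first exact: (proj1 (hC _)).
  by apply: Rinv_0_lt_compat; have := Rabs_pos (C (of_tuple x)); lra.
have [dl hdl] := compactness_value m (to_tuple (fun=> - M)) (to_tuple (fun=> M)) (fun x => mkposreal _ (dl0 x)).
exists (/ dl) => z hz; have [x [_ [h1 h2]]] := NNPP _ (hdl _ (bounded_tuple hz)).
apply: (mono _ (C (of_tuple x))); last first.
  apply: (proj2 (hC (of_tuple x))) => i; apply: Rlt_le_trans (close_tuple h1 i) _.
  exact: Rmin_l.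
have c0 := Rabs_pos (C (of_tuple x)).
have h3 : dl <= / (1 + Rabs (C (of_tuple x))) by apply: Rle_trans h2 _; exact: Rmin_r.
have := Rinv_le_contravar _ _ (cond_pos dl) h3; rewrite Rinv_inv.
by have := Rle_abs (C (of_tuple x)); lra.
Qed.

(** One number bounds the value, the gradient and the remainder, and its inverse is the radius of
    validity. The property is therefore monotone in [C], which is what [local_to_uniform] needs. *)
Definition regular_at (m : nat) (G : ('I_m -> R) -> R) (z : 'I_m -> R) (C : R) :=
  0 < C /\ Rabs (G z) <= C /\ exists D, (forall i, Rabs (D i) <= C) /\
    forall z', close (/ C) z z' -> Rabs (G z' - G z) <= C * norm1 (shift z z') /\
      Rabs (G z' - G z - dot D (shift z z')) <= C * norm1 (shift z z') ^ 2.

Lemma regular_mono m (G : ('I_m -> R) -> R) z C C' : C <= C' -> regular_at G z C -> regular_at G z C'.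
Proof.
move=> CC [C0 [h1 [D [h2 h3]]]]; split; first lra; split; first lra.
exists D; split => [i|z' hz']; first by apply: Rle_trans (h2 i) CC.
have cz : close (/ C) z z'.
  by move=> i; apply: Rlt_le_trans (hz' i) _; exact: Rinv_le_contravar.
have [h4 h5] := h3 z' cz; have n0 := norm1_ge0 (shift z z').
split; [apply: Rle_trans h4 _ | apply: Rle_trans h5 _]; apply: Rmult_le_compat_r => //.
exact: pow2_ge_0.
Qed.

Lemma norm1_single m (i : 'I_m) (r : R) : norm1 (fun k => if k == i then r else 0) = Rabs r.
Proof.
rewrite /norm1 /rsum (bigD1 i) //= eqxx big1 => [|k /negbTE ->]; last exact: Rabs_R0.
by rewrite Rplus_0_r.
Qed.

Lemma dot_single m (i : 'I_m) (D : 'I_m -> R) (r : R) : dot D (fun k => if k == i then r else 0) = D i * r.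
Proof.
rewrite /dot /rsum (bigD1 i) //= eqxx big1 => [|k /negbTE ->]; last by ring.
by rewrite Rplus_0_r.
Qed.

(** In the constant, [C + C * s] bounds the gradient and [2 / s] keeps the radius below [s / 2], so
    that the neighbourhood of [z] stays in the cube around [z0]. *)
Lemma smooth_regular m (G : ('I_m -> R) -> R) z0 s C : 0 < s -> 0 <= C -> smooth_on z0 s G C C C ->
  forall z, close (s / 2) z0 z -> regular_at G z (C + C * s + 2 / s + 1).
Proof.
move=> s0 C0 sm z hz.
have hz1 : close s z0 z by move=> i; apply: Rlt_trans (hz i) _; lra.
have [h1 [D hD]] := sm z hz1.
have Cs : 0 <= C * s by nra.
have si : 0 < 2 / s by apply: Rdiv_lt_0_compat; lra.
split; first lra; split; first lra.
exists D; split => [i|z' hz'].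
  (* A partial derivative is bounded by the increment over a step [s / 4] in its direction, plus the
     Taylor remainder. *)
  pose z' k := z k + (if k == i then s / 4 else 0).
  have shE : forall k, shift z z' k = if k == i then s / 4 else 0 by move=> k; rewrite /shift /z'; ring.
  have nE : norm1 (shift z z') = s / 4.
    by rewrite -[RHS](Rabs_pos_eq (s / 4)); [rewrite -(norm1_single i); apply: rsum_ext => k; rewrite shE | lra].
  have dE : dot D (shift z z') = D i * (s / 4).
    by rewrite -dot_single; apply: rsum_ext => k; rewrite shE.
  have cz : close s z0 z'.
    move=> k; have -> : z' k - z0 k = (z k - z0 k) + (if k == i then s / 4 else 0) by rewrite /z'; ring.
    apply: Rle_lt_trans (Rabs_triang _ _) _; have := hz k.
    by case: eqP => _; rewrite ?Rabs_R0 ?(Rabs_pos_eq (s / 4)); lra.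
  have [h2 h3] := hD z' cz; rewrite nE in h2; rewrite nE dE in h3.
  have h4 : Rabs (D i * (s / 4)) <= (C + C * s) * (s / 4).
    have -> : D i * (s / 4) = (G z' - G z) - (G z' - G z - D i * (s / 4)) by ring.
    by apply: Rle_trans (sub_bound h2 h3) _; nra.
  rewrite Rabs_mult (Rabs_pos_eq (s / 4)) in h4; last lra.
  have h5 : Rabs (D i) <= C + C * s by apply: (Rmult_le_reg_r (s / 4)); lra.
  lra.
have cz : close s z0 z'.
  move=> k; have -> : z' k - z0 k = (z k - z0 k) + (z' k - z k) by ring.
  apply: Rle_lt_trans (Rabs_triang _ _) _; have := hz k; have := hz' k.
  have : / (C + C * s + 2 / s + 1) <= s / 2.
    have -> : s / 2 = / (2 / s) by field; lra.
    by apply: Rinv_le_contravar; lra.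
  lra.
have [h2 h3] := hD z' cz; have n0 := norm1_ge0 (shift z z').
split; [apply: Rle_trans h2 _ | apply: Rle_trans h3 _]; apply: Rmult_le_compat_r; try lra.
exact: pow2_ge_0.
Qed.

Lemma regular_box m (G : ('I_m -> R) -> R) M :
  (forall z0, exists s C, 0 < s /\ 0 <= C /\ smooth_on z0 s G C C C) ->
  exists C, forall z, (forall i, Rabs (z i) <= M) -> regular_at G z C.
Proof.
move=> sm; apply: local_to_uniform => [z C C'|z0]; first exact: regular_mono.
have [s [C [s0 [C0 h]]]] := sm z0; exists (s / 2), (C + C * s + 2 / s + 1).
by split; [lra | exact: smooth_regular].
Qed.

(** The local bounds are chained along the segment by [dini_bound]. *)
Lemma regular_lipschitz m (G : ('I_m -> R) -> R) C z z' :
  (forall s, 0 <= s <= 1 -> regular_at G (fun i => z i + s * (z' i - z i)) C) ->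
  Rabs (G z' - G z) <= C * norm1 (shift z z').
Proof.
move=> reg; have [C0 _] := reg 0 ltac:(lra).
pose w s i := z i + s * (z' i - z i).
pose n := norm1 (shift z z'); have n0 : 0 <= n := norm1_ge0 _.
have shw s s' : forall i, shift (w s) (w s') i = (s' - s) * shift z z' i by move=> i; rewrite /shift /w; ring.
have nw s s' : norm1 (shift (w s) (w s')) = Rabs (s' - s) * n.
  by rewrite /n /norm1 -rsum_scal; apply: rsum_ext => i; rewrite shw Rabs_mult.
have e1 : w 1 = z' by apply: functional_extensionality => i; rewrite /w; ring.
have e0 : w 0 = z by apply: functional_extensionality => i; rewrite /w; ring.
have -> : C * n = C * n * (1 - 0) by ring.
rewrite -{1}e1 -{1}e0; apply: (@dini_bound (fun s => G (w s))); first lra.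
move=> t ht e e0'; exists (/ (C * (1 + n))); split.
  by apply: Rinv_0_lt_compat; apply: Rmult_lt_0_compat; lra.
move=> s hs hst; have [_ [_ [D [_ hD]]]] := reg t ht.
have cl : close (/ C) (w t) (w s).
  move=> i; rewrite -/(shift (w t) (w s) i) shw Rabs_mult.
  have ni : Rabs (shift z z' i) <= n by apply: (@rsum_term _ (fun k => Rabs (shift z z' k))) => k; exact: Rabs_pos.
  have h1 : Rabs (s - t) * Rabs (shift z z' i) <= Rabs (s - t) * (1 + n).
    by apply: Rmult_le_compat_l; [exact: Rabs_pos | lra].
  apply: Rle_lt_trans h1 _.
  have -> : / C = / (C * (1 + n)) * (1 + n) by field; lra.
  by apply: Rmult_lt_compat_r; lra.
have [h1 _] := hD _ cl; apply: Rle_trans h1 _; rewrite nw.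
by have := Rabs_pos (s - t); nra.
Qed.

(** The half angles are points of the unit circle at distance [2 |sin ((x - x') / 4)|]. A suitable
    shift by a multiple of 4 PI, which the half angles do not see, makes the difference of the
    angles comparable with this chord. *)
Lemma half_angle_chord x x' : exists k : Z,
  Rabs (x - (x' + 4 * IZR k * PI)) <=
    6 * (Rabs (cos (x / 2) - cos (x' / 2)) + Rabs (sin (x / 2) - sin (x' / 2))).
Proof.
have [k hk] := nearest_mult_PI ((x - x') / 4); exists k.
have ck : (cos (x / 2) - cos (x' / 2)) ^ 2 + (sin (x / 2) - sin (x' / 2)) ^ 2 = (2 * sin ((x - x') / 4)) ^ 2.
  have e : cos (x / 2 - x' / 2) = 1 - 2 * sin ((x - x') / 4) * sin ((x - x') / 4).
    by rewrite -cos_2a_sin; congr cos; field.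
  rewrite cos_minus in e; have := sin2_cos2 (x / 2); have := sin2_cos2 (x' / 2); rewrite /Rsqr; nra.
have h1 := abs_le_3_abs_sin hk; rewrite sin_sub_mult_PI in h1.
set u := cos (x / 2) - cos (x' / 2) in ck *; set v := sin (x / 2) - sin (x' / 2) in ck *.
have h2 : Rabs (2 * sin ((x - x') / 4)) <= Rabs u + Rabs v.
  have u0 := Rabs_pos u; have v0 := Rabs_pos v; apply: abs_le_sqr; first lra.
  by rewrite -ck -(pow2_abs u) -(pow2_abs v); nra.
rewrite Rabs_mult (Rabs_pos_eq 2) in h2; last lra.
have -> : x - (x' + 4 * IZR k * PI) = 4 * ((x - x') / 4 - IZR k * PI) by field.
by rewrite Rabs_mult (Rabs_pos_eq 4); lra.
Qed.

Lemma half_angle_zero x : exists k : Z, Rabs (x - 2 * IZR k * PI) <= 6 * Rabs (sin (x / 2)).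
Proof.
have [k hk] := nearest_mult_PI (x / 2); exists k.
have h1 := abs_le_3_abs_sin hk; rewrite sin_sub_mult_PI in h1.
have -> : x - 2 * IZR k * PI = 2 * (x / 2 - IZR k * PI) by field.
by rewrite Rabs_mult (Rabs_pos_eq 2); lra.
Qed.

Lemma periodic_Z (h : R -> R) : (forall q, h (q + 2 * PI) = h q) ->
  forall (k : Z) q, h (q + 2 * IZR k * PI) = h q.
Proof.
move=> per.
have pn (n : nat) q : h (q + 2 * INR n * PI) = h q.
  elim: n => [|n IH]; first by congr h; rewrite /=; ring.
  rewrite -[RHS]IH -(per (q + 2 * INR n * PI)); congr h; rewrite S_INR; ring.
move=> k q; case: (Z_le_gt_dec 0 k) => hk.
  by rewrite -(Z2Nat.id k) // -INR_IZR_INZ.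
have -> : IZR k = - INR (Z.to_nat (- k)) by rewrite INR_IZR_INZ Z2Nat.id ?opp_IZR; [ring | lia].
rewrite -(pn (Z.to_nat (- k))); congr h; ring.
Qed.

(** * Uniform bounds for periodic coefficients, [q] being unbounded *)

Section Strip.
Variables (d : nat) (g : vec d -> R -> R -> R) (M : R).
Hypothesis an : real_analytic g.
Hypothesis per : forall y p q, g y p (q + 2 * PI) = g y p q.

Lemma packed_pack y p q : packed g (pack y p q) = g y p q.
Proof.
rewrite /packed pack_ip pack_iq; congr (g _ p q).
by apply: functional_extensionality => j; rewrite pack_iy.
Qed.

Definition in_strip (z : 'I_d.+2 -> R) := Rabs (z ip) <= M /\ forall j, Rabs (z (iy j)) <= M.

Lemma strip_regular : exists C, forall z, in_strip z -> regular_at (packed g) z C.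
Proof.
have [C hC] := regular_box (Rmax M 4) (analytic_smooth an); exists C => z [hp hy].
have mM := Rmax_l M 4; have m4 := Rmax_r M 4.
(* Periodicity brings [q] back to [|q| <= 4], hence [z] to a compact box. *)
have [k hk] := nearest_mult_PI (z iq / 2).
pose w i := z i + (if i == iq then - (2 * IZR k * PI) else 0).
have wq : w iq = z iq - 2 * IZR k * PI by rewrite /w eqxx; ring.
have wp : w ip = z ip by rewrite /w /=; ring.
have wy j : w (iy j) = z (iy j) by rewrite /w /=; ring.
have box i : Rabs (w i) <= Rmax M 4.
  move: i; apply: index_cases; rewrite ?wp ?wq.
  - by apply: Rle_trans hp _.
  - have -> : z iq - 2 * IZR k * PI = 2 * (z iq / 2 - IZR k * PI) by field.
    by rewrite Rabs_mult (Rabs_pos_eq 2); lra.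
  - by move=> j; rewrite wy; apply: Rle_trans (hy j) _.
have pw v : packed g (fun i => v i + (if i == iq then - (2 * IZR k * PI) else 0)) = packed g v.
  rewrite /packed /= -(@periodic_Z _ (per _ _) k).
  have -> : (fun j => v (iy j) + 0) = (fun j => v (iy j)) by apply: functional_extensionality => j; ring.
  by congr (g _ _ _); rewrite /= ?eqxx; ring.
have [C0 [h1 [D [h2 h3]]]] := hC w box.
split=> //; split; first by rewrite -pw.
exists D; split=> // z' hz'.
have sh : shift w (fun i => z' i + (if i == iq then - (2 * IZR k * PI) else 0)) = shift z z'.
  by apply: functional_extensionality => i; rewrite /shift /w; ring.
have [] := h3 (fun i => z' i + (if i == iq then - (2 * IZR k * PI) else 0)).
  by move=> i; have := congr1 (fun v => v i) sh; rewrite {1}/shift /= => ->; exact: hz'.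
by rewrite sh pw /w pw.
Qed.

Lemma strip_lipschitz C : (forall z, in_strip z -> regular_at (packed g) z C) ->
  forall y p q y' p' q', (forall j, Rabs (y j) <= M) -> Rabs p <= M ->
  (forall j, Rabs (y' j) <= M) -> Rabs p' <= M ->
  Rabs (g y p q - g y' p' q') <= C * (norm1 (fun j => y j - y' j) + Rabs (p - p') + Rabs (q - q')).
Proof.
move=> reg y p q y' p' q' hy hp hy' hp'; rewrite -(packed_pack y) -(packed_pack y').
have -> : norm1 (fun j => y j - y' j) + Rabs (p - p') + Rabs (q - q') = norm1 (shift (pack y' p' q') (pack y p q)).
  rewrite /norm1 rsum_packed /shift !pack_ip !pack_iq -Rplus_assoc [RHS]Rplus_comm -Rplus_assoc.
  by congr (_ + _ + _); apply: rsum_ext => j; rewrite !pack_iy.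
apply: regular_lipschitz => s hs; apply: reg.
have cv x x' : Rabs x <= M -> Rabs x' <= M -> Rabs (x + s * (x' - x)) <= M.
  by move=> /Rabs_le_between ? /Rabs_le_between ?; apply: Rabs_le; nra.
by split=> [|j]; rewrite ?pack_ip ?pack_iy; exact: cv.
Qed.

Lemma strip_circle_lipschitz C : 0 <= C -> (forall z, in_strip z -> regular_at (packed g) z C) ->
  forall y p q y' p' q', (forall j, Rabs (y j) <= M) -> Rabs p <= M ->
  (forall j, Rabs (y' j) <= M) -> Rabs p' <= M ->
  Rabs (g y p q - g y' p' q') <= C * (norm1 (fun j => y j - y' j) + Rabs (p - p') +
    6 * (Rabs (cos (q / 2) - cos (q' / 2)) + Rabs (sin (q / 2) - sin (q' / 2)))).
Proof.
move=> C0 reg y p q y' p' q' hy hp hy' hp'.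
have [k hk] := half_angle_chord q q'.
have -> : g y' p' q' = g y' p' (q' + 4 * IZR k * PI).
  by rewrite -(@periodic_Z _ (per _ _) (2 * k)%Z) mult_IZR; congr g; ring.
apply: Rle_trans (strip_lipschitz reg _ _ hy hp hy' hp') _.
by apply: Rmult_le_compat_l => //; lra.
Qed.

Lemma strip_circle_zero C : 0 <= C -> (forall z, in_strip z -> regular_at (packed g) z C) ->
  forall y p q, (forall j, Rabs (y j) <= M) -> Rabs p <= M ->
  Rabs (g y p q - g y p 0) <= C * (6 * Rabs (sin (q / 2))).
Proof.
move=> C0 reg y p q hy hp; have [k hk] := half_angle_zero q.
rewrite -(@periodic_Z _ (per y p) k 0).
apply: Rle_trans (strip_lipschitz reg _ _ hy hp hy hp) _; apply: Rmult_le_compat_l => //.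
rewrite /norm1 (@rsum_ext _ _ (fun=> 0)) => [|j]; last by rewrite Rminus_diag Rabs_R0.
by rewrite rsum_const Rminus_diag Rabs_R0 Rplus_0_l; lra.
Qed.

End Strip.

Lemma is_derive_of_eps (f : R -> R) t l :
  (forall e, 0 < e -> exists dl, 0 < dl /\ forall s, Rabs (s - t) < dl ->
    Rabs (f s - f t - l * (s - t)) <= e * Rabs (s - t)) -> is_derive f t l.
Proof.
move=> h; apply/is_derive_Reals => e e0.
have [dl [dl0 hdl]] := h (e / 2) ltac:(lra).
exists (mkposreal dl dl0) => s s0 hs.
have := hdl (t + s); have -> : t + s - t = s by ring.
move=> /(_ hs) h1; have sp := Rabs_pos_lt _ s0.
have -> : (f (t + s) - f t) / s - l = (f (t + s) - f t - l * s) / s by field.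
rewrite Rabs_div //; apply/Rlt_div_l => //.
by apply: Rle_lt_trans h1 _; nra.
Qed.

Lemma common_radius (T : finType) (x : T -> R) : (forall i, 0 < x i) ->
  exists r, 0 < r /\ forall i, r <= x i.
Proof.
move=> x0; have xi i : 0 < / x i by exact: Rinv_0_lt_compat.
have s0 : 0 <= rsum (fun i => / x i) by apply: rsum_ge0 => i; have := xi i; lra.
exists (/ (1 + rsum (fun i => / x i))); split => [|i]; first by apply: Rinv_0_lt_compat; lra.
rewrite -[X in _ <= X]Rinv_inv; apply: Rinv_le_contravar => //.
by have := @rsum_term _ (fun i => / x i) i (fun i => Rlt_le _ _ (xi i)); lra.
Qed.

Lemma regular_chain m (G : ('I_m -> R) -> R) (z : R -> 'I_m -> R) t (v D : 'I_m -> R) C : 0 < C ->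
  (forall z', close (/ C) (z t) z' ->
     Rabs (G z' - G (z t) - dot D (shift (z t) z')) <= C * norm1 (shift (z t) z') ^ 2) ->
  (forall i, is_derive (fun s => z s i) t (v i)) ->
  is_derive (fun s => G (z s)) t (dot D v).
Proof.
move=> C0 hG hz.
pose V := rsum (fun i => 1 + Rabs (v i)).
have V0 : 0 <= V by apply: rsum_ge0 => i; have := Rabs_pos (v i); lra.
have lin : is_derive (fun s => dot D (shift (z t) (z s))) t (dot D v).
  apply: is_derive_rsum => i; rewrite /shift.
  have -> : D i * v i = D i * (v i - 0) by ring.
  apply: (is_derive_scal (fun s => z s i - z t i)).
  exact: (is_derive_minus (fun s => z s i) (fun=> z t i) _ _ _ (hz i) (is_derive_const _ _)).
have near i : exists dl, 0 < dl /\ forall s, Rabs (s - t) < dl ->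
    Rabs (z s i - z t i) <= (1 + Rabs (v i)) * Rabs (s - t).
  have [dl [dl0 h]] := derive_eps (hz i) Rlt_0_1; exists dl; split=> // s hs.
  have -> : z s i - z t i = (z s i - z t i - v i * (s - t)) + v i * (s - t) by ring.
  apply: Rle_trans (Rabs_triang _ _) _; rewrite Rabs_mult; have := h s hs; lra.
have [dl hdl] := fin_all_exists near.
have [r [r0 hr]] := common_radius (fun i => proj1 (hdl i)).
have nb s : Rabs (s - t) < r -> norm1 (shift (z t) (z s)) <= V * Rabs (s - t).
  move=> hs; rewrite Rmult_comm -rsum_scal; apply: rsum_le => i.
  rewrite Rmult_comm; apply: (proj2 (hdl i)); have := hr i; lra.
apply: is_derive_of_eps => e e0.
have [d1 [d10 h1]] := derive_eps lin (e := e / 2) ltac:(lra).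
(* The first bound keeps the curve where the expansion is valid, the second makes the quadratic
   remainder at most [e / 2] times [|s - t|]. *)
pose b := Rmin (/ (C * (1 + V))) (e / (2 * C * (1 + V ^ 2))).
have V2 := pow2_ge_0 V.
have b0 : 0 < b.
  apply: Rmin_glb_lt; first by apply: Rinv_0_lt_compat; nra.
  by apply: Rdiv_lt_0_compat => //; apply: Rmult_lt_0_compat; lra.
have b1 : b <= / (C * (1 + V)) by exact: Rmin_l.
have b2 : b <= e / (2 * C * (1 + V ^ 2)) by exact: Rmin_r.
exists (Rmin d1 (Rmin r b)); split; first by apply: Rmin_glb_lt => //; exact: Rmin_glb_lt.
move=> s hs; have hsd : Rabs (s - t) < d1 by apply: Rlt_le_trans hs (Rmin_l _ _).
have hs2 : Rabs (s - t) < Rmin r b by apply: Rlt_le_trans hs (Rmin_r _ _).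
have hsr : Rabs (s - t) < r by apply: Rlt_le_trans hs2 (Rmin_l _ _).
have hsb : Rabs (s - t) < b by apply: Rlt_le_trans hs2 (Rmin_r _ _).
have ns := nb s hsr; have n0 := norm1_ge0 (shift (z t) (z s)); have st := Rabs_pos (s - t).
have cl : close (/ C) (z t) (z s).
  move=> i; rewrite -/(shift (z t) (z s) i).
  apply: Rle_lt_trans (_ : norm1 (shift (z t) (z s)) < _).
    by apply: (@rsum_term _ (fun k => Rabs (shift (z t) (z s) k))) => k; exact: Rabs_pos.
  have : (1 + V) * Rabs (s - t) < (1 + V) * / (C * (1 + V)) by apply: Rmult_lt_compat_l; lra.
  have -> : (1 + V) * / (C * (1 + V)) = / C by field; lra.
  by nra.
have h2 := hG _ cl.
have h3 := h1 s hsd.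
have e1 : dot D (shift (z t) (z t)) = 0.
  by rewrite /dot (@rsum_ext _ _ (fun=> 0)) ?rsum_const => [|i]; rewrite /shift; ring.
rewrite e1 Rminus_0_r in h3.
have -> : G (z s) - G (z t) - dot D v * (s - t) = (G (z s) - G (z t) - dot D (shift (z t) (z s))) +
  (dot D (shift (z t) (z s)) - dot D v * (s - t)) by ring.
apply: Rle_trans (add_bound h2 h3) _.
have n2 : norm1 (shift (z t) (z s)) ^ 2 <= (V * Rabs (s - t)) ^ 2 by apply: pow_incr.
have : C * norm1 (shift (z t) (z s)) ^ 2 <= e / 2 * Rabs (s - t); last lra.
apply: Rle_trans (Rmult_le_compat_l _ _ _ (Rlt_le _ _ C0) n2) _.
have -> : C * (V * Rabs (s - t)) ^ 2 = C * V ^ 2 * Rabs (s - t) * Rabs (s - t) by ring.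
apply: Rmult_le_compat_r => //.
have h4 : C * (1 + V ^ 2) * Rabs (s - t) <= C * (1 + V ^ 2) * (e / (2 * C * (1 + V ^ 2))).
  by apply: Rmult_le_compat_l; nra.
have e2 : C * (1 + V ^ 2) * (e / (2 * C * (1 + V ^ 2))) = e / 2 by field; lra.
by nra.
Qed.

(* What is used of a coefficient on the strip [|y j|, |p| <= M]. *)
Record tame (d : nat) (M C : R) (g : vec d -> R -> R -> R) (D : vec d -> R -> R -> 'I_d.+2 -> R) : Prop := {
  t_gt0 : 0 < C;
  t_val : forall y p q, (forall j, Rabs (y j) <= M) -> Rabs p <= M -> Rabs (g y p q) <= C;
  t_grad : forall y p q i, (forall j, Rabs (y j) <= M) -> Rabs p <= M -> Rabs (D y p q i) <= C;
  t_lip : forall y p q y' p' q', (forall j, Rabs (y j) <= M) -> Rabs p <= M ->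
    (forall j, Rabs (y' j) <= M) -> Rabs p' <= M ->
    Rabs (g y p q - g y' p' q') <= C * (norm1 (fun j => y j - y' j) + Rabs (p - p') +
      Rabs (cos (q / 2) - cos (q' / 2)) + Rabs (sin (q / 2) - sin (q' / 2)));
  t_zero : forall y p q, (forall j, Rabs (y j) <= M) -> Rabs p <= M ->
    Rabs (g y p q - g y p 0) <= C * Rabs (sin (q / 2));
  t_chain : forall (y : R -> vec d) (p q : R -> R) t (vy : vec d) vp vq,
    (forall j, Rabs (y t j) <= M) -> Rabs (p t) <= M ->
    (forall j, is_derive (fun s => y s j) t (vy j)) -> is_derive p t vp -> is_derive q t vq ->
    is_derive (fun s => g (y s) (p s) (q s)) t
      (dot (fun j => D (y t) (p t) (q t) (iy j)) vy + D (y t) (p t) (q t) ip * vp + D (y t) (p t) (q t) iq * vq)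
}.

Lemma tame_le d M C C' g D : C <= C' -> @tame d M C g D -> tame M C' g D.
Proof.
move=> CC [C0 h1 h2 h3 h4 h5]; split=> //.
- lra.
- by move=> y p q hy hp; apply: Rle_trans (h1 _ _ _ hy hp) CC.
- by move=> y p q i hy hp; apply: Rle_trans (h2 _ _ _ _ hy hp) CC.
- move=> y p q y' p' q' hy hp hy' hp'; apply: Rle_trans (h3 _ _ _ _ _ _ hy hp hy' hp') _.
  apply: Rmult_le_compat_r => //; repeat apply: Rplus_le_le_0_compat; try exact: Rabs_pos.
  exact: norm1_ge0.
- move=> y p q hy hp; apply: Rle_trans (h4 _ _ _ hy hp) _.
  by apply: Rmult_le_compat_r => //; exact: Rabs_pos.
Qed.

Lemma tame_zero d M : @tame d M 1 (fun _ _ _ => 0) (fun _ _ _ _ => 0).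
Proof.
have n0 (v : vec d) := norm1_ge0 v.
split; try by move=> *; rewrite ?Rminus_diag ?Rabs_R0; lra.
- move=> y p q y' p' q' _ _ _ _; rewrite Rminus_diag Rabs_R0 Rmult_1_l.
  repeat apply: Rplus_le_le_0_compat; try exact: Rabs_pos; exact: n0.
- by move=> y p q _ _; rewrite Rminus_diag Rabs_R0 Rmult_1_l; exact: Rabs_pos.
move=> y p q t vy vp vq _ _ _ _ _.
rewrite dot_0; have -> : 0 + 0 * vp + 0 * vq = 0 by ring.
exact: is_derive_const.
Qed.

Lemma analytic_tame d (g : vec d -> R -> R -> R) M : real_analytic g ->
  (forall y p q, g y p (q + 2 * PI) = g y p q) -> exists C D, tame M C g D.
Proof.
move=> an per; have [C0 reg0] := strip_regular M an per.
pose C := Rabs C0 + 1; have Cp : 0 < C by rewrite /C; have := Rabs_pos C0; lra.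
have reg z : in_strip M z -> regular_at (packed g) z C.
  by move=> hz; apply: regular_mono (reg0 z hz); rewrite /C; have := Rle_abs C0; lra.
pose PD z D := (forall i, Rabs (D i) <= C) /\
    forall z', close (/ C) z z' -> Rabs (packed g z' - packed g z) <= C * norm1 (shift z z') /\
      Rabs (packed g z' - packed g z - dot D (shift z z')) <= C * norm1 (shift z z') ^ 2.
pose D y p q := epsilon (inhabits (fun=> 0)) (PD (pack y p q)).
have strip (y : vec d) p q : (forall j, Rabs (y j) <= M) -> Rabs p <= M -> in_strip M (pack y p q).
  by move=> hy hp; split=> [|j]; rewrite ?pack_ip ?pack_iy.
have hD y p q : (forall j, Rabs (y j) <= M) -> Rabs p <= M -> PD (pack y p q) (D y p q).
  by move=> hy hp; apply: epsilon_spec; have [_ [_ h]] := reg _ (strip y p q hy hp).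
have C0' : 0 <= C by lra.
(* The 6 is that of [half_angle_chord] and [half_angle_zero]. *)
exists (6 * C), D; split.
- lra.
- move=> y p q hy hp; have [_ [h _]] := reg _ (strip y p q hy hp).
  by rewrite packed_pack in h; lra.
- by move=> y p q i hy hp; have [h _] := hD y p q hy hp; have := h i; lra.
- move=> y p q y' p' q' hy hp hy' hp'.
  apply: Rle_trans (strip_circle_lipschitz per C0' reg q q' hy hp hy' hp') _.
  have := norm1_ge0 (fun j => y j - y' j); have := Rabs_pos (p - p'); nra.
- move=> y p q hy hp; apply: Rle_trans (strip_circle_zero per C0' reg q hy hp) _.
  by right; ring.
move=> y p q t vy vp vq hy hp dy dp dq.
have [_ h] := hD (y t) (p t) (q t) hy hp.
have -> : dot (fun j => D (y t) (p t) (q t) (iy j)) vy + D (y t) (p t) (q t) ip * vp + D (y t) (p t) (q t) iq * vq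
  = dot (D (y t) (p t) (q t)) (pack vy vp vq).
  rewrite /dot rsum_packed pack_ip pack_iq [RHS]Rplus_comm.
  rewrite (@rsum_ext _ (fun j => D (y t) (p t) (q t) (iy j) * pack vy vp vq (iy j))
     (fun j => D (y t) (p t) (q t) (iy j) * vy j)) => [|j]; last by rewrite pack_iy.
  ring.
apply: (is_derive_ext (fun s => packed g (pack (y s) (p s) (q s)))); first by move=> s; exact: packed_pack.
apply: (regular_chain (z := fun s => pack (y s) (p s) (q s)) Cp) => [z' hz'|].
  exact: (proj2 (h z' hz')).
by apply: index_cases => [||j]; rewrite ?pack_ip ?pack_iq ?pack_iy;
  apply: is_derive_ext; [ | exact: dp | | exact: dq | | exact: dy]; move=> s; rewrite ?pack_ip ?pack_iq ?pack_iy.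
Qed.

(** * From solutions to orbits *)

Definition harmonic (d : nat) (n : 'I_d -> Z) (l : Z) (phi : vec d) (t : R) := zdot n phi + IZR l * t.

Section Trigonometric.
Variables (d : nat) (T : finType) (nz : T -> 'I_d -> Z) (lz : T -> Z).
Variables (re im : T -> vec d -> R -> R -> R) (Dre Dim : T -> vec d -> R -> R -> 'I_d.+2 -> R).
Variables (M C : R).
Hypothesis re_tame : forall i, tame M C (re i) (Dre i).
Hypothesis im_tame : forall i, tame M C (im i) (Dim i).

Definition trig (y phi : vec d) (p q t : R) := rsum (fun i =>
  re i y p q * cos (harmonic (nz i) (lz i) phi t) - im i y p q * sin (harmonic (nz i) (lz i) phi t)).

Definition slope (y phi : vec d) (p q t : R) (m : 'I_d.+2) := rsum (fun i =>
  Dre i y p q m * cos (harmonic (nz i) (lz i) phi t) - Dim i y p q m * sin (harmonic (nz i) (lz i) phi t)).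

(** Minus the derivative of the mode [i] with respect to its phase: multiplied by [n_j] it is the
    contribution of this mode to the force on [I_j], and multiplied by [l] the one to - df/dt. *)
Definition force (i : T) (y phi : vec d) (p q t : R) :=
  re i y p q * sin (harmonic (nz i) (lz i) phi t) + im i y p q * cos (harmonic (nz i) (lz i) phi t).

Lemma is_derive_harmonic n l (phi : R -> vec d) (tau : R -> R) t vphi vtau :
  (forall j, is_derive (fun s => phi s j) t (vphi j)) -> is_derive tau t vtau ->
  is_derive (fun s => harmonic n l (phi s) (tau s)) t (dot (fun j => IZR (n j)) vphi + IZR l * vtau).
Proof.
move=> dphi dtau; apply: (is_derive_plus (fun s => zdot n (phi s))).
  by apply: is_derive_rsum => j; exact: (is_derive_scal (fun s => phi s j)).
exact: is_derive_scal.
Qed.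

Lemma is_derive_cos_sin (r i th : R -> R) t vr vi vth :
  is_derive r t vr -> is_derive i t vi -> is_derive th t vth ->
  is_derive (fun s => r s * cos (th s) - i s * sin (th s)) t
    (vr * cos (th t) - vi * sin (th t) - (r t * sin (th t) + i t * cos (th t)) * vth).
Proof.
move=> dr di dth; auto_derive.
  by split; [exists vr | split; [exists vth | split; [exists vi | split; [exists vth|]]]].
rewrite (is_derive_unique _ _ _ dr) (is_derive_unique _ _ _ di) (is_derive_unique _ _ _ dth).
ring.
Qed.

(** All arguments move at once, time included under the name [tau]. The four partial derivatives of
    the system are special cases, with all arguments but one constant, and the energy balance is the
    case of a solution. *)
Lemma trig_chain (y phi : R -> vec d) (p q tau : R -> R) t vy vphi vp vq vtau :
  (forall j, Rabs (y t j) <= M) -> Rabs (p t) <= M ->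
  (forall j, is_derive (fun s => y s j) t (vy j)) -> (forall j, is_derive (fun s => phi s j) t (vphi j)) ->
  is_derive p t vp -> is_derive q t vq -> is_derive tau t vtau ->
  is_derive (fun s => trig (y s) (phi s) (p s) (q s) (tau s)) t
    (dot (fun j => slope (y t) (phi t) (p t) (q t) (tau t) (iy j)) vy +
     slope (y t) (phi t) (p t) (q t) (tau t) ip * vp + slope (y t) (phi t) (p t) (q t) (tau t) iq * vq -
     rsum (fun i => force i (y t) (phi t) (p t) (q t) (tau t) *
        (dot (fun j => IZR (nz i j)) vphi + IZR (lz i) * vtau))).
Proof.
move=> hy hp dy dphi dp dq dtau.
pose ch (D : T -> vec d -> R -> R -> 'I_d.+2 -> R) i := dot (fun j => D i (y t) (p t) (q t) (iy j)) vy +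
  D i (y t) (p t) (q t) ip * vp + D i (y t) (p t) (q t) iq * vq.
have -> : dot (fun j => slope (y t) (phi t) (p t) (q t) (tau t) (iy j)) vy +
     slope (y t) (phi t) (p t) (q t) (tau t) ip * vp + slope (y t) (phi t) (p t) (q t) (tau t) iq * vq -
     rsum (fun i => force i (y t) (phi t) (p t) (q t) (tau t) *
        (dot (fun j => IZR (nz i j)) vphi + IZR (lz i) * vtau)) =
  rsum (fun i => ch Dre i * cos (harmonic (nz i) (lz i) (phi t) (tau t)) -
    ch Dim i * sin (harmonic (nz i) (lz i) (phi t) (tau t)) -
    force i (y t) (phi t) (p t) (q t) (tau t) * (dot (fun j => IZR (nz i j)) vphi + IZR (lz i) * vtau)).
  rewrite rsum_sub; congr (_ - _).
  rewrite (_ : dot (fun j => slope _ _ _ _ _ (iy j)) vy = rsum (fun i =>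
    dot (fun j => Dre i (y t) (p t) (q t) (iy j)) vy * cos (harmonic (nz i) (lz i) (phi t) (tau t)) -
    dot (fun j => Dim i (y t) (p t) (q t) (iy j)) vy * sin (harmonic (nz i) (lz i) (phi t) (tau t)))).
    rewrite /slope Rmult_comm -rsum_scal (Rmult_comm (rsum _) vq) -rsum_scal -!rsum_add.
    by apply: rsum_ext => i; rewrite /ch; ring.
  rewrite /dot /slope.
  rewrite (@rsum_ext _ _ (fun j => rsum (fun i => (Dre i (y t) (p t) (q t) (iy j) * cos (harmonic (nz i) (lz i) (phi t) (tau t)) -
      Dim i (y t) (p t) (q t) (iy j) * sin (harmonic (nz i) (lz i) (phi t) (tau t))) * vy j))); last first.
    by move=> j; rewrite Rmult_comm -rsum_scal; apply: rsum_ext => i; ring.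
  rewrite rsum_exchange; apply: rsum_ext => i.
  rewrite Rmult_comm -rsum_scal (Rmult_comm _ (sin _)) -rsum_scal -rsum_sub.
  by apply: rsum_ext => j; ring.
apply: is_derive_rsum => i; apply: is_derive_cos_sin.
- exact: (t_chain (re_tame i) hy hp dy dp dq).
- exact: (t_chain (im_tame i) hy hp dy dp dq).
exact: is_derive_harmonic.
Qed.

Lemma upd_id (y : vec d) j : upd y j (y j) = y.
Proof. by apply: functional_extensionality => k; rewrite /upd; case: eqP => [->|]. Qed.

Lemma is_derive_upd (y : vec d) j k x : is_derive (fun s => upd y j s k) x (if k == j then 1 else 0).
Proof. by rewrite /upd; case: (k == j); [exact: is_derive_id | exact: is_derive_const]. Qed.

Lemma dot_delta (v : vec d) j : dot v (fun k => if k == j then 1 else 0) = v j.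
Proof. by rewrite (dot_single j v 1); ring. Qed.

Lemma dot_zero (v : vec d) : dot v (fun=> 0) = 0.
Proof. by rewrite /dot (@rsum_ext _ _ (fun=> 0)) ?rsum_const => [|j]; ring. Qed.

Variables (y phi : vec d) (p q t : R).
Hypotheses (hy : forall j, Rabs (y j) <= M) (hp : Rabs p <= M).

Let cst (x : R) (s : R) : is_derive (fun=> x) s 0 := is_derive_const x s.

Lemma rsum_force_zero : rsum (fun i => force i y phi p q t *
  (dot (fun j => IZR (nz i j)) (fun=> 0) + IZR (lz i) * 0)) = 0.
Proof. by rewrite (@rsum_ext _ _ (fun=> 0)) ?rsum_const => [|i]; rewrite ?dot_zero; ring. Qed.

Lemma dI_trig j : dI trig y phi p q t j = slope y phi p q t (iy j).
Proof.
apply: is_derive_unique.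
have hy' k : Rabs (upd y j (y j) k) <= M by rewrite upd_id.
have := trig_chain (y := upd y j) (phi := fun=> phi) (p := fun=> p) (q := fun=> q) (tau := fun=> t)
  hy' hp (fun k => is_derive_upd y j k (y j)) (fun k => cst (phi k) _) (cst p _) (cst q _) (cst t _).
by rewrite upd_id dot_delta rsum_force_zero !Rmult_0_r !Rplus_0_r Rminus_0_r.
Qed.

Lemma dp_trig : dp trig y phi p q t = slope y phi p q t ip.
Proof.
apply: is_derive_unique.
have := trig_chain (y := fun=> y) (phi := fun=> phi) (p := fun s => s) (q := fun=> q) (tau := fun=> t) (t := p)
  hy hp (fun k => cst (y k) _) (fun k => cst (phi k) _) (is_derive_id _) (cst q _) (cst t _).
by rewrite dot_zero rsum_force_zero !Rmult_0_r Rmult_1_r !Rplus_0_r Rplus_0_l Rminus_0_r.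
Qed.

Lemma dq_trig : dq trig y phi p q t = slope y phi p q t iq.
Proof.
apply: is_derive_unique.
have := trig_chain (y := fun=> y) (phi := fun=> phi) (p := fun=> p) (q := fun s => s) (tau := fun=> t) (t := q)
  hy hp (fun k => cst (y k) _) (fun k => cst (phi k) _) (cst p _) (is_derive_id _) (cst t _).
by rewrite dot_zero rsum_force_zero !Rmult_0_r Rmult_1_r !Rplus_0_l Rminus_0_r.
Qed.

Lemma dphi_trig j : dphi trig y phi p q t j = - rsum (fun i => IZR (nz i j) * force i y phi p q t).
Proof.
apply: is_derive_unique.
have := trig_chain (y := fun=> y) (phi := upd phi j) (p := fun=> p) (q := fun=> q) (tau := fun=> t) (t := phi j)
  hy hp (fun k => cst (y k) _) (fun k => is_derive_upd phi j k (phi j)) (cst p _) (cst q _) (cst t _).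
rewrite upd_id dot_zero !Rmult_0_r !Rplus_0_r Rminus_0_l.
rewrite (@rsum_ext _ _ (fun i => IZR (nz i j) * force i y phi p q t)) // => i.
by rewrite dot_delta; ring.
Qed.

Lemma slope_bound m : Rabs (slope y phi p q t m) <= INR #|T| * (2 * C).
Proof.
apply: rsum_bound => i; have -> : 2 * C = C * 1 + C * 1 by ring.
by apply: sub_bound; apply: mul_bound; [exact: (t_grad (re_tame i)) | exact: abs_cos_le
  | exact: (t_grad (im_tame i)) | exact: abs_sin_le].
Qed.

Lemma trig_bound : Rabs (trig y phi p q t) <= INR #|T| * (2 * C).
Proof.
apply: rsum_bound => i; have -> : 2 * C = C * 1 + C * 1 by ring.
by apply: sub_bound; apply: mul_bound; [exact: (t_val (re_tame i)) | exact: abs_cos_le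
  | exact: (t_val (im_tame i)) | exact: abs_sin_le].
Qed.

Lemma force_bound i : Rabs (force i y phi p q t) <= 2 * C.
Proof.
have -> : 2 * C = C * 1 + C * 1 by ring.
by apply: add_bound; apply: mul_bound; [exact: (t_val (re_tame i)) | exact: abs_sin_le
  | exact: (t_val (im_tame i)) | exact: abs_cos_le].
Qed.

End Trigonometric.

(** Used twice: on time, to extend the harmonics continuously beyond the interval before integrating
    them, and on the momentum, because [orbit] asks for bounds up to [|y| <= K] while the
    coefficients are controlled only up to [M < K]. *)
Definition clamp (lo hi x : R) := Rmax lo (Rmin hi x).

Lemma clamp_in lo hi x : lo <= hi -> lo <= clamp lo hi x <= hi.
Proof.
by rewrite /clamp /Rmax /Rmin => h; case: Rle_dec; case: Rle_dec => *; lra.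
Qed.

Lemma clamp_id lo hi x : lo <= x <= hi -> clamp lo hi x = x.
Proof.
by rewrite /clamp /Rmax /Rmin => h; case: Rle_dec; case: Rle_dec => *; lra.
Qed.

Lemma clamp_lip lo hi x x' : lo <= hi -> Rabs (clamp lo hi x - clamp lo hi x') <= Rabs (x - x').
Proof.
rewrite /clamp /Rmax /Rmin => h.
by repeat destruct (Rle_dec _ _); split_Rabs; lra.
Qed.

Lemma continuous_of_eps (f : R -> R) t :
  (forall e, 0 < e -> exists dl, 0 < dl /\ forall s, Rabs (s - t) < dl -> Rabs (f s - f t) < e) ->
  continuous f t.
Proof.
move=> h; apply/filterlim_locally => e; have [dl [dl0 hdl]] := h e (cond_pos e).
by exists (mkposreal dl dl0) => s hs; exact: hdl.
Qed.

Lemma continuous_clamp lo hi x : lo <= hi -> continuous (clamp lo hi) x.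
Proof.
move=> h; apply: continuous_of_eps => e e0; exists e; split=> // s hs.
exact: Rle_lt_trans (clamp_lip s x h) hs.
Qed.

Section OrbitOfSolution.
Variables (d : nat) (T : finType) (nz : T -> 'I_d -> Z) (lz : T -> Z).
Variables (re im : T -> vec d -> R -> R -> R) (Dre Dim : T -> vec d -> R -> R -> 'I_d.+2 -> R).
Variables (M C L : R).
Hypothesis re_tame : forall i, tame M C (re i) (Dre i).
Hypothesis im_tame : forall i, tame M C (im i) (Dim i).
Hypothesis nz_le : forall i j, Rabs (IZR (nz i j)) <= L.
Hypothesis lz_le : forall i, Rabs (IZR (lz i)) <= L.
Hypotheses (M0 : 0 <= M) (L0 : 0 <= L) (C0 : 0 < C).

Let W := INR #|T|.
Let B := W * (2 * C).
(** A sum of nonnegative terms that dominates the bound required by each field of [orbit]. In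
    particular [M + 2 <= K] gives the bound on the energy, and the product after [C] accounts for
    the motion of the actions in the Lipschitz bounds in time. *)
Definition orbit_constant := 2 + INR d + W + L + M + B + C + C * (INR d * (W * (L * (2 * C)))) + INR d * (L * B).
Let K := orbit_constant.

Lemma orbit_constant_ge : 2 <= K /\ INR d <= K /\ W <= K /\ L <= K /\ M + 2 <= K /\ B <= K /\ C <= K /\
  C + C * (INR d * (W * (L * (2 * C)))) <= K /\ INR d * (L * B) <= K.
Proof.
have W0 : 0 <= W := pos_INR _; have d0 := pos_INR d.
have B0 : 0 <= B by apply: Rmult_le_pos; lra.
have h1 : 0 <= INR d * (L * B) by apply: Rmult_le_pos => //; exact: Rmult_le_pos.
have h2 : 0 <= C * (INR d * (W * (L * (2 * C)))).
  by repeat (apply: Rmult_le_pos => //); lra.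
by rewrite /K /orbit_constant; repeat split; lra.
Qed.

Variables (mu a b a' b' : R) (y phi : R -> vec d) (p q : R -> R).
Hypotheses (mu0 : 0 <= mu) (aa : a < a') (bb : b' < b) (ab : a' <= b').
Hypothesis sol : solves (trig nz lz re im) mu a b y phi p q.
Hypothesis y_le : forall t, a' <= t <= b' -> forall j, Rabs (y t j) <= M.
Hypothesis p_le : forall t, a' <= t <= b' -> Rabs (p t) <= M.

Let th i t := harmonic (nz i) (lz i) (phi t) t.
Let c i t := force nz lz re im i (y t) (phi t) (p t) (q t) t.
Let A t := slope nz lz Dre Dim (y t) (phi t) (p t) (q t) t.

Lemma equations t : a' <= t <= b' ->
  (forall j, is_derive (fun s => phi s j) t (y t j + mu * A t (iy j))) /\
  (forall j, is_derive (fun s => y s j) t (mu * rsum (fun i => IZR (nz i j) * c i t))) /\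
  is_derive q t (p t + mu * A t ip) /\ is_derive p t (sin (q t) - mu * A t iq).
Proof.
move=> ht; have [h1 [h2 [h3 h4]]] := sol (t := t) ltac:(lra).
have hy := y_le ht; have hp := p_le ht.
rewrite (dp_trig nz lz re_tame im_tame _ _ _ hy hp) in h3.
rewrite (dq_trig nz lz re_tame im_tame _ _ _ hy hp) in h4.
split=> [j|]; first by have := h1 j; rewrite (dI_trig nz lz re_tame im_tame _ _ _ hy hp).
split=> // j; have := h2 j; rewrite (dphi_trig nz lz re_tame im_tame _ _ _ hy hp).
by rewrite Ropp_mult_distr_r Ropp_involutive.
Qed.

Lemma A_bound t m : a' <= t <= b' -> Rabs (A t m) <= B.
Proof. by move=> ht; exact: (slope_bound nz lz re_tame im_tame _ _ _ (y_le ht) (p_le ht)). Qed.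

Lemma force_le i t : a' <= t <= b' -> Rabs (c i t) <= 2 * C.
Proof. by move=> ht; exact: (force_bound nz lz re_tame im_tame _ _ _ (y_le ht) (p_le ht)). Qed.

Lemma is_derive_th i t : a' <= t <= b' ->
  is_derive (th i) t (dot (fun j => IZR (nz i j)) (fun j => y t j + mu * A t (iy j)) + IZR (lz i) * 1).
Proof.
move=> ht; have [h1 _] := equations ht.
by apply: (is_derive_harmonic (nz i) (lz i) h1); exact: is_derive_id.
Qed.

Lemma continuous_force i t : a' <= t <= b' -> continuous (c i) t.
Proof.
move=> ht; have [h1 [h2 [h3 h4]]] := equations ht; have hth := continuous_is_derive (is_derive_th i ht).
apply: cont_plus; apply: cont_mult.
- exact: continuous_is_derive (t_chain (re_tame i) (y_le ht) (p_le ht) h2 h4 h3).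
- apply: (continuous_comp (th i) sin) => //; exact: continuous_sin.
- exact: continuous_is_derive (t_chain (im_tame i) (y_le ht) (p_le ht) h2 h4 h3).
apply: (continuous_comp (th i) cos) => //; exact: continuous_cos.
Qed.

Lemma action_lip t t' : a' <= t <= b' -> a' <= t' <= b' ->
  norm1 (fun j => y t j - y t' j) <= INR d * (W * (L * (2 * C))) * (mu * Rabs (t - t')).
Proof.
move=> ht ht'; rewrite -{3}(card_ord d) Rmult_assoc -rsum_const; apply: rsum_le => j.
have key s s' : a' <= s -> s' <= b' -> s <= s' -> Rabs (y s' j - y s j) <= W * (L * (2 * C)) * (mu * Rabs (s' - s)).
  move=> hs hs' ss; rewrite (Rabs_pos_eq (s' - s)); last lra.
  rewrite -Rmult_assoc; apply: (@derive_bound (fun r => y r j) (fun r => mu * rsum (fun i => IZR (nz i j) * c i r))) => // r hr.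
    by have [_ [h _]] := equations (t := r) ltac:(lra).
  rewrite Rmult_comm; apply: mul_bound; last by rewrite Rabs_pos_eq; lra.
  by apply: rsum_bound => i; apply: mul_bound => //; apply: force_le; lra.
case: (Rle_lt_dec t t') => tt; last by apply: key; lra.
by rewrite Rabs_minus_sym (Rabs_minus_sym t); apply: key; lra.
Qed.

Let acc i := RInt (fun s => mu * c i (clamp a' b' s)) 0.

Lemma is_derive_acc i t : a' <= t <= b' -> is_derive (acc i) t (mu * c i t).
Proof.
move=> ht; rewrite -{2}(clamp_id ht).
apply: (is_derive_prim (f := fun s => mu * c i (clamp a' b' s))) => s.
apply: cont_mult; first exact: cont_cst.
apply: (continuous_comp (clamp a' b') (c i)); first exact: continuous_clamp.
by apply: continuous_force; exact: clamp_in.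
Qed.

(* Autonomy of the extended Hamiltonian: only the explicit time derivative of [f] survives. *)
Lemma is_derive_total_energy t : a' <= t <= b' ->
  is_derive (fun s => energy (p s) (q s) + mu * trig nz lz re im (y s) (phi s) (p s) (q s) s + dot (y s) (y s) / 2) t
    (- (mu * rsum (fun i => IZR (lz i) * c i t))).
Proof.
move=> ht; have [h1 [h2 [h3 h4]]] := equations ht.
set vy := fun j => mu * rsum (fun i => IZR (nz i j) * c i t) in h2.
set vphi := fun j => y t j + mu * A t (iy j) in h1.
set vq := p t + _ in h3; set vp := sin (q t) - _ in h4.
have dE : is_derive (fun s => energy (p s) (q s)) t (p t * vp - sin (q t) * vq).
  rewrite /energy; auto_derive; first (split; [exists vp; exact: h4 | split; [exists vq; exact: h3 | exact: Logic.I]]).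
  by rewrite (is_derive_unique _ _ _ h3) (is_derive_unique _ _ _ h4); field.
have df := trig_chain nz lz re_tame im_tame (y_le ht) (p_le ht) h2 h1 h4 h3 (is_derive_id t).
have dI : is_derive (fun s => dot (y s) (y s) / 2) t (dot (y t) vy).
  have -> : dot (y t) vy = (dot vy (y t) + dot (y t) vy) / 2.
    have -> : dot vy (y t) = dot (y t) vy by apply: rsum_ext => j; ring.
    field.
  apply: (is_derive_ext (fun s => / 2 * dot (y s) (y s))); first by move=> s; rewrite /Rdiv Rmult_comm.
  rewrite /Rdiv Rmult_comm; apply: is_derive_scal; rewrite /dot -rsum_add.
  by apply: is_derive_rsum => j; exact: (is_derive_mult (fun s => y s j) (fun s => y s j) _ _ _ (h2 j) (h2 j) Rmult_comm).
have -> : - (mu * rsum (fun i => IZR (lz i) * c i t)) =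
  p t * vp - sin (q t) * vq + mu * (dot (fun j => A t (iy j)) vy + A t ip * vp + A t iq * vq -
    rsum (fun i => c i t * (dot (fun j => IZR (nz i j)) vphi + IZR (lz i) * 1))) + dot (y t) vy.
  have e1 v : dot v vy = mu * rsum (fun i => c i t * dot (fun j => IZR (nz i j)) v).
    rewrite /dot /vy -rsum_scal.
    rewrite (@rsum_ext _ (fun i => mu * (c i t * rsum (fun j => IZR (nz i j) * v j)))
       (fun i => rsum (fun j => v j * (mu * (IZR (nz i j) * c i t))))); last first.
      by move=> i; rewrite -!rsum_scal; apply: rsum_ext => j; ring.
    rewrite rsum_exchange; apply: rsum_ext => j.
    by rewrite -!rsum_scal; apply: rsum_ext => i; ring.
  rewrite !e1.
  rewrite (@rsum_ext _ (fun i => c i t * (dot (fun j => IZR (nz i j)) vphi + IZR (lz i) * 1))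
    (fun i => c i t * dot (fun j => IZR (nz i j)) (y t) + (mu * (c i t * dot (fun j => IZR (nz i j)) (fun j => A t (iy j)))
       + IZR (lz i) * c i t))).
    by rewrite rsum_add rsum_add rsum_scal /vp /vq; ring.
  by move=> i; rewrite /vphi dot_comb; ring.
apply: (is_derive_plus (fun s => energy (p s) (q s) + mu * trig nz lz re im (y s) (phi s) (p s) (q s) s)) dI.
apply: (is_derive_plus (fun s => energy (p s) (q s))) dE _.
exact: is_derive_scal.
Qed.

Lemma orbit_of_solution : orbit (fun i j => IZR (nz i j)) (fun i => IZR (lz i)) K mu a' b' y p q th c acc
  (fun t => trig nz lz re im (y t) (phi t) (p t) (q t) t)
  (fun i t v x => re i (y t) (clamp (- M) M v) x) (fun i t v x => im i (y t) (clamp (- M) M v) x).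
Proof.
have [K1 [K2 [K3 [K4 [K5 [K6 [K7 [K8 K9]]]]]]]] := orbit_constant_ge.
have cM v : Rabs (clamp (- M) M v) <= M by apply/Rabs_le_between; apply: clamp_in; lra.
have cp t : a' <= t <= b' -> clamp (- M) M (p t) = p t.
  by move=> ht; apply: clamp_id; apply/Rabs_le_between; exact: p_le.
have lip g D : tame M C g D -> forall t t' v v' x x', a' <= t <= b' -> a' <= t' <= b' ->
    Rabs (g (y t) (clamp (- M) M v) x - g (y t') (clamp (- M) M v') x') <= K * (mu * Rabs (t - t') + Rabs (v - v') +
      Rabs (cos (x / 2) - cos (x' / 2)) + Rabs (sin (x / 2) - sin (x' / 2))).
  move=> tg t t' v v' x x' ht ht'.
  apply: Rle_trans (t_lip tg x x' (y_le ht) (cM v) (y_le ht') (cM v')) _.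
  have h1 := action_lip ht ht'; have h2 := @clamp_lip (- M) M v v' ltac:(lra).
  have m0 : 0 <= mu * Rabs (t - t') by apply: Rmult_le_pos => //; exact: Rabs_pos.
  have := Rabs_pos (v - v'); have := Rabs_pos (cos (x / 2) - cos (x' / 2)); have := Rabs_pos (sin (x / 2) - sin (x' / 2)).
  move: (Rabs (sin _ - _)) (Rabs (cos _ - _)) (Rabs (v - v')) h2 => S Co V h2 S0 Co0 V0.
  have h3 := Rmult_le_compat_l _ _ _ (Rlt_le _ _ C0) h1.
  have h4 := Rmult_le_compat_l _ _ _ (Rlt_le _ _ C0) h2.
  have h5 := Rmult_le_compat_r _ _ _ m0 K8; have h6 := Rmult_le_compat_r _ _ _ S0 K7.
  have h7 := Rmult_le_compat_r _ _ _ Co0 K7; have h8 := Rmult_le_compat_r _ _ _ V0 K7.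
  have h9 : 0 <= C * (mu * Rabs (t - t')) by apply: Rmult_le_pos; lra.
  rewrite !Rmult_plus_distr_l; lra.
have val g D : tame M C g D -> forall t v x, a' <= t <= b' -> Rabs (g (y t) (clamp (- M) M v) x) <= K.
  by move=> tg t v x ht; have := t_val tg x (y_le ht) (cM v); lra.
have zero g D : tame M C g D -> forall t v x, a' <= t <= b' ->
    Rabs (g (y t) (clamp (- M) M v) x - g (y t) (clamp (- M) M v) 0) <= K * Rabs (sin (x / 2)).
  move=> tg t v x ht; apply: Rle_trans (t_zero tg x (y_le ht) (cM v)) _.
  by apply: Rmult_le_compat_r => //; exact: Rabs_pos.
split=> //.
- by move=> i j; exact: Rle_trans (nz_le i j) K4.
- by move=> i; exact: Rle_trans (lz_le i) K4.
- by move=> t j ht; have := y_le ht j; lra.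
- move=> t ht; have := p_le ht; rewrite /energy => hp.
  have : p t ^ 2 <= M ^ 2 by rewrite -(pow2_abs (p t)); apply: pow_incr; split=> //; exact: Rabs_pos.
  by have := COS_bound (q t); nra.
- move=> t ht; have := trig_bound nz lz re_tame im_tame (phi t) (q t) t (y_le ht) (p_le ht); rewrite -/W -/B; lra.
- by move=> i t v x ht _; exact: val (re_tame i) _ _ _ ht.
- by move=> i t v x ht _; exact: val (im_tame i) _ _ _ ht.
- by move=> i t t' v v' x x' ht ht' _ _; exact: lip (re_tame i) _ _ _ _ _ _ ht ht'.
- by move=> i t t' v v' x x' ht ht' _ _; exact: lip (im_tame i) _ _ _ _ _ _ ht ht'.
- by move=> i t v x ht _; exact: zero (re_tame i) _ _ _ ht.
- by move=> i t v x ht _; exact: zero (im_tame i) _ _ _ ht.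
- by move=> i t ht; rewrite cp.
- by move=> i t ht; exact: is_derive_acc.
- by move=> t j ht; have [_ [h _]] := equations ht.
- move=> i t ht; eexists; split; first exact: is_derive_th.
  rewrite /frequency dot_comb.
  have -> : dot (fun j => IZR (nz i j)) (y t) + mu * dot (fun j => IZR (nz i j)) (fun j => A t (iy j)) + IZR (lz i) * 1 -
    (dot (fun j => IZR (nz i j)) (y t) + IZR (lz i)) = dot (fun j => IZR (nz i j)) (fun j => A t (iy j)) * mu by ring.
  apply: mul_bound; last by rewrite Rabs_pos_eq; lra.
  apply: Rle_trans K9; rewrite -{5}(card_ord d); apply: rsum_bound => j.
  by apply: mul_bound => //; exact: A_bound.
- move=> t ht; have [_ [_ [h _]]] := equations ht; eexists; split; first exact: h.
  have -> : p t + mu * A t ip - p t = A t ip * mu by ring.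
  apply: mul_bound; last by rewrite Rabs_pos_eq; lra.
  by have := A_bound ip ht; lra.
- move=> t ht; have [_ [_ [_ h]]] := equations ht; eexists; split; first exact: h.
  have -> : sin (q t) - mu * A t iq - sin (q t) = - (A t iq * mu) by ring.
  rewrite Rabs_Ropp; apply: mul_bound; last by rewrite Rabs_pos_eq; lra.
  by have := A_bound iq ht; lra.
move=> t ht; eexists; split; first exact: is_derive_total_energy.
rewrite Rplus_opp_l Rabs_R0; apply: Rmult_le_pos; [lra | exact: pow2_ge_0].
Qed.

End OrbitOfSolution.

Lemma coord_le_enorm d (x : vec d) j : Rabs (x j) <= enorm x.
Proof.
rewrite -sqrt_Rsqr_abs; apply: sqrt_le_1_alt.
by apply: (@rsum_term _ (fun j => x j * x j)) => k; exact: Rle_0_sqr.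
Qed.

Lemma enorm_le_norm1 d (x : vec d) : enorm x <= norm1 x.
Proof.
have n0 := norm1_ge0 x; rewrite -(sqrt_Rsqr _ n0); apply: sqrt_le_1_alt.
rewrite /Rsqr {1}/norm1 Rmult_comm -rsum_scal; apply: rsum_le => j.
have hj : Rabs (x j) <= norm1 x by apply: (@rsum_term _ (fun j => Rabs (x j))) => k; exact: Rabs_pos.
have -> : x j * x j = Rabs (x j) * Rabs (x j) by rewrite -Rabs_mult Rabs_pos_eq //; exact: Rle_0_sqr.
by apply: Rmult_le_compat_r => //; exact: Rabs_pos.
Qed.

Lemma zof_le N (k : 'I_(N + N).+1) : Rabs (IZR (zof k)) <= INR N.
Proof.
rewrite INR_IZR_INZ -abs_IZR; apply: IZR_le; rewrite /zof.
by move: (nat_of_ord k) (ltn_ord k) => m /ltP; rewrite -plusE; lia.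
Qed.

Section Coefficients.
Variables (d N : nat) (fre fim : ('I_d -> Z) -> Z -> vec d -> R -> R -> R).

Definition mode : finType := ({ffun 'I_d -> 'I_(N + N).+1} * 'I_(N + N).+1)%type.
Definition mode_n (i : mode) (j : 'I_d) : Z := zof (i.1 j).
Definition mode_l (i : mode) : Z := zof i.2.
(** Extending the coefficients by 0 turns the conditional double sum into a sum over one finite
    type, the index set of the resonances. *)
Definition coefficient (f : ('I_d -> Z) -> Z -> vec d -> R -> R -> R) (i : mode) : vec d -> R -> R -> R :=
  if (freq_norm (mode_n i) (mode_l i) <= N)%nat then f (mode_n i) (mode_l i) else fun _ _ _ => 0.

Lemma trig_f_trig : trig_f N fre fim = trig mode_n mode_l (coefficient fre) (coefficient fim).
Proof.
apply: functional_extensionality => y; apply: functional_extensionality => phi.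
apply: functional_extensionality => p; apply: functional_extensionality => q.
apply: functional_extensionality => t.
rewrite /trig_f /trig /rsum.
rewrite (eq_bigr (fun k => \big[Rplus/0]_(l0 < (N + N).+1)
   (coefficient fre (k, l0) y p q * cos (harmonic (mode_n (k, l0)) (mode_l (k, l0)) phi t) -
    coefficient fim (k, l0) y p q * sin (harmonic (mode_n (k, l0)) (mode_l (k, l0)) phi t)))).
  by rewrite pair_bigA; apply: eq_bigr => -[].
move=> k _; rewrite big_mkcond; apply: eq_bigr => l0 _; rewrite /coefficient /mode_n /mode_l /=.
by case: ifP => _ //; ring.
Qed.

Lemma coefficients_tame (f : ('I_d -> Z) -> Z -> vec d -> R -> R -> R) M :
  (forall n l, (freq_norm n l <= N)%nat -> real_analytic (f n l)) ->
  (forall n l, (freq_norm n l <= N)%nat -> forall I p q, f n l I p (q + 2 * PI) = f n l I p q) ->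
  exists C D, 0 < C /\ forall i, tame M C (coefficient f i) (D i).
Proof.
move=> an per.
have one i : exists C, exists D, tame M C (coefficient f i) D.
  rewrite /coefficient; case: ifP => hi; first by apply: analytic_tame; [exact: an | exact: per].
  by exists 1, (fun _ _ _ _ => 0); exact: tame_zero.
have [C hC] := fin_all_exists one; have [D hD] := fin_all_exists hC.
have C0 i : 0 <= C i by have := t_gt0 (hD i); lra.
exists (1 + rsum C), D; split; first by have := rsum_ge0 C0; lra.
by move=> i; apply: tame_le (hD i); have := rsum_term i C0; lra.
Qed.

End Coefficients.

Theorem theorem1p2 (d N : nat) (hd : (1 <= d)%nat)
  (fre fim : ('I_d -> Z) -> Z -> vec d -> R -> R -> R)
  (Han : forall n l, (freq_norm n l <= N)%nat ->
           real_analytic (fre n l) /\ real_analytic (fim n l))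
  (Hper : forall n l, (freq_norm n l <= N)%nat -> forall I p q,
           fre n l I p (q + 2 * PI) = fre n l I p q /\
           fim n l I p (q + 2 * PI) = fim n l I p q)
  (Hreal : forall n l, (freq_norm n l <= N)%nat -> forall I p q,
           fre (fun j => (- n j)%Z) (- l)%Z I p q = fre n l I p q /\
           fim (fun j => (- n j)%Z) (- l)%Z I p q = - fim n l I p q)
  (kappa rbar rtil : R) (hkappa : 0 < kappa) (hrbar : 0 < rbar) (hrtil : 0 < rtil) :
  exists mu1 kappa0 : R, 0 < mu1 /\ 0 < kappa0 /\
    forall mu : R, 0 < mu <= mu1 ->
    forall (a b : R) (I phi : R -> vec d) (p q : R -> R),
      a < 0 < b ->
      solves (trig_f N fre fim) mu a b I phi p q ->
      enorm (I 0) <= rbar -> Rabs (p 0) <= rtil ->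
      forall t, a < t < b -> Rabs t <= kappa0 / mu * ln (1 / mu) ->
        enorm (vsub (I t) (I 0)) <= kappa.

Proof.
(* Room for a drift of 1: the actions grow by at most 1, and [p ^ 2] by at most 6, namely twice the
   variation of the energy plus twice that of [cos q]. *)
pose M := rbar + rtil + 3.
have Han_re n l : (freq_norm n l <= N)%nat -> real_analytic (fre n l) by move=> h; case: (Han n l h).
have Han_im n l : (freq_norm n l <= N)%nat -> real_analytic (fim n l) by move=> h; case: (Han n l h).
have Hper_re n l : (freq_norm n l <= N)%nat -> forall I p q, fre n l I p (q + 2 * PI) = fre n l I p q.
  by move=> h I p q; case: (Hper n l h I p q).
have Hper_im n l : (freq_norm n l <= N)%nat -> forall I p q, fim n l I p (q + 2 * PI) = fim n l I p q.
  by move=> h I p q; case: (Hper n l h I p q).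
have [C1 [Dre [C10 tame1]]] := coefficients_tame M Han_re Hper_re.
have [C2 [Dim [C20 tame2]]] := coefficients_tame M Han_im Hper_im.
pose C := C1 + C2; have C0 : 0 < C by rewrite /C; lra.
have re_tame i : tame M C (coefficient fre i) (Dre i) by apply: tame_le (tame1 i); rewrite /C; lra.
have im_tame i : tame M C (coefficient fim i) (Dim i) by apply: tame_le (tame2 i); rewrite /C; lra.
have M0 : 0 <= M by rewrite /M; lra.
have nl (i : mode d N) j : Rabs (IZR (mode_n i j)) <= INR N by exact: zof_le.
have ll (i : mode d N) : Rabs (IZR (mode_l i)) <= INR N by exact: zof_le.
have N0 := pos_INR N.
pose K := orbit_constant d (mode d N) M C (INR N).
have K2 : 2 <= K by have [] := @orbit_constant_ge d (mode d N) M C (INR N) M0 N0 C0.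
(* At most 1 to remain in the strip where the coefficients are controlled, at most [kappa] for the
   conclusion. *)
pose r := Rmin 1 kappa.
have r0 : 0 < r by apply: Rmin_glb_lt; lra.
have r1 : r <= 1 by exact: Rmin_l.
have rk : r <= kappa by exact: Rmin_r.
have [mu1 [kappa0 [mu10 [k00 stable]]]] :=
  @orbit_stable d (mode d N) (fun i j => IZR (mode_n i j)) K (r / 2) K2 ltac:(lra).
exists mu1, kappa0; split=> //; split=> // mu hmu a b I phi p q hab sol hI hp t ht htk.
pose E s := energy (p s) (q s).
(* The energy is monitored together with the actions, since it is what keeps [p] bounded. *)
pose dist s := norm1 (fun j => I 0 j - I s j) + Rabs (E 0 - E s).
have dist0 : dist 0 = 0.
  rewrite /dist /norm1 (@rsum_ext _ _ (fun=> 0)) ?rsum_const => [|j]; last by rewrite Rminus_diag Rabs_R0.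
  by rewrite Rminus_diag Rabs_R0; ring.
have tin s : Rmin 0 t <= s <= Rmax 0 t -> a < s < b.
  by rewrite /Rmin /Rmax; case: Rle_dec => ? ?; lra.
have abs_cont (g : R -> R) s : continuous g s -> continuous (fun x => Rabs (g 0 - g x)) s.
  move=> cg; apply: (continuous_comp (fun x => g 0 - g x) Rabs); last exact: continuous_Rabs.
  by apply: cont_minus => //; exact: cont_cst.
have cdist s : Rmin 0 t <= s <= Rmax 0 t -> continuous dist s.
  move=> hs; have [_ [dI [dq dp]]] := sol s (tin s hs).
  apply: cont_plus.
    by apply: continuous_rsum => j; apply: (abs_cont (fun x => I x j)); exact: continuous_is_derive (dI j).
  apply: (abs_cont E); rewrite /E /energy.
  have cp := continuous_is_derive dp; have cq := continuous_is_derive dq.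
  apply: cont_minus; last exact: cont_cst.
  apply: cont_plus; last by apply: (continuous_comp q cos) => //; exact: continuous_cos.
  apply: (continuous_comp p (fun x => x ^ 2 / 2)) => //.
  by apply: ex_derive_continuous; auto_derive.
have in_strip s : dist s <= r -> (forall j, Rabs (I s j) <= M) /\ Rabs (p s) <= M.
  rewrite /dist => hs; have n0 := norm1_ge0 (fun j => I 0 j - I s j); have e0 := Rabs_pos (E 0 - E s).
  split=> [j|].
    have h1 := coord_le_enorm (I 0) j.
    have h2 : Rabs (I 0 j - I s j) <= norm1 (fun j => I 0 j - I s j).
      by apply: (@rsum_term _ (fun j => Rabs (I 0 j - I s j))) => k; exact: Rabs_pos.
    have -> : I s j = I 0 j - (I 0 j - I s j) by ring.
    apply: Rle_trans (sub_bound h1 h2) _; rewrite /M; lra.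
  have p02 : p 0 ^ 2 <= rtil ^ 2 by rewrite -(pow2_abs (p 0)); apply: pow_incr; split=> //; exact: Rabs_pos.
  have hE : Rabs (E 0 - E s) <= 1 by lra.
  move/Rabs_le_between: hE; rewrite /E /energy => hE.
  have := COS_bound (q 0); have := COS_bound (q s) => c1 c2.
  apply: abs_le_sqr => //; rewrite /M; nra.
(* Bootstrap from time 0: while [dist <= r] the solution stays in the strip and is an orbit with
   constant [K], and [stable] returns the better bound [r / 2]. *)
have main s : Rmin 0 t <= s <= Rmax 0 t -> dist s <= r / 2.
  apply: (bootstrap (t0 := 0) r0) => //.
  - by split; [exact: Rmin_l | exact: Rmax_l].
  - by rewrite dist0; lra.
  move=> {}s hs hdist.
  have sub x : Rmin 0 s <= x <= Rmax 0 s -> Rmin 0 t <= x <= Rmax 0 t.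
    by move: hs; rewrite /Rmin /Rmax; do 2 case: Rle_dec => ?; lra.
  have mm : Rmin 0 s <= 0 <= Rmax 0 s by split; [exact: Rmin_l | exact: Rmax_l].
  have ms : Rmin 0 s <= s <= Rmax 0 s by split; [exact: Rmin_r | exact: Rmax_r].
  have [la _] := tin _ (sub (Rmin 0 s) ltac:(lra)).
  have [_ lb] := tin _ (sub (Rmax 0 s) ltac:(lra)).
  rewrite trig_f_trig in sol.
  have orb := orbit_of_solution re_tame im_tame nl ll M0 N0 C0 (Rlt_le _ _ (proj1 hmu)) la lb ltac:(lra) sol
    (fun x hx => proj1 (in_strip x (hdist x hx))) (fun x hx => proj2 (in_strip x (hdist x hx))).
  apply: (stable _ _ _ _ _ _ _ _ _ _ _ _ _ hmu orb mm _ _ ms).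
  have st : Rabs s <= Rabs t.
    by move: hs; rewrite /Rmin /Rmax /Rabs; case: Rle_dec => ?; do 2 case: Rcase_abs => ?; lra.
  have -> : Rmax 0 s - Rmin 0 s = Rabs s.
    by rewrite /Rmin /Rmax /Rabs; case: Rle_dec => ?; case: Rcase_abs => ?; lra.
  have := Rabs_pos t; lra.
have ts : Rmin 0 t <= t <= Rmax 0 t by split; [exact: Rmin_r | exact: Rmax_r].
apply: Rle_trans (enorm_le_norm1 _) _.
have -> : norm1 (vsub (I t) (I 0)) = norm1 (fun j => I 0 j - I t j).
  by apply: rsum_ext => j; rewrite /vsub Rabs_minus_sym.
by have := main t ts; have := Rabs_pos (E 0 - E t); rewrite /dist; lra.
Qed.
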